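(* Let $\Omega\subset\mathbb{R}^d$ be a bounded convex domain with $C^{2,1}$ boundary, let $U\in C^2(\overline\Omega)$, and let $\mu$ be the probability measure on $\Omega\times\mathbb{R}^d$ with density proportional to $e^{-\frac12|v|^2-U(x)}$. Let $\mathscr L_a:=v\cdot\nabla_x-\nabla_xU\cdot\nabla_v$, and let $\mathscr C$ be the specular class defined in the context. Then for all $f,g\in\mathscr C$, $$\langle\mathscr L_af,g\rangle_{L^2(\mu)}=-\langle f,\mathscr L_ag\rangle_{L^2(\mu)} .$$
   Context: $n(x)$ is the outward unit normal at $x\in\partial\Omega$, and $R_xv:=v-2(v\cdot n(x))\,n(x)$. The specular class $\mathscr C$ is the set of $f\in C^2(\overline\Omega\times\mathbb{R}^d)$ such that, for some $N\in(0,\infty)$ and constants $C_\alpha<\infty$ depending on $f$, $|\partial^\alpha f(x,v)|\le C_\alpha(1+|v|)^N$ for all $(x,v)\in\overline\Omega\times\mathbb{R}^d$ and all multi-indices $|\alpha|\le2$ (mixed derivatives in $(x,v)$), and $f(x,v)=f(x,R_xv)$ for all $x\in\partial\Omega$, $v\in\mathbb{R}^d$. A bounded open set has $C^{2,1}$ boundary if its boundary is locally the graph of a $C^2$ function with Lipschitz second derivatives, with the set lying locally on one side. *)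

(* Defs.v *)
From HB Require Import structures.
From mathcomp Require Import all_boot all_order all_algebra.
From mathcomp Require Import all_classical all_reals all_analysis.
Import Order.TTheory GRing.Theory Num.Theory.
Import numFieldNormedType.Exports.

Set Implicit Arguments.
Unset Strict Implicit.
Unset Printing Implicit Defensive.

Local Open Scope classical_set_scope.
Local Open Scope ring_scope.

(* The norm of the normed module 'rV[R]_n is the sup norm; it is used only
   through the topology it induces. Lengths and angles are Euclidean. *)
Definition dotv {R : realType} {n} (u v : 'rV[R]_n) : R :=
  \sum_(i < n) u 0 i * v 0 i.

Definition enorm {R : realType} {n} (u : 'rV[R]_n) : R :=
  Num.sqrt (dotv u u).

(* 'rV[R]_n carries the sigma-algebra generated by its coordinates. *)
Definition coord_rV {R : realType} {n} (i : 'I_n) (x : 'rV[R]_n) : R := x 0 i.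

Definition measure_rV_display : measure_display.
Proof. exact: default_measure_display. Qed.

Section measurable_rV.
Context {R : realType} (n : nat).

Let coords : 'I_n -> 'rV[R]_n -> R := @coord_rV R n.

Let rV_set0 : g_sigma_preimage coords set0.
Proof. exact: sigma_algebra0. Qed.

Let rV_setC A : g_sigma_preimage coords A -> g_sigma_preimage coords (~` A).
Proof. exact: sigma_algebraC. Qed.

Let rV_bigcup (F : (set 'rV[R]_n)^nat) :
  (forall i, g_sigma_preimage coords (F i)) ->
  g_sigma_preimage coords (\bigcup_i (F i)).
Proof. exact: sigma_algebra_bigcup. Qed.

HB.instance Definition _ := @isMeasurable.Build measure_rV_display
  'rV[R]_n (g_sigma_preimage coords) rV_set0 rV_setC rV_bigcup.

End measurable_rV.

Lemma measurable_coord_rV {R : realType} n (i : 'I_n) :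
  measurable_fun [set: 'rV[R]_n] (coord_rV i).
Proof.
move=> _ Y mY; rewrite setTI; apply: sub_sigma_algebra => /=.
rewrite -bigcup_seq/=; exists i => /=; first by rewrite mem_index_enum.
by exists Y => //; rewrite setTI.
Qed.

Lemma measurable_fun_coord_rVP d (T : measurableType d) {R : realType} n
    (f : T -> 'rV[R]_n) :
  measurable_fun [set: T] f <->
  forall i, measurable_fun [set: T] (coord_rV i \o f).
Proof.
split=> [mf i|mf]; first exact: measurableT_comp (measurable_coord_rV i) mf.
move=> _ A mA; rewrite setTI.
have : preimage_set_system [set: T] f (g_sigma_preimage (@coord_rV R n))
         (f @^-1` A) by exists A => //; rewrite setTI.
rewrite -g_sigma_preimage_comp; apply: smallest_sub.
  exact: sigma_algebra_measurable.
case: n => [|n] in f mf A mA *; first by rewrite big_ord0.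
rewrite -bigcup_mkord_ord; apply: bigcup_sub => i Ii.
by move=> B [C mC <-]; exact: mf.
Qed.

Definition cons_rV {R : realType} {n} (p : R * 'rV[R]_n) : 'rV[R]_n.+1 :=
  row_mx p.1%:M p.2.

Definition uncons_rV {R : realType} {n} (x : 'rV[R]_n.+1) : R * 'rV[R]_n :=
  (x 0 0, rsubmx (x : 'rV[R]_(1 + n))).

Lemma cons_rVK {R : realType} n : cancel (@cons_rV R n) uncons_rV.
Proof.
move=> [a x]; rewrite /uncons_rV /cons_rV /= row_mxKr; congr (_, _).
have -> : (0 : 'I_n.+1) = lshift n (0 : 'I_1) by exact/val_inj.
by rewrite [LHS](@row_mxEl R 1 1 n) mxE eqxx.
Qed.

Lemma measurable_cons_rV {R : realType} n :
  measurable_fun [set: measurableTypeR R * 'rV[R]_n] cons_rV.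
Proof.
apply/measurable_fun_coord_rVP => i.
case: (splitP (i : 'I_(1 + n))) => [j ij|k ik].
  rewrite (_ : _ \o _ = fst) //; apply/funext => -[a x] /=.
  rewrite /coord_rV /cons_rV (_ : i = lshift n j); last exact/val_inj.
  by rewrite [LHS](@row_mxEl R 1 1 n) mxE ord1 eqxx.
rewrite (_ : _ \o _ = coord_rV k \o snd).
  exact: measurableT_comp (measurable_coord_rV k) measurable_snd.
apply/funext => -[a x] /=.
rewrite /coord_rV /cons_rV (_ : i = rshift 1 k); last exact/val_inj.
by rewrite [LHS](@row_mxEr R 1 1 n).
Qed.

Lemma measurable_uncons_rV {R : realType} n :
  measurable_fun [set: 'rV[R]_n.+1]
    (uncons_rV : _ -> measurableTypeR R * 'rV[R]_n).
Proof.
apply: measurable_fun_pair; first exact: (measurable_coord_rV 0).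
apply/measurable_fun_coord_rVP => i.
rewrite (_ : _ \o _ = coord_rV (rshift 1 i)); first exact: measurable_coord_rV.
by apply/funext => x /=; rewrite /coord_rV mxE.
Qed.

Section lebesgue_rV.
Context {R : realType}.
Local Open Scope ereal_scope.

Section step.
Context n (m : {sigma_finite_measure set 'rV[R]_n -> \bar R}).

Let step := pushforward (@lebesgue_measure R \x m) (@cons_rV R n).

Let measurable_preimage (A : set 'rV[R]_n.+1) :
  measurable A ->
  measurable (cons_rV @^-1` A : set (measurableTypeR R * 'rV[R]_n)).
Proof.
by move=> mA; rewrite -[X in measurable X]setTI; exact: measurable_cons_rV.
Qed.

Let step0 : step set0 = 0.
Proof. by rewrite /step /pushforward preimage_set0 measure0. Qed.

Let step_ge0 A : 0 <= step A.
Proof. by rewrite /step /pushforward; exact: measure_ge0. Qed.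

Let step_sigma_additive : semi_sigma_additive step.
Proof.
move=> F mF tF mUF; rewrite /step /pushforward preimage_bigcup.
apply: measure_semi_sigma_additive.
- by move=> k; exact: measurable_preimage.
- apply/trivIsetP => /= i j _ _ ij; rewrite -preimage_setI.
  by move/trivIsetP : tF => /(_ _ _ _ _ ij) ->//; rewrite preimage_set0.
- by rewrite -preimage_bigcup; exact: measurable_preimage.
Qed.

HB.instance Definition _ := isMeasure.Build _ _ _ step
  step0 step_ge0 step_sigma_additive.

Let step_sigma_finite : sigma_finite setT step.
Proof.
have /sigma_finiteP[F [TF ndF Foo]] := sigma_finiteT (@lebesgue_measure R).
have /sigma_finiteP[G [TG ndG Goo]] := sigma_finiteT m.
have mFG k : measurable (F k `*` G k).
  by apply: measurableX; [have [] := Foo k|have [] := Goo k].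
exists (fun k => uncons_rV @^-1` (F k `*` G k)).
  rewrite predeqE => x; split=> // _.
  have [k _ Fk] : (\bigcup_k F k) (uncons_rV x).1 by rewrite -TF.
  have [l _ Gl] : (\bigcup_k G k) (uncons_rV x).2 by rewrite -TG.
  exists (maxn k l) => //; split.
    by move: Fk; exact/subsetPset/ndF/leq_maxl.
  by move: Gl; exact/subsetPset/ndG/leq_maxr.
move=> k; split.
  by rewrite -[X in measurable X]setTI; exact: measurable_uncons_rV.
rewrite /step /pushforward -comp_preimage.
rewrite (_ : uncons_rV \o cons_rV = id); last exact/funext/cons_rVK.
have [mFk Fk] := Foo k; have [mGk Gk] := Goo k.
by rewrite preimage_id product_measure1E// lte_mul_pinfty// ge0_fin_numE.
Qed.

HB.instance Definition _ := Measure_isSigmaFinite.Build _ _ _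
  step step_sigma_finite.

Definition lebesgue_step : {sigma_finite_measure set 'rV[R]_n.+1 -> \bar R} :=
  step.

End step.

Fixpoint lebesgue_rV n : {sigma_finite_measure set 'rV[R]_n -> \bar R} :=
  match n with
  | 0 => dirac (0%R : 'rV[R]_0)
  | n'.+1 => lebesgue_step (lebesgue_rV n')
  end.

End lebesgue_rV.

Definition boundary {T : topologicalType} (A : set T) : set T :=
  closure A `\` interior A.

(* f is C^k up to the boundary of the open set A, with respect to the
   directions e: for every word s of length at most k, the iterated directional
   derivative of f along s exists in A and extends continuously to closure A;
   F s is that extension. All words are considered, so no symmetry of the mixed
   derivatives is presupposed. *)
Definition is_jet {R : realType} {V : normedModType R} {I : Type} (e : I -> V)
    (k : nat) (A : set V) (f : V -> R) (F : seq I -> V -> R) : Prop :=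
  [/\ forall z, closure A z -> F [::] z = f z,
      forall s i z, (size s < k)%N -> A z ->
        is_derive z (e i) (F s) (F (i :: s) z) &
      forall s, (size s <= k)%N -> {within closure A, continuous (F s)}].

Definition basis_rV {R : realType} {n} (i : 'I_n) : 'rV[R]_n := delta_mx 0 i.

Definition C2_closure {R : realType} {n} (A : set 'rV[R]_n) (f : 'rV[R]_n -> R)
    : Prop :=
  exists F, is_jet basis_rV 2 A f F.

(* In the Cartesian coordinates y = x *m Q, Omega is the region above the graph
   y_i = gamma(y') inside the (sup norm) ball of radius r around x0 *m Q, where
   y' = col' i y is y with its i-th coordinate removed. *)
Definition C21_chart {R : realType} {n} (Omega : set 'rV[R]_n) (x0 : 'rV[R]_n)
    (Q : 'M[R]_n) (i : 'I_n) (r : R) (gamma : 'rV[R]_n.-1 -> R) : Prop :=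
  [/\ Q *m Q^T = 1%:M,
      0 < r,
      exists2 G, is_jet basis_rV 2 (ball (col' i (x0 *m Q)) r) gamma G &
        forall j k,
          [lipschitz G [:: j; k] y' | y' in ball (col' i (x0 *m Q)) r] &
      forall y, ball (x0 *m Q) r y ->
        (Omega (y *m Q^T) <-> gamma (col' i y) < y 0 i) /\
        (boundary Omega (y *m Q^T) <-> gamma (col' i y) = y 0 i)].

Definition C21_boundary {R : realType} {n} (Omega : set 'rV[R]_n) : Prop :=
  forall x0, boundary Omega x0 ->
    exists Q i r gamma, C21_chart Omega x0 Q i r gamma.

(* The row vector (grad gamma(y'), -1), the entry -1 being the i-th one: it is
   normal to the graph y_i = gamma(y') and points below it. *)
Definition graph_conormal {R : realType} {n} (i : 'I_n)
    (gamma : 'rV[R]_n.-1 -> R) (y' : 'rV[R]_n.-1) : 'rV[R]_n :=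
  \row_j (if unlift i j is Some k then 'D_(basis_rV k) gamma y' else -1).

Definition is_outward_normal {R : realType} {n} (Omega : set 'rV[R]_n)
    (x n_x : 'rV[R]_n) : Prop :=
  exists Q i r gamma, C21_chart Omega x Q i r gamma /\
    let m := graph_conormal i gamma (col' i (x *m Q)) in
    n_x = (enorm m)^-1 *: (m *m Q^T).

Definition outward_normal {R : realType} {n} (Omega : set 'rV[R]_n)
    (x : 'rV[R]_n) : 'rV[R]_n :=
  xget 0 [set n_x | is_outward_normal Omega x n_x].

Definition reflect_velocity {R : realType} {n} (Omega : set 'rV[R]_n)
    (x v : 'rV[R]_n) : 'rV[R]_n :=
  v - (2 * dotv v (outward_normal Omega x)) *: outward_normal Omega x.

Section phase_space.
Context {R : realType} {d : nat}.
Local Notation V := 'rV[R]_d.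
Implicit Types (Omega : set V) (U : V -> R) (f g : V * V -> R).

Definition phase_basis (a : 'I_d + 'I_d) : V * V :=
  match a with
  | inl i => (basis_rV i, 0)
  | inr i => (0, basis_rV i)
  end.

Definition phase_domain Omega : set (V * V) := Omega `*` [set: V].

Definition specular_class Omega f : Prop :=
  (exists F N, [/\ is_jet phase_basis 2 (phase_domain Omega) f F,
      0 < N &
      forall s, (size s <= 2)%N -> exists C, forall x v,
        closure Omega x -> `|F s (x, v)| <= C * (1 + enorm v) `^ N]) /\
  (forall x v, boundary Omega x -> f (x, v) = f (x, reflect_velocity Omega x v)).

Definition liouville U f (z : V * V) : R :=
  \sum_(i < d) z.2 0 i * 'D_(phase_basis (inl i)) f z -
  \sum_(i < d) 'D_(basis_rV i) U z.1 * 'D_(phase_basis (inr i)) f z.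

(* mu is a measure on the whole phase space concentrated on
   phase_domain Omega; since mu has total mass 1, c is the inverse of the
   partition function. *)
Definition gibbs_measure Omega U (mu : probability (V * V)%type R) : Prop :=
  exists c : R, forall A, measurable A ->
    (mu A = \int[lebesgue_rV d \x lebesgue_rV d]_(z in A `&` phase_domain Omega)
              (c * expR (- (dotv z.2 z.2 / 2) - U z.1))%:E)%E.

Section L2.
Variables (Omega : set V) (mu : probability (V * V)%type R).

(* Functions are only meaningful on (the closure of) phase_domain Omega, hence
   are restricted to it. *)
Definition in_L2 f : Prop := f \_ (phase_domain Omega) \in Lfun mu 2%:E.

Definition L2_inner f g : R := \int[mu]_(z in phase_domain Omega) (f z * g z).

End L2.

End phase_space.

(* Main.v *)
(** Put H = f g w with w = exp (- |v|^2 / 2 - U). The product rule gives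
    (L_a f) g w + f (L_a g) w = v . grad_x H - grad U . grad_v H, because the two
    derivatives of w cancel; so it suffices that both terms on the right have
    integral 0 over Omega x R^d. No divergence theorem is used: if tau_n are
    measure preserving maps and n (F (tau_n z) - F z) converges dominatedly to
    G z, then the integral of G is 0.

    Velocity term: tau_n (x, v) = (x, v + b x / n) with b = grad U on Omega.

    Transport term: tau_n (x, v) = (x + v / n, v) applied to chi_k H, where
    chi_k = (1 - rho^k)^2 on Omega and rho is the gauge of the convex set Omega
    about an interior point. This yields int chi_k v . grad_x H = - int H v . grad
    chi_k. At x, grad rho is parallel to the outward normal at the radial
    projection y of x on the boundary, and v -> (v . n y) H (y, v) is odd under
    the reflection at y, hence integrates to 0. Replacing H (x, v) by
    H (x, v) - H (y, v) = O (1 - rho x) bounds the velocity integral of the right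
    hand side by a multiple of k rho^(k-1) (1 - rho), which is bounded by 1 and
    tends to 0. Let k tend to infinity. *)
From HB Require Import structures.
Require Import Defs.
From mathcomp Require Import all_boot all_order all_algebra.
From mathcomp Require Import all_classical all_reals all_analysis.
From mathcomp Require Import measurable_realfun ring lra.
Import Order.TTheory GRing.Theory Num.Theory.
Import numFieldNormedType.Exports.

Set Implicit Arguments.
Unset Strict Implicit.
Unset Printing Implicit Defensive.

Local Open Scope classical_set_scope.
Local Open Scope ring_scope.

(** The indicator of $\Omega$ cannot serve as the cutoff: its difference quotients along $x + v/n$
    are not dominated near the boundary. The gauge yields cutoffs from one global function, without
    a partition of unity or a surface measure: by homogeneity its derivatives at $x$ are those at
    the radial projection $y$, and these are read off from the side of the boundary on which a ray
    from $y$ starts. Only one-sided directional derivatives of $\rho$ are used, hence the transport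
    runs forward, with time steps $1/(n+1)$. The Lipschitz constant of $\chi_k$ grows with $k$, and
    the cancellation that compensates it appears only after the velocity integration; so the limit
    in $k$ of the flux is taken on an iterated integral, by dominated convergence in $x$ alone. All
    dominating functions are Gaussians $e^{-a|\cdot|^2}$, and $a$ records the losses: 1/2 in the
    weight, 1/4 after absorbing polynomial growth, 1/8 after absorbing a factor $|v|$ or a bounded
    shift of $v$, and 1/32 in both variables once part of the decay in velocity is traded for decay
    in position. *)

Local Notation pushforward_measure :=
  measure_function_pushforward__canonical__measure_function_Measure.

(** * Measure preserving maps *)

Section measure_preserving.
Context d (T : measurableType d) (R : realType).
Implicit Types (mu : {measure set T -> \bar R}) (phi : T -> T).

Definition measure_preserving mu phi :=
  measurable_fun [set: T] phi /\
  forall A, measurable A -> mu (phi @^-1` A) = mu A.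

Local Open Scope ereal_scope.

Lemma ge0_integral_mp mu phi (f : T -> \bar R) : measure_preserving mu phi ->
  measurable_fun setT f -> (forall x, 0 <= f x) ->
  \int[mu]_x f (phi x) = \int[mu]_x f x.
Proof.
move=> [mphi muphi] mf f0.
rewrite -[LHS](@ge0_integral_pushforward _ _ T T R phi mphi mu setT f)//.
apply: (@eq_measure_integral _ _ _ _ mu (pushforward_measure mu mphi)).
  by move=> A mA _; exact: muphi.
Qed.

Lemma integrable_mp mu phi (f : T -> \bar R) : measure_preserving mu phi ->
  mu.-integrable setT f -> mu.-integrable setT (f \o phi).
Proof.
move=> mp /integrableP[mf foo]; have [mphi _] := mp.
apply/integrableP; split; first exact: measurableT_comp.
rewrite (ge0_integral_mp mp (f := abse \o f))//.
  exact: measurableT_comp.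
by move=> x; exact: abse_ge0.
Qed.

Lemma integral_mp mu phi (f : T -> \bar R) : measure_preserving mu phi ->
  mu.-integrable setT f -> \int[mu]_x f (phi x) = \int[mu]_x f x.
Proof.
move=> mp fi; have [mphi muphi] := mp; have mf := measurable_int _ fi.
rewrite -[LHS](@integral_pushforward _ _ T T R phi mphi mu setT f)//.
  apply: (@eq_measure_integral _ _ _ _ mu (pushforward_measure mu mphi)).
  by move=> A mA _; exact: muphi.
exact: integrable_mp.
Qed.

Lemma mp_comp mu phi psi : measure_preserving mu phi ->
  measure_preserving mu psi -> measure_preserving mu (phi \o psi).
Proof.
move=> [mphi muphi] [mpsi mupsi]; split; first exact: measurableT_comp.
move=> A mA; rewrite comp_preimage mupsi ?muphi//.
by rewrite -[X in measurable X]setTI; exact: mphi.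
Qed.

End measure_preserving.

Section shear.
Context d1 d2 (T1 : measurableType d1) (T2 : measurableType d2) (R : realType).
Variable m1 : {sigma_finite_measure set T1 -> \bar R}.
Variable m2 : {sigma_finite_measure set T2 -> \bar R}.

(** The product measure integrates the measures of the sections at a fixed first coordinate, and the
    shear acts on the section at [x] through [S x]. *)
Lemma mp_shear_r (S : T1 -> T2 -> T2) :
  measurable_fun setT (fun z : T1 * T2 => (z.1, S z.1 z.2)) ->
  (forall x, measure_preserving m2 (S x)) ->
  measure_preserving (m1 \x m2)%E (fun z => (z.1, S z.1 z.2)).
Proof.
move=> mS mpS; split=> // A mA.
rewrite /= /product_measure1; apply: eq_integral => x _ /=.
rewrite -[RHS](mpS x).2; last exact: measurable_xsection.
by congr (m2 _); apply/seteqP; split=> y; rewrite /xsection/= !inE.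
Qed.

(** Here the sections at a fixed second coordinate are the relevant ones. Uniqueness of the product
    measure allows computing it through them, which is the auxiliary fact [E]. *)
Lemma mp_shear_l (S : T2 -> T1 -> T1) :
  measurable_fun setT (fun z : T1 * T2 => (S z.2 z.1, z.2)) ->
  (forall y, measure_preserving m1 (S y)) ->
  measure_preserving (m1 \x m2)%E (fun z => (S z.2 z.1, z.2)).
Proof.
move=> mS mpS; split=> // A mA.
have mA' : measurable ((fun z : T1 * T2 => (S z.2 z.1, z.2)) @^-1` A).
  by rewrite -[X in measurable X]setTI; exact: mS.
have E B : measurable B ->
    (m1 \x m2)%E B = (\int[m2]_y m1 (ysection B y))%E.
  move=> mB; rewrite (@product_measure_unique _ _ _ _ _ m1 m2 (m1 \x^ m2)%E)//.
  by move=> C D mC mD; exact: product_measure2E.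
rewrite [LHS]E// [RHS]E//; apply: eq_integral => y _ /=.
rewrite -[RHS](mpS y).2; last exact: measurable_ysection.
by congr (m1 _); apply/seteqP; split=> x; rewrite /ysection/= !inE.
Qed.

End shear.

(** * Integration against a measure with a density *)

Section density.
Context d (T : measurableType d) (R : realType).
Variables (mu nu : {measure set T -> \bar R}) (D : set T) (w : T -> R).
Hypotheses (mD : measurable D) (mw : measurable_fun D w).
Hypothesis w0 : forall x, D x -> (0 <= w x)%R.
Local Open Scope ereal_scope.
Hypothesis nuE : forall A, measurable A ->
  nu A = \int[mu]_(x in A `&` D) (w x)%:E.

Import HBNNSimple.

(** The density is known on sets only; approximation of [f] from below by simple functions and
    monotone convergence on both sides extend it to functions. *)
Lemma ge0_integral_density (f : T -> \bar R) :
  measurable_fun D f -> (forall x, D x -> 0 <= f x) ->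
  \int[nu]_(x in D) f x = \int[mu]_(x in D) (f x * (w x)%:E).
Proof.
move=> mf f0; pose f_ := nnsfun_approx mD mf.
have mwE : measurable_fun D (EFin \o w) by exact/measurable_EFinP.
transitivity (limn (fun n => \int[nu]_(x in D) (f_ n x)%:E)).
  rewrite -monotone_convergence//.
  - apply: eq_integral => y /[!inE] yD; apply/esym/cvg_lim => //.
    by apply: cvg_nnsfun_approx.
  - by move=> n; apply/measurable_EFinP; exact: measurable_funTS.
  - by move=> n y _; rewrite lee_fin.
  - by move=> y _ m n mn; rewrite lee_fin; exact/lefP/nd_nnsfun_approx.
rewrite [X in limn X](_ : _ =
    (fun n => \int[mu]_(x in D) ((f_ n x)%:E * (w x)%:E))).
  rewrite -monotone_convergence//.
  - apply: eq_integral => y /[!inE] yD; apply/cvg_lim => //.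
    under eq_cvg do rewrite muleC; rewrite muleC.
    apply: cvgeZl => //; exact: cvg_nnsfun_approx.
  - move=> n; apply: emeasurable_funM => //.
    by apply/measurable_EFinP; exact: measurable_funTS.
  - by move=> n y Dy; rewrite -EFinM lee_fin mulr_ge0// w0.
  - move=> y Dy m n mn; rewrite -!EFinM lee_fin ler_wpM2r ?w0//.
    exact/lefP/nd_nnsfun_approx.
apply/funext => n.
under eq_integral do rewrite fimfunE -fsumEFin//.
rewrite ge0_integral_fsum//; last 2 first.
  - move=> r; exact/measurable_EFinP/measurable_funM.
  - by move=> r y _; rewrite EFinM nnfun_muleindic_ge0.
under [RHS]eq_integral.
  move=> x _; rewrite fimfunE -fsumEFin// ge0_mule_fsuml; last first.
    by move=> r; rewrite EFinM nnfun_muleindic_ge0.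
  over.
rewrite ge0_integral_fsum//; last 2 first.
  - move=> r; apply: emeasurable_funM => //.
    exact/measurable_EFinP/measurable_funM.
  - move=> r y Dy; rewrite mule_ge0// ?lee_fin ?w0//.
    by rewrite -lee_fin EFinM nnfun_muleindic_ge0.
(* The approximants are nonnegative, so the level set of a negative [r] is empty and both terms
   vanish. *)
apply: eq_fsbigr => r rf; have [r0|r0] := leP 0%R r; last first.
  rewrite (_ : f_ n @^-1` [set r] = set0); last by exact: preimage_nnfun0.
  by rewrite !integral0_eq// => x _; rewrite indic0 mulr0 ?mul0e.
have mfr : measurable (f_ n @^-1` [set r]) by [].
under eq_integral do rewrite EFinM.
rewrite ge0_integralZl//=; last first.
  by apply/measurable_EFinP; apply: measurable_funTS; exact: measurable_indic.
rewrite integral_indic// nuE ?measurableI//; last exact: measurableI.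
under [RHS]eq_integral do rewrite EFinM -muleA.
rewrite ge0_integralZl//=; last 2 first.
  - apply: emeasurable_funM => //.
    by apply/measurable_EFinP; apply: measurable_funTS; exact: measurable_indic.
  - by move=> x Dx; rewrite mule_ge0// lee_fin w0.
congr (_ * _); rewrite -setIA setIid setIC integral_mkcondr.
by apply: eq_integral => x _; rewrite epatch_indic muleC.
Qed.

End density.

(** * Translation invariance of Lebesgue measure *)

Section translation.
Context {R : realType}.

(** The image measure agrees with the length on half-open intervals, and this determines Lebesgue
    measure. *)
Lemma mp_translate_R (a : R) :
  measure_preserving (@lebesgue_measure R) (fun x => x + a).
Proof.
have ma : measurable_fun [set: measurableTypeR R]
    (fun x : R => x + a : measurableTypeR R).
  exact: measurable_funD.
split=> // A mA; apply/esym.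
refine (@lebesgue_measure_unique R (pushforward_measure lebesgue_measure ma) _ A mA).
move=> X [[x y] _ <-] /=; rewrite /pushforward.
rewrite (_ : _ @^-1` _ = `]x - a, y - a]%classic); last first.
  by apply/seteqP; split=> z /=; rewrite !in_itv/= ltrBlDr lerBrDr.
rewrite !lebesgue_measure_itv/= !lte_fin ltrD2r; case: ifP => // _.
by rewrite -!EFinB; congr EFin; ring.
Qed.

Lemma measurable_addr_rV n (a : 'rV[R]_n) :
  measurable_fun setT (fun x : 'rV[R]_n => x + a).
Proof.
apply/measurable_fun_coord_rVP => i.
rewrite (_ : _ \o _ = (fun x => coord_rV i x + a 0 i)).
  by apply: measurable_funD => //; exact: measurable_coord_rV.
by apply/funext => x; rewrite /= /coord_rV mxE.
Qed.

Lemma uncons_rVK n : cancel (@uncons_rV R n) cons_rV.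
Proof.
move=> x; rewrite /cons_rV /uncons_rV/=.
apply: etrans (@hsubmxK R 1 1 n x); congr (row_mx _ _).
apply/rowP => i; rewrite !ord1 !mxE eqxx mulr1n.
by congr (x _ _); exact/val_inj.
Qed.

(** Through [cons_rV] the measure in dimension [n.+1] is a product, and a translation becomes the
    composition of two shears, one for the first coordinate and one for the remaining ones. In
    dimension 0 the space is a single point. *)
Lemma mp_translate_rV n (a : 'rV[R]_n) :
  measure_preserving (lebesgue_rV n) (fun x => x + a).
Proof.
elim: n a => [|n IH] a; split=> [|A mA]; try exact: measurable_addr_rV.
  congr (lebesgue_rV 0 _); apply/seteqP; split=> x /=;
  by rewrite (_ : x + a = x)// ; apply/matrixP => i [].
change ((@lebesgue_measure R \x lebesgue_rV n)%E
    (cons_rV @^-1` ((fun x => x + a) @^-1` A)) =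
  (@lebesgue_measure R \x lebesgue_rV n)%E (cons_rV @^-1` A)).
have mA' : measurable (cons_rV @^-1` A : set (measurableTypeR R * 'rV[R]_n)).
  by rewrite -[X in measurable X]setTI; exact: measurable_cons_rV.
pose b := uncons_rV a.
have m1 : measurable_fun setT
    (fun z : measurableTypeR R * 'rV[R]_n => (z.1, z.2 + b.2)).
  apply/measurable_fun_pair; first exact: measurable_fst.
  exact: measurableT_comp (measurable_addr_rV _) measurable_snd.
have m2 : measurable_fun setT
    (fun z : measurableTypeR R * 'rV[R]_n => (z.1 + b.1, z.2)).
  apply/measurable_fun_pair; last exact: measurable_snd.
  by apply: measurable_funD.
have mp1 := mp_shear_r (@lebesgue_measure R) (S := fun _ (y : 'rV[R]_n) => y + b.2)
  m1 (fun _ => IH _).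
have mp2 := @mp_shear_l _ _ (measurableTypeR R) _ R (@lebesgue_measure R)
  (lebesgue_rV n) (fun _ (x : R) => x + b.1)
  m2 (fun _ => mp_translate_R _).
rewrite -[RHS](mp_comp mp1 mp2).2//.
congr (product_measure1 _ _ _); apply/seteqP.
suff E z : cons_rV z + a = cons_rV (z.1 + b.1, z.2 + b.2).
  by split=> z /=; rewrite E.
case: z => x y; rewrite -{1}[a]uncons_rVK /cons_rV/= [LHS](@add_row_mx R 1 1 n).
by rewrite -raddfD.
Qed.

End translation.

(** * Gaussians and isometries of row vectors *)

Section rV_measurability.
Context {R : realType}.

Lemma measurable_coord d (T : measurableType d) n (f : T -> 'rV[R]_n) i :
  measurable_fun setT f -> measurable_fun setT (fun x => f x 0 i).
Proof. by move=> mf; exact: (measurableT_comp (measurable_coord_rV i) mf). Qed.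

Lemma measurable_addrV d (T : measurableType d) n (f g : T -> 'rV[R]_n) :
  measurable_fun setT f -> measurable_fun setT g ->
  measurable_fun setT (fun x => f x + g x).
Proof.
move=> mf mg; apply/measurable_fun_coord_rVP => i.
rewrite (_ : _ \o _ = (coord_rV i \o f) \+ (coord_rV i \o g)).
  by apply: measurable_funD; exact: measurable_coord.
by apply/funext => x; rewrite /= /coord_rV mxE.
Qed.

Lemma measurable_scaler_rV d (T : measurableType d) n (a : T -> R) (f : T -> 'rV[R]_n) :
  measurable_fun setT a -> measurable_fun setT f ->
  measurable_fun setT (fun x => a x *: f x).
Proof.
move=> ma mf; apply/measurable_fun_coord_rVP => i.
rewrite (_ : _ \o _ = a \* (coord_rV i \o f)).
  by apply: measurable_funM => //; exact: measurable_coord.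
by apply/funext => x; rewrite /= /coord_rV mxE.
Qed.

Lemma measurable_oppr_rV d (T : measurableType d) n (f : T -> 'rV[R]_n) :
  measurable_fun setT f -> measurable_fun setT (fun x => - f x).
Proof.
move=> mf; under eq_fun do rewrite -scaleN1r.
exact: measurable_scaler_rV.
Qed.

Lemma measurable_dotv d (T : measurableType d) n (f g : T -> 'rV[R]_n) :
  measurable_fun setT f -> measurable_fun setT g ->
  measurable_fun setT (fun x => dotv (f x) (g x)).
Proof.
move=> mf mg; apply: measurable_sum => i.
by apply: measurable_funM; exact: measurable_coord.
Qed.

End rV_measurability.

Section dotv.
Context {R : realType} {n : nat}.
Implicit Types u v w : 'rV[R]_n.

Lemma dotvC u v : dotv u v = dotv v u.
Proof. by apply: eq_bigr => i _; rewrite mulrC. Qed.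

Lemma dotvDl u v w : dotv (u + v) w = dotv u w + dotv v w.
Proof. by rewrite -big_split/=; apply: eq_bigr => i _; rewrite mxE mulrDl. Qed.

Lemma dotvZl a u w : dotv (a *: u) w = a * dotv u w.
Proof. by rewrite big_distrr/=; apply: eq_bigr => i _; rewrite mxE mulrA. Qed.

Lemma dotvDr u v w : dotv w (u + v) = dotv w u + dotv w v.
Proof. by rewrite dotvC dotvDl !(dotvC w). Qed.

Lemma dotvZr a u w : dotv w (a *: u) = a * dotv w u.
Proof. by rewrite dotvC dotvZl dotvC. Qed.

Lemma dotvNl u w : dotv (- u) w = - dotv u w.
Proof. by rewrite -scaleN1r dotvZl mulN1r. Qed.

Lemma dotvNr u w : dotv w (- u) = - dotv w u.
Proof. by rewrite dotvC dotvNl dotvC. Qed.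

Lemma dotv_ge0 u : 0 <= dotv u u.
Proof. by apply: sumr_ge0 => i _; rewrite -expr2 sqr_ge0. Qed.

Lemma sqr_enorm u : enorm u ^+ 2 = dotv u u.
Proof. by rewrite /enorm sqr_sqrtr// dotv_ge0. Qed.

Lemma enorm_ge0 u : 0 <= enorm u.
Proof. exact: sqrtr_ge0. Qed.

Lemma ler_coord_enorm u i : `|u 0 i| <= enorm u.
Proof.
rewrite -ler_sqr ?nnegrE ?enorm_ge0// real_normK ?num_real// sqr_enorm.
rewrite /dotv (bigD1 i)//= -expr2 lerDl.
by apply: sumr_ge0 => j _; rewrite -expr2 sqr_ge0.
Qed.

End dotv.

Section gaussian.
Context {R : realType}.
Implicit Types a : R.

Lemma cons_rV0 n (z : R * 'rV[R]_n) : cons_rV z 0 0 = z.1.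
Proof.
rewrite /cons_rV (_ : 0 = lshift n (0 : 'I_1)); last exact/val_inj.
by rewrite [LHS](@row_mxEl R 1 1 n) mxE eqxx.
Qed.

Lemma cons_rVS n (z : R * 'rV[R]_n) i : cons_rV z 0 (lift ord0 i) = z.2 0 i.
Proof.
rewrite /cons_rV (_ : lift ord0 i = rshift 1 i); last exact/val_inj.
by rewrite [LHS](@row_mxEr R 1 1 n).
Qed.

Lemma dotv_cons_rV n (z : R * 'rV[R]_n) :
  dotv (cons_rV z) (cons_rV z) = z.1 ^+ 2 + dotv z.2 z.2.
Proof.
rewrite /dotv big_ord_recl cons_rV0 expr2; congr (_ + _).
by apply: eq_bigr => i _; rewrite cons_rVS.
Qed.

Definition gauss n a (v : 'rV[R]_n) : R := expR (- (a * dotv v v)).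

Lemma gauss_gt0 n a (v : 'rV[R]_n) : 0 < gauss a v.
Proof. exact: expR_gt0. Qed.

Lemma gauss_ge0 n a (v : 'rV[R]_n) : 0 <= gauss a v.
Proof. exact: expR_ge0. Qed.

Lemma measurable_gauss d (T : measurableType d) n a (f : T -> 'rV[R]_n) :
  measurable_fun setT f -> measurable_fun setT (fun x => gauss a (f x)).
Proof.
move=> mf; apply: (measurableT_comp (@measurable_expR R)).
apply: measurable_funN.
by apply: measurable_funM => //; exact: measurable_dotv.
Qed.

Local Open Scope ereal_scope.

Lemma ge0_integral_rVS n (f : 'rV[R]_n.+1 -> \bar R) :
  measurable_fun setT f -> (forall x, 0 <= f x) ->
  \int[lebesgue_rV n.+1]_x f x =
  \int[@lebesgue_measure R \x lebesgue_rV n]_z f (cons_rV z).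
Proof.
move=> mf f0.
exact: (@ge0_integral_pushforward _ _ _ _ _ _ (@measurable_cons_rV R n)
  (@lebesgue_measure R \x lebesgue_rV n) setT f).
Qed.

Lemma integral_gauss_R a : (0 < a)%R ->
  exists2 c : R, (0 < c)%R &
  \int[@lebesgue_measure R]_x (expR (- (a * x ^+ 2)))%:E = c%:E.
Proof.
(* The normal density of standard deviation [s] has exponent $-x^2/(2s^2)$; the choice $s^2 =
   1/(2a)$ turns it into $-ax^2$. *)
move=> a0; pose s := Num.sqrt (a *+ 2)^-1.
have s2 : (s ^+ 2 *+ 2)%R = a^-1%R.
  rewrite sqr_sqrtr ?invr_ge0 ?mulrn_wge0// ?ltW// -mulr_natr -(mulr_natr a).
  by rewrite invfM mulfVK.
have s0 : s != 0%R by rewrite gt_eqF// sqrtr_gt0 invr_gt0 mulrn_wgt0.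
have E x : expR (- (a * x ^+ 2)) = ((normal_peak s)^-1 * normal_pdf 0 s x)%R.
  rewrite normal_pdfE// mulKf ?gt_eqF ?normal_peak_gt0//.
  by rewrite /normal_fun subr0 s2 invrK mulNr mulrC.
exists (normal_peak s)^-1%R; first by rewrite invr_gt0 normal_peak_gt0.
under eq_integral do rewrite E EFinM.
rewrite integralZl//; last exact: integrable_normal_pdf.
by rewrite integral_normal_pdf mule1.
Qed.

(** Tonelli factors the integral into one-dimensional ones. Only the finiteness and positivity of
    the value matter later: the latter permits dividing by it in [mp_isometry]. *)
Lemma integral_gauss n a : (0 < a)%R -> exists2 c : R, (0 < c)%R &
  \int[lebesgue_rV n]_v (gauss a v)%:E = c%:E.
Proof.
move=> a0; elim: n => [|n [c c0 IH]].
  exists (gauss a (0 : 'rV[R]_0)); first exact: gauss_gt0.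
  by rewrite [LHS]integral_dirac// ?diracT ?mul1e//; exact/measurable_EFinP/measurable_gauss.
have [b b0 Hb] := integral_gauss_R a0; exists (b * c)%R; first exact: mulr_gt0.
have mG m : measurable_fun setT (fun v : 'rV[R]_m => (gauss a v)%:E).
  exact/measurable_EFinP/measurable_gauss.
rewrite ge0_integral_rVS//; last by move=> x; rewrite lee_fin gauss_ge0.
rewrite fubini_tonelli1//=; last 2 first.
  by apply: measurableT_comp (mG _) _; exact: measurable_cons_rV.
  by move=> x; rewrite lee_fin gauss_ge0.
rewrite /fubini_F.
transitivity (\int[@lebesgue_measure R]_x ((expR (- (a * x ^+ 2)))%:E * c%:E)).
  apply: eq_integral => x _; rewrite -IH -ge0_integralZl//=; last 2 first.
    exact: mG.
    by move=> y _; rewrite lee_fin gauss_ge0.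
  apply: eq_integral => y _; rewrite -EFinM /gauss dotv_cons_rV/=.
  by rewrite mulrDr opprD expRD.
rewrite ge0_integralZr//=.
- by rewrite Hb.
- apply/measurable_EFinP; apply: (measurableT_comp (@measurable_expR R)).
  apply: measurable_funN.
  by apply: measurable_funM => //; exact: measurable_funX.
- by rewrite lee_fin ltW.
Qed.

Lemma integrable_gauss n a : (0 < a)%R ->
  (lebesgue_rV n).-integrable setT (fun v => (gauss a v)%:E).
Proof.
move=> a0; apply/integrableP; split.
  exact/measurable_EFinP/measurable_gauss.
have [c _ cE] := integral_gauss n a0.
under eq_integral do rewrite /= ger0_norm ?gauss_ge0//.
by rewrite cE ltry.
Qed.

End gaussian.

Section isometry.
Context {R : realType} {n : nat}.
Variable T : 'rV[R]_n -> 'rV[R]_n.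
Hypotheses (mT : measurable_fun setT T) (TD : {morph T : x y / x + y}).
Hypotheses (TK : involutive T) (Tdot : forall x, dotv (T x) (T x) = dotv x x).
Local Open Scope ereal_scope.
Let mu := lebesgue_rV n : {sigma_finite_measure set 'rV[R]_n -> \bar R}.

(* Tonelli and translation invariance evaluate the double integral of
   [G (T z) * \1_B (y + T z)], G a Gaussian, as both [mu B * \int G] and
   [mu (T @^-1` B) * \int G]. *)
Lemma mp_isometry : measure_preserving (lebesgue_rV n) T.
Proof.
split=> // B mB.
have [c c0 cE] := @integral_gauss R n 1 ltr01.
pose G (v : 'rV[R]_n) := gauss 1 v.
have mG : measurable_fun setT G by exact: measurable_gauss.
have m1B : measurable_fun setT (\1_B : _ -> R) by exact: measurable_indic.
have mTB : measurable (T @^-1` B) by rewrite -[X in measurable X]setTI; exact: mT.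
have T0 : T 0%R = 0%R by apply: (@addrI _ (T 0%R)); rewrite -TD !addr0.
have TN x : T (- x)%R = (- T x)%R.
  by apply: (@addrI _ (T x)); rewrite -TD !subrr.
pose H1 (z : 'rV[R]_n * 'rV[R]_n) := (G (T z.1) * \1_B (z.2 + T z.1))%:E.
pose H2 (z : 'rV[R]_n * 'rV[R]_n) := (G (T z.1 - z.2) * \1_B (T z.1))%:E.
have mT1 : measurable_fun setT (fun z : 'rV[R]_n * 'rV[R]_n => T z.1).
  exact: measurableT_comp mT measurable_fst.
have mH1 : measurable_fun setT H1.
  apply/measurable_EFinP; apply: measurable_funM.
    exact: measurableT_comp mG mT1.
  apply: measurableT_comp m1B _; apply: measurable_addrV => //.
have mH2 : measurable_fun setT H2.
  apply/measurable_EFinP; apply: measurable_funM.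
    apply: measurableT_comp mG _; apply: measurable_addrV => //.
    exact: measurable_oppr_rV.
  exact: measurableT_comp m1B _.
have H10 z : 0 <= H1 z by rewrite lee_fin mulr_ge0// gauss_ge0.
have H20 z : 0 <= H2 z by rewrite lee_fin mulr_ge0// gauss_ge0.
have step1 : \int[mu \x mu]_z H1 z = c%:E * mu B.
  rewrite fubini_tonelli1// /fubini_F.
  transitivity (\int[mu]_z ((G z)%:E * mu B)).
    apply: eq_integral => z _; rewrite /H1/=.
    under eq_integral do rewrite EFinM.
    rewrite ge0_integralZl//=; last 2 first.
    - apply/measurable_EFinP; apply: measurableT_comp m1B _.
      exact: measurable_addr_rV.
    - by rewrite lee_fin gauss_ge0.
    rewrite /G /gauss Tdot; congr (_ * _).
    rewrite (ge0_integral_mp (mp_translate_rV (T z)) (f := EFin \o \1_B))//.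
    - by rewrite integral_indic// setIT.
    - exact/measurable_EFinP.
    - by move=> x; rewrite lee_fin.
  rewrite ge0_integralZr//=; first by rewrite cE.
  - exact/measurable_EFinP.
  - by move=> x _; rewrite lee_fin gauss_ge0.
have step2 : \int[mu \x mu]_z H2 z = c%:E * mu (T @^-1` B).
  rewrite fubini_tonelli1// /fubini_F.
  transitivity (\int[mu]_z (c%:E * (\1_(T @^-1` B) z)%:E)).
    apply: eq_integral => z _; rewrite /H2/=.
    under eq_integral do rewrite EFinM.
    rewrite ge0_integralZr//=; last 2 first.
    - apply/measurable_EFinP; apply: measurableT_comp mG _.
      by apply: measurable_addrV => //; exact: measurable_oppr_rV.
    - by move=> y _; rewrite lee_fin gauss_ge0.
    congr (_ * _); rewrite -cE.
    transitivity (\int[mu]_y (G (y - T z))%:E).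
      apply: eq_integral => y _; congr EFin; congr expR; congr (- (1 * _))%R.
      by rewrite -[(T z - y)%R]opprB dotvNl dotvNr opprK.
    apply: (ge0_integral_mp (mp_translate_rV (- T z)%R) (f := fun v => (G v)%:E)).
      exact/measurable_EFinP.
    by move=> x; rewrite lee_fin gauss_ge0.
  rewrite ge0_integralZl//=; last 2 first.
  - by apply/measurable_EFinP; exact: measurable_indic.
  - by rewrite lee_fin ltW.
  by rewrite integral_indic// setIT.
have step3 : \int[mu \x mu]_z H1 z = \int[mu \x mu]_z H2 z.
  apply: etrans (fubini_tonelli2 H1 mH1 H10) _.
  apply: etrans _ (esym (fubini_tonelli2 H2 mH2 H20)).
  rewrite /fubini_G; apply: eq_integral => y _.
  transitivity (\int[mu]_z H1 ((z + T (- y))%R, y)); last first.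
    apply: eq_integral => z _; rewrite /H1 /H2/= TD TK.
    by rewrite addrCA subrr addr0.
  apply/esym.
  apply: (ge0_integral_mp (mp_translate_rV (T (- y)%R)) (f := fun z => H1 (z, y))) => //.
  exact: measurableT_comp mH1 (measurable_pair2 _).
move: step3; rewrite step1 step2.
move/(congr1 (fun x => c^-1%:E * x)).
by rewrite !muleA -!EFinM mulVf ?gt_eqF// !mul1e.
Qed.

End isometry.

(** * Open sets and continuous functions are measurable *)

Section open_measurable.
Context {R : realType}.

(** A ball of the sup norm is a finite intersection of preimages of intervals under coordinates. *)
Lemma measurable_ball_rV n (x : 'rV[R]_n) (e : R) : measurable (ball x e).
Proof.
have [e0|e0] := leP e 0.
  rewrite (_ : ball x e = set0)//; apply/seteqP; split=> y //= [].
  by rewrite ltNge e0.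
rewrite (_ : ball x e = \bigcap_(i in [set: 'I_n]) (fun y => y 0 i) @^-1` ball (x 0 i) e).
  apply: fin_bigcap_measurable => // i _.
  rewrite -[X in measurable X]setTI; apply: (measurable_coord i) => //.
  exact: measurable_ball.
apply/seteqP; split=> [y [_ xy] i _|y xy]; first exact: xy.
by split=> // j i; rewrite !ord1; exact: xy.
Qed.

Lemma rat_row_approx n (x : 'rV[R]_n) (e : R) : 0 < e ->
  exists q : 'rV[rat]_n, ball x e (map_mx ratr q : 'rV[R]_n).
Proof.
move=> e0.
have /fin_all_exists[q Hq] : forall i, exists q : rat, ball (x 0 i) e (ratr q).
  move=> i; have /rat_in_itvoo[q] : x 0 i - e < x 0 i + e by rewrite ltrD2l gtrN.
  by rewrite in_itv/= => xq; exists q; rewrite ball_itv/= in_itv.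
by exists (\row_i q i); split=> // j i; rewrite !ord1 !mxE.
Qed.

(** The sigma-algebra is generated by the coordinates, so its relation to the topology has to be
    proved. The boxes with rational centers and radii $1/(k+1)$ are countably many, and an open set
    is the union of those it contains. *)
Lemma open_measurable_prod n m (O : set ('rV[R]_n * 'rV[R]_m)) :
  open O -> measurable O.
Proof.
move=> oO; pose e (k : nat) : R := k.+1%:R^-1.
pose B (p : 'rV[rat]_n * 'rV[rat]_m * nat) : set ('rV[R]_n * 'rV[R]_m) :=
  ball (map_mx ratr p.1.1 : 'rV[R]_n) (e p.2) `*`
  ball (map_mx ratr p.1.2 : 'rV[R]_m) (e p.2).
rewrite (_ : O = \bigcup_p (if `[< B p `<=` O >] then B p else set0)).
  apply: countable_bigcupT_measurable => [|p]; first exact: countableP.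
  case: ifP => // _; apply: measurableX; exact: measurable_ball_rV.
apply/seteqP; split=> [[x y] Oxy|z [p _]]; last first.
  by case: ifPn => // /asboolP BO; exact: BO.
have /nbhs_ballP[r /= r0 rO] := open_nbhs_nbhs (conj oO Oxy).
have r20 : 0 < r / 2 by rewrite divr_gt0.
have [k kr] : exists k, e k < r / 2.
  have [k _ /(_ k (leqnn _))] := @near_infty_natSinv_lt R (PosNum r20).
  by exists k.
have ek0 : 0 < e k by rewrite invr_gt0.
have [p xp] := rat_row_approx x ek0; have [q yq] := rat_row_approx y ek0.
exists (p, q, k) => //; rewrite ifT; last first.
  apply/asboolP => -[x' y'] [/= px' qy']; apply: rO; split=> /=.
    apply: (@le_ball _ _ _ (e k + e k)); first by rewrite [leRHS]splitr lerD// ltW.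
    exact: ball_triangle xp px'.
  apply: (@le_ball _ _ _ (e k + e k)); first by rewrite [leRHS]splitr lerD// ltW.
  exact: ball_triangle yq qy'.
by split=> /=; exact: ball_sym.
Qed.

(** Reduces to the product case by adding a factor of dimension 0. *)
Lemma open_measurable_rV n (O : set 'rV[R]_n) : open O -> measurable O.
Proof.
move=> oO; have mO : measurable (fst @^-1` O : set ('rV[R]_n * 'rV[R]_0)).
  by apply: open_measurable_prod; apply: open_comp => // z _; exact: cvg_fst.
have mf : measurable_fun setT (fun x : 'rV[R]_n => (x, 0 : 'rV[R]_0)).
  exact: measurable_pair2.
by rewrite -[X in measurable X]setTI; exact: (mf _ _ mO).
Qed.

Lemma continuous_measurable_prod n m (O : set ('rV[R]_n * 'rV[R]_m))
    (f : 'rV[R]_n * 'rV[R]_m -> R) :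
  open O -> {in O, continuous f} -> measurable_fun O f.
Proof.
move=> oO; rewrite -continuous_open_subspace// => /continuousP cf.
move=> mO; apply: (measurability _ (RGenOpens.measurableE R)) => //.
move=> _ [_ [a [b ->] <-]].
apply: open_measurable_prod; rewrite open_setSI//.
by apply: cf; exact: interval_open.
Qed.

Lemma continuous_measurable_rV n (O : set 'rV[R]_n) (f : 'rV[R]_n -> R) :
  open O -> {in O, continuous f} -> measurable_fun O f.
Proof.
move=> oO; rewrite -continuous_open_subspace// => /continuousP cf.
move=> mO; apply: (measurability _ (RGenOpens.measurableE R)) => //.
move=> _ [_ [a [b ->] <-]].
apply: open_measurable_rV; rewrite open_setSI//.
by apply: cf; exact: interval_open.
Qed.

End open_measurable.

(** * Vanishing integrals from measure preserving flows *)

Section flow.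
Context d (T : measurableType d) (R : realType).
Variable mu : {measure set T -> \bar R}.

Lemma integral_flow_derivative (tau : nat -> T -> T) (F G D : T -> R) :
  (forall n, measure_preserving mu (tau n)) ->
  mu.-integrable setT (EFin \o F) -> mu.-integrable setT (EFin \o D) ->
  (forall n z, `|n.+1%:R * (F (tau n z) - F z)| <= D z) ->
  (forall z, (fun n => n.+1%:R * (F (tau n z) - F z)) @ \oo --> G z) ->
  mu.-integrable setT (EFin \o G) /\ (\int[mu]_z (G z)%:E = 0)%E.
Proof.
move=> mp iF iD FD FG.
have mF : measurable_fun setT F by exact/measurable_EFinP/measurable_int/iF.
pose Q n z := n.+1%:R * (F (tau n z) - F z).
have mQ n : measurable_fun setT (Q n).
  apply: measurable_funM => //; apply: measurable_funB => //.
  by apply: measurableT_comp mF _; have [] := mp n.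
have mG : measurable_fun setT G.
  by apply: (measurable_fun_cvg (h := Q)) => // z _; exact: FG.
have [|||||iG _ cvG] := @dominated_convergence _ _ _ mu setT measurableT
    (fun n => EFin \o Q n) (EFin \o G) (EFin \o D).
- by move=> n; exact/measurable_EFinP.
- exact/measurable_EFinP.
- by apply: aeW => z _; apply: cvg_EFin (FG z); apply: nearW.
- exact: iD.
- by apply: aeW => z n _; rewrite /= lee_fin; exact: FD.
split=> //; have Q0 n : (\int[mu]_z (Q n z)%:E = 0)%E.
  under eq_integral do rewrite EFinM EFinB.
  have iFt : mu.-integrable setT (fun z => (F (tau n z))%:E).
    exact: (integrable_mp (mp n) iF).
  rewrite integralZl//; last exact: integrableB.
  rewrite integralB// (integral_mp (mp n) iF) subee ?mule0//.
  exact: integrable_fin_num.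
move/cvg_lim : cvG => <- //.
by apply: cvg_lim => //; apply: cvg_near_cst; apply: nearW => n; exact: Q0.
Qed.

End flow.

(** * Directional derivatives and jets *)

Lemma is_deriveP {R : realType} {V : normedModType R} (f : V -> R) (z u : V) (l : R) :
  is_derive z u f l <->
  h^-1 * (f (z + h *: u) - f z) @[h --> (0 : R)^'] --> l.
Proof.
have -> : (fun h => h^-1 * (f (z + h *: u) - f z)) =
    (fun h : R => h^-1 *: ((f \o shift z) (h *: u) - f z)).
  by apply/funext => h; rewrite /= (addrC z).
split=> [[ex <-]//|cl]; split; first by apply/cvg_ex; exists l.
exact/cvg_lim.
Qed.

Section directional.
Context {R : realType} {V : normedModType R}.
Implicit Types (f : V -> R) (z u : V).

Lemma is_derive_line f z u s l : is_derive (z + s *: u) u f l ->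
  is_derive s 1 (fun t : R => f (z + t *: u)) l.
Proof.
move=> /is_deriveP fl; apply/is_deriveP.
by under eq_fun do rewrite [_ *: 1]mulr1 scalerDl addrA.
Qed.

Lemma mean_value_line f (df : R -> R) z u :
  (forall s, 0 <= s <= 1 -> is_derive (z + s *: u) u f (df s)) ->
  exists2 s, 0 < s < 1 & f (z + u) - f z = df s.
Proof.
move=> dfP; pose phi (t : R) := f (z + t *: u).
have dphi (s : R) : s \in `[0, 1] -> is_derive s 1 phi (df s).
  by move=> s01; apply: is_derive_line; apply: dfP; rewrite in_itv in s01.
have p1 (s : R) : s \in `]0, 1[ -> is_derive s 1 phi (df s).
  rewrite in_itv/= => /andP[/ltW s0 /ltW s1].
  by apply: dphi; rewrite in_itv/= s0.
have p2 : {within `[0, 1], continuous phi}.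
  by apply: derivable_within_continuous => s s01; have [] := dphi _ s01.
have [s] := MVT ltr01 p1 p2.
rewrite in_itv/= subr0 mulr1 /phi scale1r scale0r addr0 => s01 E.
by exists s.
Qed.

Lemma is_derive_scale f z u k l : is_derive z u f l ->
  is_derive z (k *: u) f (k * l).
Proof.
have [->|k0] := eqVneq k 0.
  by rewrite scale0r mul0r => _; exact: is_derive0.
move=> /is_deriveP/cvgr_dnbhsP fl; apply/is_deriveP/cvgr_dnbhsP => h [h0 hcv].
have -> : (fun n => (h n)^-1 * (f (z + h n *: (k *: u)) - f z)) =
    (fun n => k * ((h n * k)^-1 * (f (z + (h n * k) *: u) - f z))).
  apply/funext => n; rewrite scalerA invfM.
  by rewrite -[_ / _ * _]mulrA mulrCA mulVKf.
apply: cvgMr; apply: (fl (fun n => h n * k)); split.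
  by move=> n; rewrite mulf_neq0.
by rewrite -(mul0r k); apply: cvgMl.
Qed.

(** Directional derivatives are not additive in general. The increment along [e] is taken from the
    moved point [z + h *: u]; by the mean value theorem it equals [h] times a value of [Fe] at a
    point tending to [z], and continuity of [Fe] at [z] concludes. Iterated, this turns the
    derivatives along basis vectors that a jet provides into derivatives along every direction. *)
Lemma is_derive_add_direction (A : set V) f (Fu : R) (Fe : V -> R) z u e :
  open A -> A z -> is_derive z u f Fu ->
  (forall y, A y -> is_derive y e f (Fe y)) -> {for z, continuous Fe} ->
  is_derive z (u + e) f (Fu + Fe z).
Proof.
move=> oA Az /is_deriveP dfu dfe cFe; apply/is_deriveP.
have -> : (fun h : R => h^-1 * (f (z + h *: (u + e)) - f z)) =
    (fun h => h^-1 * (f (z + h *: u) - f z)) \+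
    (fun h => h^-1 * (f (z + h *: (u + e)) - f (z + h *: u))).
  by apply/funext => h /=; rewrite -mulrDr; congr (_ * _); ring.
apply: cvgD dfu _; apply/cvgrPdist_lt => eps eps0.
have /nbhs_ballP[r /= r0 rP] : \forall y \near z, A y /\ `|Fe z - Fe y| < eps.
  near=> y; split; first by near: y; exact: open_nbhs_nbhs.
  by near: y; move/cvgrPdist_lt : cFe; apply.
(* As [M] exceeds [|u| + |e|], the condition [|h| * M < r] keeps the segment from [z + h *: u] to
   [z + h *: (u + e)] inside the ball. *)
pose M := `|u| + `|e| + 1.
have M0 : 0 < M by rewrite ltr_wpDl// addr_ge0.
near=> h.
have h0 : h != 0 by near: h; exact: nbhs_dnbhs_neq.
have hM : `|h| * M < r.
  by rewrite -ltr_pdivlMr//; near: h; apply: dnbhs0_lt; exact: divr_gt0.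
have inr (s : R) : 0 <= s <= 1 -> ball z r (z + h *: u + s *: (h *: e)).
  move=> /andP[s0 s1]; rewrite -ball_normE/= opprD addrA opprD addrA subrr sub0r.
  rewrite -opprD normrN; apply: le_lt_trans hM.
  apply: le_trans (ler_normD _ _) _; rewrite !normrZ.
  rewrite (ger0_norm s0) /M -addrA mulrDr lerD2l mulrDr mulr1 -[leLHS]addr0.
  by rewrite lerD// ler_piMl// mulr_ge0.
have [s s01 E] := @mean_value_line f (fun s => h * Fe (z + h *: u + s *: (h *: e)))
  (z + h *: u) (h *: e) (fun s s01 => is_derive_scale h (dfe _ (rP _ (inr s s01)).1)).
rewrite scalerDr addrA E mulKf//; apply: (rP _ _).2.
by apply: inr; case/andP: s01 => /ltW -> /ltW ->.
Unshelve. all: end_near. Qed.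

Lemma is_derive_sum_directions (I : Type) (r : seq I) (A : set V) f
    (e : I -> V) (F : I -> V -> R) (c : I -> R) z :
  open A -> A z ->
  (forall i y, A y -> is_derive y (e i) f (F i y)) ->
  (forall i y, A y -> {for y, continuous (F i)}) ->
  is_derive z (\sum_(i <- r) c i *: e i) f (\sum_(i <- r) c i * F i z).
Proof.
move=> oA Az dF cF; elim: r => [|i r IH].
  by rewrite !big_nil; exact: is_derive0.
rewrite !big_cons (addrC (_ *: _)) (addrC (_ * _)).
apply: (@is_derive_add_direction A f _ (fun y => c i * F i y)) => //.
  by move=> y Ay; apply: is_derive_scale; exact: dF.
by apply: cvgMr; exact: cF.
Qed.

Lemma is_derive_cvg_seq f z u l : is_derive z u f l ->
  n.+1%:R * (f (z + n.+1%:R^-1 *: u) - f z) @[n --> \oo] --> l.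
Proof.
move=> /is_deriveP/cvgr_dnbhsP /(_ (fun n => n.+1%:R^-1)).
move=> fl; under eq_fun do rewrite -[X in X * _]invrK; apply: fl; split=> [n|].
  by rewrite invr_neq0.
exact: cvg_harmonic.
Qed.

End directional.

Section jets.
Context {R : realType} {V : normedModType R} {I : Type}.
Variables (e : I -> V) (k : nat) (A : set V) (f : V -> R) (F : seq I -> V -> R).
Hypotheses (oA : open A) (jF : is_jet e k A f F).

Lemma jet_continuous s z : (size s <= k)%N -> A z -> {for z, continuous (F s)}.
Proof.
move=> sk Az; have [_ _ /(_ _ sk)] := jF.
move/(continuous_subspaceW (@subset_closure _ A)).
by rewrite continuous_open_subspace// => /(_ z); apply; rewrite inE.
Qed.

Lemma near_jet0 z : A z -> \forall y \near z, F [::] y = f y.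
Proof.
move=> Az; have [F0 _ _] := jF.
apply: filterS (open_nbhs_nbhs (conj oA Az)) => y Ay.
by apply: F0; exact: subset_closure.
Qed.

Lemma jet_is_derive i z : (0 < k)%N -> A z -> is_derive z (e i) f (F [:: i] z).
Proof.
move=> k0 Az; apply: (near_eq_is_derive (near_jet0 Az)).
by have [_ + _] := jF; apply.
Qed.

Lemma jet_is_derive_sum (r : seq I) (c : I -> R) z : (0 < k)%N -> A z ->
  is_derive z (\sum_(i <- r) c i *: e i) f (\sum_(i <- r) c i * F [:: i] z).
Proof.
move=> k0 Az.
apply: (is_derive_sum_directions _ _ (A := A) (F := fun i => F [:: i])) => // [i y Ay|i y Ay].
- exact: jet_is_derive.
- exact: jet_continuous.
Qed.

Lemma jet_continuous0 : {within closure A, continuous f}.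
Proof.
have [F0 _ /(_ [::] isT)] := jF.
by apply: subspace_eq_continuous => z; rewrite inE => /F0.
Qed.

End jets.

(** * The gauge of a convex domain *)

Lemma at_right_map {R : realType} (f : R -> R) : f t @[t --> 0^'+] --> (0 : R) ->
  (\forall t \near 0^'+, 0 < f t) -> f t @[t --> 0^'+] --> 0^'+.
Proof.
move=> f0 fpos P [e /= e0 eP]; near=> t; apply: eP; last by near: t.
by rewrite /= sub0r normrN; near: t; move/cvgr0Pnorm_lt : f0; exact.
Unshelve. all: end_near. Qed.

Lemma near_right_1D {R : realType} (k : R) : \forall t \near (0 : R)^'+, 0 < 1 + t * k.
Proof.
have : 1 + t * k @[t --> (0 : R)^'+] --> 1 + 0 * k.
  apply: cvg_at_right_filter; apply: cvgD; first exact: cvg_cst.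
  by apply: cvgMl; exact: cvg_id.
by rewrite mul0r addr0 => /cvgr_gt; apply.
Qed.

(** * Sides of the boundary in a local chart *)

Section chart.
Context {R : realType} {n : nat}.
Variables (Omega : set 'rV[R]_n) (x : 'rV[R]_n) (Q : 'M[R]_n) (i : 'I_n) (r : R)
  (gamma : 'rV[R]_n.-1 -> R).
Hypothesis chart : C21_chart Omega x Q i r gamma.

Let y' := col' i (x *m Q).
Let m := graph_conormal i gamma y'.
(** A local defining function in the original coordinates: near [x] it is negative exactly on
    [Omega] and zero exactly on the boundary. *)
Let phi (z : 'rV[R]_n) := gamma (col' i (z *m Q)) - (z *m Q) 0 i.

Lemma dotv_graph_conormal (w : 'rV[R]_n) :
  dotv m w = \sum_k (col' i w) 0 k * 'D_(basis_rV k) gamma y' - w 0 i.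
Proof.
rewrite /dotv (bigD1_ord i)//= addrC; congr (_ + _).
  apply: eq_bigr => k _; rewrite !mxE liftK mulrC.
  by congr (w _ _ * _); exact/val_inj.
by rewrite mxE unlift_none mulN1r.
Qed.

Lemma dotv_mulmxr (a u : 'rV[R]_n) : dotv (a *m Q^T) u = dotv a (u *m Q).
Proof.
have E (b c : 'rV[R]_n) : dotv b c = (b *m c^T) 0 0.
  by rewrite mxE; apply: eq_bigr => k _; rewrite mxE.
by rewrite !E trmx_mul mulmxA.
Qed.

Lemma col'D (a b : 'rV[R]_n) : col' i (a + b) = col' i a + col' i b.
Proof. by apply/rowP => k; rewrite !mxE. Qed.

Lemma col'Z c (a : 'rV[R]_n) : col' i (c *: a) = c *: col' i a.
Proof. by apply/rowP => k; rewrite !mxE. Qed.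

(** The gradient of [phi] at [x] is the conormal carried back by the orthogonal matrix [Q]. Hence
    the sign of its product with [u] tells on which side of the boundary a ray along [u] starts. *)
Lemma chart_is_derive u : is_derive x u phi (dotv (m *m Q^T) u).
Proof.
have [QQ r0 [G jG _] _] := chart.
have Ay : ball y' r y' by exact: ballxx.
have oA : open (ball y' r) by exact: ball_open.
have dG k : 'D_(basis_rV k) gamma y' = G [:: k] y'.
  by have [] := jet_is_derive oA jG k isT Ay.
have := jet_is_derive_sum oA jG (index_enum 'I_n.-1) (fun k => col' i (u *m Q) 0 k) isT Ay.
rewrite -row_sum_delta dotv_mulmxr dotv_graph_conormal.
under eq_bigr do rewrite -dG.
move=> /is_deriveP dgamma; apply/is_deriveP.
have -> : (fun h : R => h^-1 * (phi (x + h *: u) - phi x)) =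
    (fun h => h^-1 * (gamma (y' + h *: col' i (u *m Q)) - gamma y')) \-
    (fun h => h^-1 * h * (u *m Q) 0 i).
  apply/funext => h /=; rewrite /phi mulmxDl -scalemxAl col'D col'Z -/y' !mxE.
  by ring.
apply: cvgB dgamma _; apply: cvg_near_cst; near=> h.
by rewrite mulVf ?mul1r//; near: h; exact: nbhs_dnbhs_neq.
Unshelve. all: end_near. Qed.

Lemma chart_near u : \forall t \near (0 : R),
  Omega (x + t *: u) <-> phi (x + t *: u) < 0.
Proof.
have [QQ r0 _ chartP] := chart.
have u0 : 0 < `|u *m Q| + 1 by rewrite ltr_wpDl.
have ru0 : 0 < r / (`|u *m Q| + 1) by exact: divr_gt0.
near=> t.
have tr : `|t| < r / (`|u *m Q| + 1) by near: t; apply: (@nbhs0_lt _ R^o).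
have /chartP[H _] : ball (x *m Q) r ((x + t *: u) *m Q).
  rewrite -ball_normE/= mulmxDl -scalemxAl opprD addrA subrr sub0r normrN normrZ.
  move: tr; rewrite ltr_pdivlMr//; apply: le_lt_trans.
  by rewrite ler_wpM2l// lerDl.
by move: H; rewrite -mulmxA QQ mulmx1 /phi subr_lt0.
Unshelve. all: end_near. Qed.

Hypothesis bx : boundary Omega x.

Lemma chart_phi0 : phi x = 0.
Proof.
have [QQ r0 _ /(_ _ (ballxx _ r0))[_]] := chart.
by rewrite -mulmxA QQ mulmx1 => -[/(_ bx) E _]; rewrite /phi E subrr.
Qed.

(** As [phi] vanishes at [x], its directional derivative gives its sign for small positive [t]. *)
Lemma chart_outside u : 0 < dotv (m *m Q^T) u ->
  \forall t \near (0 : R)^'+, ~ Omega (x + t *: u).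
Proof.
move=> u0; have /is_deriveP/cvg_dnbhs_at_right/cvgr_gt := chart_is_derive u.
move=> /(_ _ u0); rewrite chart_phi0 => dphi.
near=> t; have t0 : 0 < t by near: t; exact: nbhs_right_gt.
have H : Omega (x + t *: u) <-> phi (x + t *: u) < 0.
  by near: t; apply: cvg_within; exact: chart_near.
move=> /H; apply/negP; rewrite -leNgt ltW//.
have : 0 < t^-1 * (phi (x + t *: u) - 0) by near: t.
by rewrite subr0 pmulr_rgt0// invr_gt0.
Unshelve. all: end_near. Qed.

Lemma chart_inside u : dotv (m *m Q^T) u < 0 ->
  \forall t \near (0 : R)^'+, Omega (x + t *: u).
Proof.
move=> u0; have /is_deriveP/cvg_dnbhs_at_right/cvgr_lt := chart_is_derive u.
move=> /(_ _ u0); rewrite chart_phi0 => dphi.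
near=> t; have t0 : 0 < t by near: t; exact: nbhs_right_gt.
have H : Omega (x + t *: u) <-> phi (x + t *: u) < 0.
  by near: t; apply: cvg_within; exact: chart_near.
apply/H.
have : t^-1 * (phi (x + t *: u) - 0) < 0 by near: t.
by rewrite subr0 pmulr_rlt0// invr_gt0.
Unshelve. all: end_near. Qed.

(** [Q] preserves lengths, and the entry -1 of the conormal contributes 1 to its squared length. *)
Lemma chart_conormal_neq0 : 0 < dotv (m *m Q^T) (m *m Q^T).
Proof.
have [QQ _ _ _] := chart.
rewrite dotv_mulmxr -mulmxA (mulmx1C QQ) mulmx1.
rewrite /dotv (bigD1 i)//= ltr_wpDr//; last first.
  by rewrite mxE unlift_none mulN1r opprK ltr01.
by apply: sumr_ge0 => j _; rewrite -expr2 sqr_ge0.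
Qed.

End chart.

Section gauge.
Context {R : realType} {n : nat}.
Local Notation V := 'rV[R]_n.
Variables (Omega : set V) (p : V) (r M : R).
Hypothesis Omega_open : open Omega.
Hypothesis Omega_convex : forall (x y : V) (a : R), Omega x -> Omega y -> 0 <= a <= 1 ->
  Omega (a *: x + (1 - a) *: y).
Hypotheses (r0 : 0 < r) (pr : ball p r `<=` Omega).
Hypotheses (M0 : 0 < M) (OmegaM : forall x, Omega x -> `|x - p| <= M).

Definition gauge_set (x : V) : set R :=
  [set s | 0 < s /\ Omega (p + s^-1 *: (x - p))].

(** The Minkowski functional of [Omega] with respect to its interior point [p]. *)
Definition gauge (x : V) : R := inf (gauge_set x).

Lemma gauge_set_norm x s : `|x - p| < s * r -> gauge_set x s.
Proof.
move=> xs; have s0 : 0 < s.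
  by rewrite -(pmulr_lgt0 _ r0); exact: le_lt_trans xs.
split=> //; apply: pr; rewrite -ball_normE/= opprD addrA subrr sub0r normrN normrZ.
by rewrite gtr0_norm ?invr_gt0// mulrC ltr_pdivrMr// mulrC.
Qed.

Lemma gauge_set_neq0 x : gauge_set x !=set0.
Proof.
exists ((`|x - p| + 1) / r); apply: gauge_set_norm.
by rewrite divfK ?gt_eqF// ltrDl.
Qed.

Lemma gauge_set_lb x : has_lbound (gauge_set x).
Proof. by exists 0 => s [/ltW]. Qed.

Lemma gauge_le x s : gauge_set x s -> gauge x <= s.
Proof. by move=> xs; apply: ge_inf => //; exact: gauge_set_lb. Qed.

Lemma gauge_ge x s : (forall t, gauge_set x t -> s <= t) -> s <= gauge x.
Proof. by move=> H; apply: lb_le_inf; [exact: gauge_set_neq0|exact: H]. Qed.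

Lemma gauge_ge0 x : 0 <= gauge x.
Proof. by apply: gauge_ge => t [/ltW]. Qed.

(** The point obtained with [t] lies on the segment from [p] to the point obtained with [s]. *)
Lemma gauge_setW x s t : gauge_set x s -> s <= t -> gauge_set x t.
Proof.
move=> [s0 Os] st; have t0 := lt_le_trans s0 st; split=> //.
rewrite (_ : p + _ = (s / t) *: (p + s^-1 *: (x - p)) + (1 - s / t) *: p); last first.
  apply/rowP => i; rewrite !mxE; field.
  by rewrite !gt_eqF.
apply: Omega_convex => //; first by apply: pr; exact: ballxx.
by rewrite divr_ge0 ?(ltW s0) ?(ltW t0)//= ler_pdivrMr// mul1r.
Qed.

Lemma gauge_set_lt x s : gauge x < s -> gauge_set x s.
Proof.
move=> /inf_lt[|t xt ts]; first exact: gauge_set_neq0.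
exact: gauge_setW xt (ltW ts).
Qed.

(** The strict inequality comes from openness: a point of [Omega] can be pushed slightly away from
    [p] and stay in [Omega]. *)
Lemma gauge_lt1 x : gauge x < 1 <-> Omega x.
Proof.
split=> [/gauge_set_lt[_]|Ox]; first by rewrite invr1 scale1r addrC subrK.
have : {for (1 : R), continuous (fun s : R => p + s^-1 *: (x - p))}.
  apply: cvgD; first exact: cvg_cst.
  by apply: cvgZl; apply: cvgV; [exact: oner_neq0|exact: cvg_id].
move=> /(_ Omega); rewrite invr1 scale1r addrC subrK.
move=> /(_ (open_nbhs_nbhs (conj Omega_open Ox)))/nbhs_ballP[e /= e0 eO].
(* The bound 1/2 keeps [s] positive when [e] is large; the other one puts [s] within distance [e] of
   1. *)
pose s := Num.max (1 / 2) (1 - e / 2).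
have s1 : s < 1.
  by rewrite gt_max ltr_pdivrMr// mul1r ltr1n/= gtrBl divr_gt0.
apply: le_lt_trans (s1); apply: gauge_le; split; first by rewrite lt_max divr_gt0.
apply: eO; rewrite -ball_normE/= ger0_norm ?subr_ge0 ?ltW//.
rewrite ltrBlDr -ltrBlDl lt_max; apply/orP; right.
by rewrite ltrD2l ltrN2 ltr_pdivrMr// ltr_pMr// ltr1n.
Qed.

(** One inequality, valid for all points and factors, suffices: applied to the dilated point with
    the factor [k^-1] it becomes the converse. *)
Lemma gauge_homo x k : 0 < k -> gauge (p + k *: (x - p)) = k * gauge x.
Proof.
have H y l : 0 < l -> l * gauge y <= gauge (p + l *: (y - p)).
  move=> l0; apply: gauge_ge => t [t0 Ot]; rewrite -ler_pdivlMl//.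
  apply: gauge_le; split; first by rewrite mulr_gt0// invr_gt0.
  by move: Ot; rewrite (addrC p (l *: _)) addrK scalerA invfM invrK mulrC.
move=> k0; apply/eqP; rewrite eq_le H// andbT.
rewrite -ler_pdivrMl//; apply: le_trans (H _ _ _) _; first by rewrite invr_gt0.
rewrite (addrC p (k *: _)) addrK scalerA mulVf ?gt_eqF// scale1r.
by rewrite addrC subrK.
Qed.

Lemma gauge_center : gauge p = 0.
Proof.
apply/eqP; rewrite eq_le gauge_ge0 andbT.
apply/ler_addgt0Pr => e e0; rewrite add0r; apply: gauge_le.
by apply: gauge_set_norm; rewrite subrr normr0 mulr_gt0.
Qed.

(** This is subadditivity of the gauge, combined with the inclusion of the ball of radius [r] for
    the increment [y - x]. For admissible [s] and [t] of the two summands, the convex combination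
    with weights [s / (s + t)] and [t / (s + t)] shows that [s + t] is admissible. *)
Lemma gauge_lipschitz x y : gauge y <= gauge x + `|y - x| / r.
Proof.
apply/ler_addgt0Pr => e e0.
pose s := gauge x + e / 2; pose t := `|y - x| / r + e / 2.
have e20 : 0 < e / 2 by rewrite divr_gt0.
have s0 : 0 < s by rewrite ltr_wpDl// gauge_ge0.
have t0 : 0 < t by rewrite ltr_wpDl// divr_ge0// ltW.
have -> : gauge x + `|y - x| / r + e = s + t.
  by rewrite /s /t addrACA -splitr.
apply: gauge_le; split; first exact: addr_gt0.
have [_ Os] : gauge_set x s by apply: gauge_set_lt; rewrite ltrDl.
have Ot : Omega (p + t^-1 *: (y - x)).
  apply: pr; rewrite -ball_normE/= opprD addrA subrr sub0r normrN normrZ.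
  rewrite gtr0_norm ?invr_gt0// mulrC ltr_pdivrMr// mulrDr mulrCA divff ?gt_eqF//.
  by rewrite mulr1 ltrDl mulr_gt0.
have st0 : 0 < s + t by exact: addr_gt0.
rewrite (_ : p + _ = (s / (s + t)) *: (p + s^-1 *: (x - p)) +
   (1 - s / (s + t)) *: (p + t^-1 *: (y - x))); last first.
  apply/rowP => i; rewrite !mxE; field.
  by rewrite !gt_eqF.
apply: Omega_convex => //.
by rewrite divr_ge0 ?(ltW s0) ?(ltW st0)//= ler_pdivrMr// mul1r lerDl ltW.
Qed.

Lemma gauge_convex x y a : 0 < a < 1 ->
  gauge (a *: x + (1 - a) *: y) <= a * gauge x + (1 - a) * gauge y.
Proof.
move=> /andP[a0 a1]; apply/ler_addgt0Pr => e e0.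
have a1' : 0 < 1 - a by rewrite subr_gt0.
pose s := gauge x + e; pose t := gauge y + e.
have s0 : 0 < s by rewrite ltr_wpDl// gauge_ge0.
have t0 : 0 < t by rewrite ltr_wpDl// gauge_ge0.
have -> : a * gauge x + (1 - a) * gauge y + e = a * s + (1 - a) * t.
  by rewrite /s /t; ring.
have as0 : 0 < a * s by exact: mulr_gt0.
have at0 : 0 < (1 - a) * t by exact: mulr_gt0.
have st0 : 0 < a * s + (1 - a) * t by exact: addr_gt0.
apply: gauge_le; split=> //.
have [_ Os] : gauge_set x s by apply: gauge_set_lt; rewrite ltrDl.
have [_ Ot] : gauge_set y t by apply: gauge_set_lt; rewrite ltrDl.
(* The weight for which the combination of the two scaled points is the combination of [x] and [y]
   scaled by [a * s + (1 - a) * t]. *)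
pose b := a * s / (a * s + (1 - a) * t).
rewrite (_ : p + _ = b *: (p + s^-1 *: (x - p)) +
   (1 - b) *: (p + t^-1 *: (y - p))); last first.
  apply/rowP => i; rewrite !mxE /b; field.
  by rewrite !gt_eqF.
apply: Omega_convex => //.
by rewrite /b divr_ge0 ?(ltW as0) ?(ltW st0)//= ler_pdivrMr// mul1r lerDl ltW.
Qed.

Lemma gauge_lipschitz_norm x y : `|gauge y - gauge x| <= `|y - x| / r.
Proof.
rewrite ler_norml lerBlDl gauge_lipschitz andbT lerNl opprB lerBlDl distrC.
exact: gauge_lipschitz.
Qed.

Lemma gauge_ge_norm x : `|x - p| <= gauge x * M.
Proof.
rewrite -ler_pdivrMr//; apply: gauge_ge => t [t0 /OmegaM].
rewrite (addrC p) addrK normrZ gtr0_norm ?invr_gt0// ler_pdivrMl//.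
by rewrite ler_pdivrMr.
Qed.

Lemma gauge_gt0 x : x != p -> 0 < gauge x.
Proof.
move=> xp; rewrite -(pmulr_lgt0 _ M0).
by apply: lt_le_trans (gauge_ge_norm x); rewrite normr_gt0 subr_eq0.
Qed.

Lemma gauge1_boundary x : gauge x = 1 -> boundary Omega x.
Proof.
move=> x1; split; last first.
  by move=> /interior_subset /gauge_lt1; rewrite x1 ltxx.
move=> B /nbhs_ballP[e /= e0 eB].
(* The dilated point has gauge [k < 1], hence lies in [Omega]; its distance to [x] is at most
   [(1 - k) * M], which the second bound makes at most [e / 2]. *)
pose k := Num.max (1 / 2) (1 - e / (2 * M)).
have M20 : 0 < 2 * M by rewrite mulr_gt0.
have k1 : k < 1 by rewrite gt_max ltr_pdivrMr// mul1r ltr1n/= gtrBl divr_gt0.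
have k0 : 0 < k by rewrite lt_max divr_gt0.
exists (p + k *: (x - p)); split.
  by apply/gauge_lt1; rewrite gauge_homo// x1 mulr1.
apply: eB; rewrite -ball_normE/=.
have -> : x - (p + k *: (x - p)) = (1 - k) *: (x - p).
  by rewrite scalerBl scale1r opprD addrA.
rewrite normrZ ger0_norm ?subr_ge0 ?ltW//.
have xM : `|x - p| <= M by have := gauge_ge_norm x; rewrite x1 mul1r.
apply: (@le_lt_trans _ _ (e / (2 * M) * M)).
  rewrite ler_pM ?subr_ge0 ?(ltW k1)// lerBlDr -lerBlDl le_max; apply/orP; right.
  by [].
by rewrite invfM mulrA divfK ?gt_eqF// ltr_pdivrMr// ltr_pMr// ltr1n.
Qed.

Definition gauge_proj (x : V) : V := p + (gauge x)^-1 *: (x - p).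

Lemma gauge_proj1 x : x != p -> gauge (gauge_proj x) = 1.
Proof.
by move=> xp; rewrite gauge_homo ?invr_gt0 ?gauge_gt0// mulVf ?gt_eqF ?gauge_gt0.
Qed.

(** The factor [(gauge x)^-1] of the displacement is absorbed by [|x - p| <= gauge x * M], so the
    estimate does not degenerate near [p]. *)
Lemma gauge_proj_dist x : x != p -> Omega x ->
  `|gauge_proj x - x| <= M * (1 - gauge x).
Proof.
move=> xp /gauge_lt1 x1; have g0 := gauge_gt0 xp.
have -> : gauge_proj x - x = ((gauge x)^-1 - 1) *: (x - p).
  by rewrite scalerBl scale1r opprB addrA /gauge_proj (addrC p).
have -> : (gauge x)^-1 - 1 = (gauge x)^-1 * (1 - gauge x).
  by rewrite mulrBr mulr1 mulVf ?gt_eqF.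
have g1 : 0 <= 1 - gauge x by rewrite subr_ge0 ltW.
rewrite normrZ ger0_norm ?mulr_ge0 ?invr_ge0 ?(ltW g0)// mulrAC.
by rewrite ler_wpM2r// mulrC ler_pdivrMr// mulrC gauge_ge_norm.
Qed.

Lemma gauge_point x v (k t : R) : 1 + t * k != 0 ->
  p + (1 + t * k)^-1 *: (x + t *: v - p) =
  x + (t / (1 + t * k)) *: (v - k *: (x - p)).
Proof. by move=> tk; apply/rowP => i; rewrite !mxE; field. Qed.

Lemma gauge_point_lt x v (k t : R) : 0 < 1 + t * k ->
  (gauge (x + t *: v) < 1 + t * k) =
  `[< Omega (x + (t / (1 + t * k)) *: (v - k *: (x - p))) >].
Proof.
move=> tk; rewrite -gauge_point ?gt_eqF//.
have E : gauge (x + t *: v) =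
    (1 + t * k) * gauge (p + (1 + t * k)^-1 *: (x + t *: v - p)).
  by rewrite gauge_homo ?invr_gt0// mulrA divff ?gt_eqF// mul1r.
rewrite E -[ltRHS]mulr1 ltr_pM2l//.
by apply/idP/asboolP => /gauge_lt1.
Qed.

(* As [x + t *: v] is the dilation by [1 + t * k] about [p] of a point on the ray
   from [x] along [v - k *: (x - p)], comparing [gauge (x + t *: v)] with
   [1 + t * k] amounts to asking on which side of the boundary this ray starts,
   that is, to the sign of [dotv w (v - k *: (x - p))]. *)
Lemma gauge_deriv_boundary x v (w : V) : gauge x = 1 ->
  (forall u, 0 < dotv w u -> \forall t \near (0 : R)^'+, ~ Omega (x + t *: u)) ->
  (forall u, dotv w u < 0 -> \forall t \near (0 : R)^'+, Omega (x + t *: u)) ->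
  0 < dotv w (x - p) ->
  t^-1 * (gauge (x + t *: v) - gauge x) @[t --> (0 : R)^'+] -->
    dotv w v / dotv w (x - p).
Proof.
move=> x1 wout win wxp; set k0 := _ / _; apply/cvgrPdist_le => eps eps0.
have reparam k : t / (1 + t * k) @[t --> (0 : R)^'+] --> (0 : R)^'+.
  apply: at_right_map.
    rewrite -[X in _ --> X](mul0r (1 + 0 * k)^-1).
    apply: cvgM; first exact: cvg_at_right_filter cvg_id.
    apply: cvgV; first by rewrite mul0r addr0.
    apply: cvgD; first exact: cvg_cst.
    by apply: cvgMl; exact: cvg_at_right_filter cvg_id.
  near=> t; rewrite divr_gt0//.
  by near: t; exact: near_right_1D.
have wk k : dotv w (v - k *: (x - p)) = (k0 - k) * dotv w (x - p).
  by rewrite [LHS]dotvDr dotvNr dotvZr mulrBl divfK ?gt_eqF.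
have up : \forall t \near (0 : R)^'+, gauge (x + t *: v) < 1 + t * (k0 + eps).
  have : dotv w (v - (k0 + eps) *: (x - p)) < 0.
    by rewrite wk opprD addrA subrr sub0r mulNr oppr_lt0 mulr_gt0.
  move=> /win /(reparam (k0 + eps)) H; near=> t.
  rewrite gauge_point_lt; last by near: t; exact: near_right_1D.
  by apply/asboolP; near: t.
have lo : \forall t \near (0 : R)^'+, 1 + t * (k0 - eps) <= gauge (x + t *: v).
  have : 0 < dotv w (v - (k0 - eps) *: (x - p)).
    by rewrite wk opprB addrCA subrr addr0 mulr_gt0.
  move=> /wout /(reparam (k0 - eps)) H; near=> t.
  rewrite leNgt gauge_point_lt; last by near: t; exact: near_right_1D.
  by apply/asboolP; near: t.
near=> t.
have t0 : 0 < t by near: t; exact: nbhs_right_gt.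
rewrite x1 distrC ler_distl; apply/andP; split.
  by rewrite ler_pdivlMl// lerBrDl; near: t.
by rewrite ler_pdivrMl// lerBlDl; apply: ltW; near: t.
Unshelve. all: end_near. Qed.

(** By homogeneity, the difference quotient at [x] for the time [t] is the one at the projection for
    the time [t / gauge x]. *)
Lemma gauge_deriv x v (l : R) : x != p ->
  t^-1 * (gauge (gauge_proj x + t *: v) - gauge (gauge_proj x))
    @[t --> (0 : R)^'+] --> l ->
  t^-1 * (gauge (x + t *: v) - gauge x) @[t --> (0 : R)^'+] --> l.
Proof.
move=> xp gl; have g0 := gauge_gt0 xp.
have scale : t / gauge x @[t --> (0 : R)^'+] --> (0 : R)^'+.
  apply: at_right_map.
    rewrite -[X in _ --> X](mul0r (gauge x)^-1).
    by apply: cvgMl; exact: cvg_at_right_filter cvg_id.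
  by near=> t; rewrite divr_gt0.
have -> : (fun t => t^-1 * (gauge (x + t *: v) - gauge x)) =
    (fun t => (t / gauge x)^-1 *
      (gauge (gauge_proj x + (t / gauge x) *: v) - gauge (gauge_proj x))).
  apply/funext => t; rewrite gauge_proj1//.
  have -> : x + t *: v =
      p + gauge x *: (gauge_proj x + (t / gauge x) *: v - p).
    apply/rowP => i; rewrite !mxE; field.
    by rewrite gt_eqF.
  by rewrite gauge_homo// -[X in _ - X]mulr1 -mulrBr invfM invrK mulrA.
exact: (cvg_comp _ _ scale gl).
Unshelve. all: end_near. Qed.

Lemma gauge_deriv_center v :
  t^-1 * (gauge (p + t *: v) - gauge p) @[t --> (0 : R)^'+] --> gauge (p + v).
Proof.
apply: cvg_near_cst; near=> t; have t0 : 0 < t by near: t; exact: nbhs_right_gt.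
rewrite gauge_center subr0 -[X in p + _ *: X](addrK p) (addrC v) gauge_homo//.
by rewrite mulKf ?gt_eqF.
Unshelve. all: end_near. Qed.

End gauge.

(** * The outward normal and the derivative of the gauge *)

Section outward_normal.
Context {R : realType} {n : nat}.
Variable Omega : set 'rV[R]_n.
Hypothesis Omega_C21 : C21_boundary Omega.

(** [outward_normal] chooses among the vectors given by all charts at [x]; unit length and the
    separation of the two sides hold for each of them, hence for the chosen one. *)
Lemma outward_normal_spec x : boundary Omega x ->
  let nx := outward_normal Omega x in
  [/\ dotv nx nx = 1,
      forall u, 0 < dotv nx u ->
        \forall t \near (0 : R)^'+, ~ Omega (x + t *: u) &
      forall u, dotv nx u < 0 ->
        \forall t \near (0 : R)^'+, Omega (x + t *: u)].
Proof.
move=> bx nx; have : is_outward_normal Omega x nx.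
  have [Q [i [r [gamma chart]]]] := Omega_C21 bx.
  apply: (@xgetPex _ 0 (is_outward_normal Omega x)).
  by exists ((enorm (graph_conormal i gamma (col' i (x *m Q))))^-1 *:
     (graph_conormal i gamma (col' i (x *m Q)) *m Q^T)), Q, i, r, gamma.
move=> [Q [i [r [gamma [chart /=]]]]]; set m := graph_conormal _ _ _ => nxE.
have [QQ _ _ _] := chart.
have mm : dotv (m *m Q^T) (m *m Q^T) = dotv m m.
  by rewrite dotv_mulmxr -mulmxA (mulmx1C QQ) mulmx1.
have m0 : 0 < dotv m m by rewrite -mm; exact: chart_conormal_neq0 chart.
have em0 : 0 < enorm m by rewrite sqrtr_gt0.
rewrite nxE; split.
- rewrite dotvZl dotvZr mm -sqr_enorm mulrA -invfM -expr2 mulVf//.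
  by rewrite expf_neq0// gt_eqF.
- move=> u; rewrite dotvZl pmulr_rgt0 ?invr_gt0// => /(chart_outside chart bx).
  exact.
- move=> u; rewrite dotvZl pmulr_rlt0 ?invr_gt0// => /(chart_inside chart bx).
  exact.
Qed.

End outward_normal.

Lemma convex_set_conv {R : realType} {n} (Omega : set 'rV[R]_n)
    (x y : 'rV[R]_n) (a : R) :
  convex_set (Omega : set (convex_lmodType 'rV[R]_n)) ->
  Omega x -> Omega y -> 0 <= a <= 1 -> Omega (a *: x + (1 - a) *: y).
Proof.
move=> cO Ox Oy /andP[a0 a1].
by have := cO x y (Itv01 a0 a1); rewrite !inE; apply.
Qed.

Lemma boundary_gauge {R : realType} {n} (Omega : set 'rV[R]_n) :
  Omega !=set0 -> open Omega -> bounded_set Omega ->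
  convex_set (Omega : set (convex_lmodType 'rV[R]_n)) -> C21_boundary Omega ->
  exists (rho : 'rV[R]_n -> R) (drho : 'rV[R]_n -> 'rV[R]_n -> R)
    (proj : 'rV[R]_n -> 'rV[R]_n) (K : R),
  [/\ 0 < K, forall x, 0 <= rho x, forall x, rho x < 1 <-> Omega x,
      forall x y, `|rho y - rho x| <= K * `|y - x| &
      (forall x v, t^-1 * (rho (x + t *: v) - rho x) @[t --> (0 : R)^'+] -->
         drho x v) /\
      (forall x, Omega x -> rho x = 0 \/
         [/\ boundary Omega (proj x), `|proj x - x| <= K * (1 - rho x) &
            exists a, forall v,
              drho x v = a * dotv (outward_normal Omega (proj x)) v])].
Proof.
move=> [p Op] oO bO cO C21.
have /nbhs_ballP[r /= r0 pr] := open_nbhs_nbhs (conj oO Op).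
have [M M0 OM] : exists2 M : R, 0 < M & forall x, Omega x -> `|x - p| <= M.
  have [M' [_ M'P]] := bO; pose M := Num.max M' 0 + 1.
  have M0 : 0 < M by rewrite ltr_wpDl// le_max lexx orbT.
  exists (M + `|p|); first by rewrite ltr_wpDr.
  move=> x Ox; apply: le_trans (ler_normB _ _) _; rewrite lerD2r.
  by apply: (M'P M) => //; rewrite ltr_pwDr// le_max lexx.
have cvx x y a := @convex_set_conv R n Omega x y a cO.
pose rho := gauge Omega p; pose proj := gauge_proj Omega p.
(* At the center the one-sided derivative along [v] is the gauge itself, which need not be linear in
   [v]. *)
pose drho x v := if x == p then rho (p + v) else
  dotv (outward_normal Omega (proj x)) v /
  dotv (outward_normal Omega (proj x)) (proj x - p).
have proj1 x : x != p -> rho (proj x) = 1.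
  by move=> xp; exact: (gauge_proj1 r0 pr M0 OM xp).
have bproj x : x != p -> boundary Omega (proj x).
  by move=> /proj1; exact: (gauge1_boundary oO cvx r0 pr M0 OM).
have r10 : 0 < r^-1 by rewrite invr_gt0.
(* [M] serves the distance to the projection, [r^-1] the Lipschitz estimate. *)
exists rho, drho, proj, (Num.max M r^-1); split.
- by rewrite lt_max M0.
- exact: gauge_ge0 r0 pr.
- exact: gauge_lt1 oO cvx r0 pr.
- move=> x y; apply: le_trans (gauge_lipschitz_norm cvx r0 pr x y) _.
  by rewrite mulrC ler_wpM2r// le_max lexx orbT.
split=> [x v|x Ox].
  rewrite /drho; case: eqVneq => [->|xp]; first exact: (gauge_deriv_center r0 pr).
  have [nn nout nin] := outward_normal_spec C21 (bproj _ xp).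
  set nx := outward_normal _ _ in nn nout nin *.
  apply: (gauge_deriv r0 pr M0 OM xp).
  apply: (gauge_deriv_boundary oO cvx r0 pr (proj1 _ xp) nout nin).
  (* It remains to see that [nx] has a positive product with [proj x - p]. With this [s] the point
     [p + s *: nx] lies in [Omega]. If [nx] had a positive product with [p + s *: nx - proj x], the
     segment from [proj x] to that point would start outside [Omega], against the convexity of the
     gauge; so the product with [proj x - p] is at least [s]. *)
  pose s := r / (`|nx| + 1).
  have s0 : 0 < s by rewrite divr_gt0// ltr_wpDl.
  have Os : Omega (p + s *: nx).
    apply: pr; rewrite -ball_normE/= opprD addrA subrr sub0r normrN normrZ.
    rewrite gtr0_norm// /s mulrAC ltr_pdivrMr ?ltr_wpDl// ltr_pM2l//.
    by rewrite ltrDl.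
  suff : dotv nx (p + s *: nx - proj x) <= 0.
    have -> : p + s *: nx - proj x = s *: nx - (proj x - p).
      by apply/rowP => i; rewrite !mxE; ring.
    rewrite [X in X <= 0]dotvDr dotvZr nn mulr1 dotvNr subr_le0.
    exact: lt_le_trans.
  rewrite leNgt; apply/negP => /nout nOmega.
  near (0 : R)^'+ => t.
  have t0 : 0 < t by near: t; exact: nbhs_right_gt.
  have t1 : t < 1 by near: t; exact: nbhs_right_lt.
  have : ~ Omega (proj x + t *: (p + s *: nx - proj x)) by near: t.
  apply; apply/(gauge_lt1 oO cvx r0 pr).
  have -> : proj x + t *: (p + s *: nx - proj x) =
      t *: (p + s *: nx) + (1 - t) *: proj x.
    by apply/rowP => i; rewrite !mxE; ring.
  have t01 : 0 < t < 1 by rewrite t0.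
  apply: le_lt_trans (gauge_convex cvx r0 pr _ _ t01) _.
  have gt : t * gauge Omega p (p + s *: nx) < t.
    by rewrite gtr_pMr//; exact/(gauge_lt1 oO cvx r0 pr).
  by rewrite -/(rho (proj x)) proj1// mulr1; lra.
have [->|xp] := eqVneq x p; [left|right].
  exact: gauge_center r0 pr.
split; first exact: bproj.
  apply: le_trans (gauge_proj_dist oO cvx r0 pr M0 OM xp Ox) _.
  rewrite ler_wpM2r ?le_max ?lexx// subr_ge0 ltW//.
  exact/(gauge_lt1 oO cvx r0 pr).
exists (dotv (outward_normal Omega (proj x)) (proj x - p))^-1 => v.
by rewrite /drho (negbTE xp) mulrC.
Unshelve. all: end_near. Qed.

(** * Real sequences and Gaussian bounds *)

Section seq_deriv.
Context {R : realType}.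
Implicit Types (a b : nat -> R) (l c : R).

(** The right derivative at time 0 of a quantity with value [a0] there, sampled at the times
    [n.+1%:R^-1]. *)
Definition seq_deriv a (a0 l : R) : Prop :=
  n.+1%:R * (a n - a0) @[n --> \oo] --> l.

Lemma seq_deriv_cvg a (a0 : R) l : seq_deriv a a0 l -> a n @[n --> \oo] --> a0.
Proof.
move=> al; have -> : a = (fun n => n.+1%:R^-1 * (n.+1%:R * (a n - a0)) + a0).
  by apply/funext => n; rewrite mulKf ?subrK// pnatr_eq0.
rewrite -[X in _ --> X]add0r -(mul0r l); apply: cvgD; last exact: cvg_cst.
by apply: cvgM => //; exact: cvg_harmonic.
Qed.

Lemma seq_deriv_near a b (a0 : R) l : (\forall n \near \oo, a n = b n) ->
  seq_deriv a a0 l -> seq_deriv b a0 l.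
Proof.
move=> ab; apply: cvg_trans; apply: near_eq_cvg.
by near=> n; congr (_ * (_ - _)); near: n.
Unshelve. all: end_near. Qed.

Lemma seq_deriv_cst c : seq_deriv (fun=> c) c 0.
Proof. by rewrite /seq_deriv; apply: cvg_near_cst; apply: nearW => n; rewrite subrr mulr0. Qed.

Lemma seq_derivB a b (a0 b0 : R) l (k : R) : seq_deriv a a0 l -> seq_deriv b b0 k ->
  seq_deriv (fun n => a n - b n) (a0 - b0) (l - k).
Proof.
move=> al bk; rewrite /seq_deriv.
have -> : (fun n => n.+1%:R * (a n - b n - (a0 - b0))) =
    (fun n => n.+1%:R * (a n - a0)) \- (fun n => n.+1%:R * (b n - b0)).
  by apply/funext => n /=; ring.
exact: cvgB.
Qed.

Lemma seq_derivM a b (a0 b0 : R) l (k : R) : seq_deriv a a0 l -> seq_deriv b b0 k ->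
  seq_deriv (fun n => a n * b n) (a0 * b0) (l * b0 + a0 * k).
Proof.
move=> al bk; rewrite /seq_deriv.
have -> : (fun n => n.+1%:R * (a n * b n - a0 * b0)) =
    (fun n => n.+1%:R * (a n - a0) * b n) \+ (fun n => a0 * (n.+1%:R * (b n - b0))).
  by apply/funext => n /=; ring.
by apply: cvgD; [exact: cvgM al (seq_deriv_cvg bk)|exact: cvgMr].
Qed.

Lemma seq_derivX a (a0 : R) l (k : nat) : seq_deriv a a0 l ->
  seq_deriv (fun n => a n ^+ k) (a0 ^+ k) (k%:R * a0 ^+ k.-1 * l).
Proof.
move=> al; elim: k => [|k IH].
  by rewrite !mul0r; exact: seq_deriv_cst.
under eq_fun do rewrite exprS; rewrite exprS.
have := seq_derivM al IH; congr seq_deriv.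
case: k {IH} => [|k] /=; first by rewrite expr0; ring.
by rewrite exprS -[k.+2]addn1 natrD; ring.
Qed.

End seq_deriv.

Section power_bounds.
Context {R : realType}.

Lemma ler_dist_X (a b : R) k : 0 <= a <= 1 -> 0 <= b <= 1 ->
  `|a ^+ k - b ^+ k| <= k%:R * `|a - b|.
Proof.
move=> /andP[a0 a1] /andP[b0 b1]; rewrite subrXX normrM mulrC ler_wpM2r//.
apply: le_trans (ler_norm_sum _ _ _) _.
rewrite -[k in k%:R]card_ord -sum1_card natr_sum; apply: ler_sum => i _.
by rewrite normrM !ger0_norm ?exprn_ge0// mulr_ile1 ?exprn_ge0 ?exprn_ile1.
Qed.

(** Each of the [k.+1] terms of $1 + a + \dots + a^k = (1 - a^{k+1})/(1 - a)$ is at least $a^k$.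
    This bounds, uniformly in [k], the slope of the cutoff times the distance to the boundary. *)
Lemma ler_kX_onem (a : R) k : 0 <= a <= 1 -> k.+1%:R * a ^+ k * (1 - a) <= 1.
Proof.
move=> /andP[a0 a1]; apply: (@le_trans _ _ (1 - a ^+ k.+1)); last first.
  by rewrite lerBlDr lerDl exprn_ge0.
rewrite -[X in _ <= X - _](expr1n _ k.+1) subrXX mulrC ler_wpM2l ?subr_ge0//.
rewrite mulr_natl -{1}[k.+1]card_ord -sumr_const.
apply: ler_sum => i _; rewrite expr1n mul1r.
by rewrite ler_wiXn2l// -ltnS.
Qed.

(** Splitting $a^k = s^k s^k$ with $s = \sqrt a$, the preceding bound controls $(k+1)s^k$ by
    $1/(1-s)$ and the other factor tends to 0. *)
Lemma cvg_kX (a : R) : 0 <= a < 1 -> k.+1%:R * a ^+ k @[k --> \oo] --> (0 : R).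
Proof.
move=> /andP[a0 a1]; pose s := Num.sqrt a.
have s0 : 0 <= s by exact: sqrtr_ge0.
have s1 : s < 1 by rewrite -sqrtr1 ltr_sqrt.
have aE : a = s * s by rewrite -expr2 sqr_sqrtr.
apply: (@squeeze_cvgr _ _ _ _ (fun=> 0) (fun k => (1 - s)^-1 * s ^+ k)).
- near=> k; rewrite mulr_ge0 ?exprn_ge0//= aE exprMn mulrA ler_wpM2r ?exprn_ge0//.
  rewrite -[leRHS]mul1r ler_pdivlMr ?subr_gt0//.
  by apply: ler_kX_onem; rewrite s0 ltW.
- exact: cvg_cst.
- rewrite -[X in _ --> X](mulr0 (1 - s)^-1); apply: cvgMr.
  by apply: cvg_expr; rewrite ger0_norm.
Unshelve. all: end_near. Qed.

End power_bounds.

Section gauss_bounds.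
Context {R : realType} {n : nat}.
Implicit Types u v x : 'rV[R]_n.

Lemma dotvB_le u v : dotv (u - v) (u - v) <= 2 * dotv u u + 2 * dotv v v.
Proof.
rewrite /dotv !big_distrr/= -big_split/=; apply: ler_sum => i _.
rewrite !mxE -!expr2 -subr_ge0.
have -> : 2 * u 0 i ^+ 2 + 2 * v 0 i ^+ 2 - (u 0 i - v 0 i) ^+ 2 = (u 0 i + v 0 i) ^+ 2.
  by ring.
exact: sqr_ge0.
Qed.

Lemma ler_norm_enorm v : `|v| <= enorm v.
Proof.
have [->|v0] := eqVneq `|v| 0; first exact: enorm_ge0.
have [[i j]] := @mx_norm_neq0 _ _ _ v v0.
by rewrite -[mx_norm v]/`|v| => -> /=; rewrite ord1; exact: ler_coord_enorm.
Qed.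

Lemma ler_enorm_sqr v : enorm v <= 1 + dotv v v.
Proof.
rewrite -sqr_enorm -subr_ge0.
have -> : 1 + enorm v ^+ 2 - enorm v = (enorm v - 1 / 2) ^+ 2 + 3 / 4 by field.
by rewrite addr_ge0 ?sqr_ge0// divr_ge0.
Qed.

(** The constant comes from $|v| \le 1 + |v|^2 \le 8(1 + |v|^2/8) \le 8e^{|v|^2/8}$. *)
Lemma enorm_gauss v : enorm v * gauss (1 / 4) v <= 8 * gauss (1 / 8) v.
Proof.
have H : enorm v <= 8 * expR (1 / 8 * dotv v v).
  apply: le_trans (ler_enorm_sqr v) _.
  have := @expR_ge1Dx R (1 / 8 * dotv v v).
  by have := dotv_ge0 v; lra.
apply: le_trans (ler_wpM2r (gauss_ge0 _ _) H) _.
rewrite -[leLHS]mulrA; apply: ler_wpM2l => //; rewrite /gauss -expRD ler_expR.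
by have := dotv_ge0 v; lra.
Qed.

Lemma exprn_gauss (m : nat) : exists2 C : R, 0 <= C &
  forall v, (1 + enorm v) ^+ m * gauss (1 / 2) v <= C * gauss (1 / 4) v.
Proof.
(* From $1 + |v| \le K e^{|v|^2/K}$ the [m]-th power costs the exponent $m/K$, which this [K] keeps
   below 1/4; [m.+1] covers the case [m = 0]. *)
pose K : R := 4 * m.+1%:R.
have K4 : 4 <= K by rewrite /K ler_peMr// ler1n.
have K0 : 0 < K by apply: lt_le_trans K4.
exists (K ^+ m) => [|v]; first by rewrite exprn_ge0// ltW.
have H : 1 + enorm v <= K * expR (K^-1 * dotv v v).
  have := @expR_ge1Dx R (K^-1 * dotv v v).
  rewrite -(ler_pM2l K0) mulrDr mulVKf ?gt_eqF//; apply: le_trans.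
  have := ler_enorm_sqr v; lra.
have H2 : (1 + enorm v) ^+ m <= K ^+ m * expR (1 / 4 * dotv v v).
  apply: (@le_trans _ _ ((K * expR (K^-1 * dotv v v)) ^+ m)).
    by rewrite lerXn2r// ?nnegrE ?addr_ge0 ?enorm_ge0 ?mulr_ge0 ?expR_ge0 ?(ltW K0).
  rewrite exprMn ler_wpM2l ?exprn_ge0 ?(ltW K0)// -expRM_natl ler_expR mulrA.
  rewrite ler_wpM2r ?dotv_ge0// ler_pdivrMr// /K mulrA divfK// mul1r.
  by rewrite ler_nat.
apply: le_trans (ler_wpM2r (gauss_ge0 _ _) H2) _.
rewrite -[leLHS]mulrA ler_wpM2l ?exprn_ge0 ?(ltW K0)// /gauss -expRD ler_expR.
by have := dotv_ge0 v; lra.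
Qed.

Lemma ler_gauss (a b : R) v : a <= b -> gauss b v <= gauss a v.
Proof. by move=> ab; rewrite ler_expR lerN2 ler_wpM2r// dotv_ge0. Qed.

(** Half of the exponent is lost to $|v|^2 \le 2|v + w|^2 + 2|w|^2$. *)
Lemma gauss_shift v w : gauss (1 / 4) (v + w) <= expR (1 / 4 * dotv w w) * gauss (1 / 8) v.
Proof.
rewrite /gauss -expRD ler_expR.
have := dotvB_le (v + w) w; rewrite addrK.
by have := dotv_ge0 w; lra.
Qed.

(* The factor [gauss (1 / 32) x] replaces the indicator of the bounded region
   that is swept when a point of Omega moves with velocity at most [v]. *)
Lemma gauss_region x v (B : R) : dotv x x <= 2 * B + 2 * dotv v v ->
  gauss (1 / 8) v <= expR (1 / 16 * B) * (gauss (1 / 32) x * gauss (1 / 32) v).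
Proof.
rewrite /gauss -!expRD ler_expR => H.
by have := dotv_ge0 v; lra.
Qed.

End gauss_bounds.

Section gauss_prod.
Context {R : realType} {n m : nat}.

Lemma integrable_gauss_prod (a : R) (C : R) : 0 < a -> 0 <= C ->
  (lebesgue_rV n \x lebesgue_rV m)%E.-integrable setT
    (fun z => (C * (gauss a z.1 * gauss a z.2))%:E).
Proof.
move=> a0 C0.
have mg : measurable_fun setT
    (fun z : 'rV[R]_n * 'rV[R]_m => C * (gauss a z.1 * gauss a z.2)).
  by apply: measurable_funM => //; apply: measurable_funM; exact: measurable_gauss.
have [c1 c10 E1] := integral_gauss n a0; have [c2 c20 E2] := integral_gauss m a0.
apply/integrable12ltyP; first exact/measurable_EFinP.
under eq_integral => x _.
  under eq_integral => y _.
    rewrite /= ger0_norm ?mulr_ge0 ?gauss_ge0// mulrA EFinM.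
    over.
  rewrite ge0_integralZl//=; last 3 first.
  - exact/measurable_EFinP/measurable_gauss.
  - by move=> y _; rewrite lee_fin gauss_ge0.
  - by rewrite lee_fin mulr_ge0 ?gauss_ge0.
  rewrite E2 -EFinM mulrAC EFinM.
  over.
rewrite ge0_integralZl//=; last 3 first.
- exact/measurable_EFinP/measurable_gauss.
- by move=> y _; rewrite lee_fin gauss_ge0.
- by rewrite lee_fin mulr_ge0// ltW.
by rewrite E1 -EFinM ltry.
Qed.

End gauss_prod.

Lemma ler_coord_norm {R : realType} n (u : 'rV[R]_n) i : `|u 0 i| <= `|u|.
Proof.
apply/ler_addgt0Pr => e e0.
have [_ /(_ 0 i)] : ball 0 (`|u| + e) u.
  by rewrite -[X in X u]/(ball _ _) -ball_normE/= sub0r normrN ltrDl.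
by rewrite mxE -ball_normE/= sub0r normrN => /ltW.
Qed.

Lemma sum_coord_bound {R : realType} d (u : 'rV[R]_d) (F : 'I_d -> R) (M : R) :
  (forall i, `|F i| <= M) -> `|\sum_(i < d) u 0 i * F i| <= d%:R * M * `|u|.
Proof.
move=> FM; apply: le_trans (ler_norm_sum _ _ _) _.
have -> : d%:R * M * `|u| = \sum_(i < d) (M * `|u|).
  by rewrite sumr_const card_ord -[RHS]mulr_natl mulrA.
apply: ler_sum => i _.
by rewrite normrM mulrC; apply: ler_pM => //; exact: ler_coord_norm.
Qed.

Lemma pair_addZ {R : realType} {n m : nat} (y u : 'rV[R]_n) (v w : 'rV[R]_m) (s : R) :
  (y, v) + s *: (u, w) = (y + s *: u, v + s *: w).
Proof. by []. Qed.

Lemma gauss_prod_ge0 {R : realType} {n m : nat} (a b K : R) (x : 'rV[R]_n)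
    (v : 'rV[R]_m) : 0 <= K -> 0 <= K * (gauss a x * gauss b v).
Proof. by move=> K0; rewrite mulr_ge0// mulr_ge0// gauss_ge0. Qed.

(** * Flows on phase space *)

Section phase_function.
Context {R : realType} {d : nat}.
Local Notation V := 'rV[R]_d.
Variables (Omega : set V) (B C : R).
Variables (H : V * V -> R) (DH : 'I_d + 'I_d -> V * V -> R).
Let A : set (V * V) := phase_domain Omega.
Hypotheses (Omega_open : open Omega) (B_ge0 : 0 <= B).
Hypothesis Omega_B : forall x, Omega x -> dotv x x <= B.
Hypothesis Omega_convex : forall (x y : V) (a : R), Omega x -> Omega y ->
  0 <= a <= 1 -> Omega (a *: x + (1 - a) *: y).
Hypothesis H_continuous : {within closure A, continuous H}.
Hypothesis H_derive : forall a z, A z -> is_derive z (phase_basis a) H (DH a z).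
Hypothesis DH_continuous : forall a z, A z -> {for z, continuous (DH a)}.
Hypothesis C_ge0 : 0 <= C.
Hypothesis H_bound : forall x v, closure Omega x ->
  `|H (x, v)| <= C * gauss (1 / 4) v.
Hypothesis DH_bound : forall a x v, Omega x ->
  `|DH a (x, v)| <= C * gauss (1 / 4) v.

Lemma phase_domain_open : open A.
Proof.
rewrite (_ : A = fst @^-1` Omega); first by apply: open_comp => // z _; exact: cvg_fst.
by apply/seteqP; split=> -[x v] //= [].
Qed.

Lemma phase_domain_measurable : measurable A.
Proof. by apply: open_measurable_prod; exact: phase_domain_open. Qed.

Lemma closure_phase_domain x v : closure Omega x -> closure A (x, v).
Proof.
move=> cx W [[W1 W2] /= [W1x W2v] W12].
have [y [Oy W1y]] := cx _ W1x.
by exists (y, v); split=> //; apply: W12; split=> //; exact: nbhs_singleton.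
Qed.

Lemma measurable_phase (g : V * V -> R) :
  (forall z, A z -> {for z, continuous g}) -> measurable_fun setT (g \_ A).
Proof.
move=> cg; apply/(measurable_restrictT _ phase_domain_measurable).
apply: continuous_measurable_prod; first exact: phase_domain_open.
by move=> z; rewrite inE; exact: cg.
Qed.

Lemma H_continuous_in z : A z -> {for z, continuous H}.
Proof.
move=> Az; move: H_continuous => /(continuous_subspaceW (@subset_closure _ A)).
rewrite continuous_open_subspace; last exact: phase_domain_open.
by move=> /(_ z); apply; rewrite inE.
Qed.

Lemma measurable_H : measurable_fun setT (H \_ A).
Proof. by apply: measurable_phase => z; exact: H_continuous_in. Qed.

Lemma sum_phase_basis_l (u : V) :
  \sum_(a <- map inl (index_enum 'I_d))
    (if a is inl i then u 0 i else 0) *: phase_basis a = (u, 0).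
Proof.
rewrite big_map.
have -> : \sum_(i < d) u 0 i *: (phase_basis (inl i) : V * V) =
    (\sum_(i < d) u 0 i *: basis_rV i, 0).
  rewrite (big_morph (fun x : V => (x, 0) : V * V) (id1 := 0) (op1 := +%R))//.
    by apply: eq_bigr => i _; congr (_, _); rewrite scaler0.
  by move=> x y; congr (_, _); rewrite addr0.
by rewrite -row_sum_delta.
Qed.

Lemma sum_phase_basis_r (u : V) :
  \sum_(a <- map inr (index_enum 'I_d))
    (if a is inr i then u 0 i else 0) *: phase_basis a = (0, u).
Proof.
rewrite big_map.
have -> : \sum_(i < d) u 0 i *: (phase_basis (inr i) : V * V) =
    (0, \sum_(i < d) u 0 i *: basis_rV i).
  rewrite (big_morph (fun x : V => (0, x) : V * V) (id1 := 0) (op1 := +%R))//.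
    by apply: eq_bigr => i _; congr (_, _); rewrite scaler0.
  by move=> x y; congr (_, _); rewrite addr0.
by rewrite -row_sum_delta.
Qed.

Lemma H_derive_l z (u : V) : A z ->
  is_derive z (u, 0) H (\sum_(i < d) u 0 i * DH (inl i) z).
Proof.
move=> Az; rewrite -sum_phase_basis_l.
have := is_derive_sum_directions (map inl (index_enum 'I_d))
  (fun a => if a is inl i then u 0 i else 0) phase_domain_open Az H_derive DH_continuous.
by rewrite [X in is_derive _ _ _ X]big_map.
Qed.

Lemma H_derive_r z (u : V) : A z ->
  is_derive z (0, u) H (\sum_(i < d) u 0 i * DH (inr i) z).
Proof.
move=> Az; rewrite -sum_phase_basis_r.
have := is_derive_sum_directions (map inr (index_enum 'I_d))
  (fun a => if a is inr i then u 0 i else 0) phase_domain_open Az H_derive DH_continuous.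
by rewrite [X in is_derive _ _ _ X]big_map.
Qed.

(** Convexity keeps the segment from [y] to [x] in [Omega], so the mean value theorem applies with
    the bound on the derivatives. *)
Lemma H_lipschitz_l x y v : Omega x -> Omega y ->
  `|H (x, v) - H (y, v)| <= d%:R * (C * gauss (1 / 4) v) * `|x - y|.
Proof.
move=> Ox Oy.
have As (s : R) : 0 <= s <= 1 -> Omega (y + s *: (x - y)).
  move=> s01; have -> : y + s *: (x - y) = s *: x + (1 - s) *: y.
    by apply/rowP => i; rewrite !mxE; ring.
  exact: Omega_convex.
have As2 s : 0 <= s <= 1 -> A ((y, v) + s *: (x - y, 0)).
  by move=> s01; split=> //; exact: As.
have [s s01] := @mean_value_line _ _ H
  (fun s => \sum_(i < d) (x - y) 0 i * DH (inl i) ((y, v) + s *: (x - y, 0)))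
  (y, v) (x - y, 0) (fun s s01 => H_derive_l _ (As2 s s01)).
have -> : (y, v) + (x - y, 0) = (x, v).
  by congr (_, _); rewrite ?addr0 // addrC subrK.
move=> ->; apply: sum_coord_bound => i.
have -> : (y, v) + s *: (x - y, 0) = (y + s *: (x - y), v).
  by rewrite pair_addZ scaler0 addr0.
by apply: DH_bound; apply: As; case/andP: s01 => /ltW -> /ltW ->.
Qed.

(** The derivatives are controlled in the open set only, so [y] is replaced by a nearby point [z] of
    [Omega], using the continuity of [H] up to the boundary. *)
Lemma H_lipschitz_boundary x y v : Omega x -> closure Omega y ->
  `|H (x, v) - H (y, v)| <= d%:R * (C * gauss (1 / 4) v) * `|x - y|.
Proof.
move=> Ox cy; set L := d%:R * _.
have L0 : 0 <= L by rewrite !mulr_ge0// gauss_ge0.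
apply/ler_addgt0Pr => e e0.
have L10 : 0 < L + 1 by rewrite ltr_wpDl.
(* An error [e1] in position costs [L * e1], and an error [e1] in the value of [H] is added: [e] in
   total. *)
pose e1 := e / (L + 1).
have e10 : 0 < e1 by rewrite divr_gt0.
have cA : closure A (y, v) by exact: closure_phase_domain.
have /subspace_continuousP /(_ _ cA) := H_continuous.
move=> /cvgrPdist_lt /(_ _ e10) [[W1 W2] /= [W1y W2v] W12].
have [z [Oz [W1z zy]]] := cy _ (filterI W1y (nbhsx_ballx y e1 e10)).
have Hz : `|H (y, v) - H (z, v)| < e1.
  apply: (W12 (z, v)); last by apply: closure_phase_domain; exact: subset_closure.
  by split=> //; exact: nbhs_singleton.
rewrite -ball_normE/= in zy.
rewrite -(subrK (H (z, v)) (H (x, v))) -addrA.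
apply: le_trans (ler_normD _ _) _.
apply: le_trans (lerD (H_lipschitz_l v Ox Oz) (ltW _)) _.
  by rewrite distrC; exact: Hz.
have xz : `|x - z| <= `|x - y| + e1.
  rewrite -(subrK y x) -addrA; apply: le_trans (ler_normD _ _) _.
  by rewrite subrK lerD2l ltW.
apply: le_trans (lerD (ler_wpM2l L0 xz) (lexx _)) _.
rewrite mulrDr -addrA lerD2l -[X in _ + X]mul1r -mulrDl /e1 mulrCA divff ?mulr1//.
by rewrite gt_eqF.
Qed.

Let lam2 := (@lebesgue_rV R d \x @lebesgue_rV R d)%E.

Lemma restrict_phaseT (g : V * V -> R) x v : Omega x -> (g \_ A) (x, v) = g (x, v).
Proof. by move=> Ox; rewrite patchT// inE. Qed.

Lemma restrict_phaseN (g : V * V -> R) x v : ~ Omega x -> (g \_ A) (x, v) = 0.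
Proof. by move=> Ox; rewrite patchN// notin_setE => -[]. Qed.

(** Applied with [t = 0] to points of [Omega] and with [t] a time step to points carried into
    [Omega], this dominates difference quotients by one function on the whole phase space. *)
Lemma gauss_Omega x v t : Omega (x + t *: v) -> 0 <= t <= 1 ->
  gauss (1 / 8) v <= expR (1 / 16 * B) * (gauss (1 / 32) x * gauss (1 / 32) v).
Proof.
move=> Ox /andP[t0 t1]; apply: gauss_region.
rewrite -[x](addrK (t *: v)); apply: le_trans (dotvB_le _ _) _.
apply: lerD; first by rewrite ler_pM2l//; exact: Omega_B.
rewrite ler_pM2l// dotvZl dotvZr mulrA ler_piMl ?dotv_ge0// -expr2.
by rewrite exprn_ile1.
Qed.

Lemma integrable_gauss_bound (g : V * V -> R) (K : R) :
  measurable_fun setT g -> 0 <= K ->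
  (forall z, `|g z| <= K * (gauss (1 / 32) z.1 * gauss (1 / 32) z.2)) ->
  lam2.-integrable setT (EFin \o g).
Proof.
move=> mg K0 gK; have a0 : (0 : R) < 1 / 32 by rewrite divr_gt0.
apply: le_integrable (@integrable_gauss_prod R d d _ _ a0 K0) => //.
  exact/measurable_EFinP.
move=> z _; rewrite /= lee_fin [leRHS]ger0_norm ?gK//.
by rewrite !mulr_ge0 ?gauss_ge0.
Qed.

Lemma integrable_H : lam2.-integrable setT (EFin \o (H \_ A)).
Proof.
apply: (@integrable_gauss_bound _ (C * expR (1 / 16 * B))).
- exact: measurable_H.
- by rewrite mulr_ge0// expR_ge0.
move=> [x v]/=; have [Ox|Ox] := pselect (Omega x); last first.
  rewrite restrict_phaseN// normr0 gauss_prod_ge0//.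
  by rewrite mulr_ge0// expR_ge0.
rewrite restrict_phaseT//; apply: le_trans (H_bound _ _) _.
  exact: subset_closure.
rewrite -mulrA ler_wpM2l//; apply: (@le_trans _ _ (gauss (1 / 8) v)).
  by apply: ler_gauss; lra.
by apply: (@gauss_Omega _ _ 0); rewrite ?scale0r ?addr0 ?lexx ?ler01.
Qed.

(** * The velocity term *)

Section velocity_flow.
Variables (b : V -> V) (Kb : R).
Hypotheses (mb : measurable_fun setT b) (bK : forall x, Omega x -> `|b x| <= Kb).
Hypothesis Kb0 : 0 <= Kb.

Lemma dotv_le_norm (u : V) : dotv u u <= d%:R * `|u| ^+ 2.
Proof.
have -> : d%:R * `|u| ^+ 2 = \sum_(i < d) `|u| ^+ 2.
  by rewrite sumr_const card_ord -[RHS]mulr_natl.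
apply: ler_sum => i _; rewrite -expr2 -[u 0 i ^+ 2]real_normK ?num_real//.
by rewrite lerXn2r ?nnegrE// ler_coord_norm.
Qed.

(** The exponential factor is the price of evaluating the Gaussian at a shifted velocity: the shift
    has sup norm at most [Kb], hence squared Euclidean length at most [d%:R * Kb ^+ 2]. *)
Lemma H_lipschitz_r x v t : Omega x -> 0 <= t <= 1 ->
  `|H (x, v + t *: b x) - H (x, v)| <=
  d%:R * (C * (expR (1 / 4 * (d%:R * Kb ^+ 2)) * gauss (1 / 8) v)) * (t * Kb).
Proof.
move=> Ox t01; pose u := t *: b x; have [t0 t1] := andP t01.
have As2 s : 0 <= s <= 1 -> A ((x, v) + s *: (0, u)).
  by move=> s01; split=> //=; rewrite scaler0 addr0.
have [s s01] := @mean_value_line _ _ H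
  (fun s => \sum_(i < d) u 0 i * DH (inr i) ((x, v) + s *: (0, u)))
  (x, v) (0, u) (fun s s01 => H_derive_r _ (As2 s s01)).
have -> : (x, v) + (0, u) = (x, v + u) by congr (_, _); rewrite addr0.
have s0 : 0 <= s <= 1 by case/andP: s01 => /ltW -> /ltW ->.
move=> ->; apply: le_trans (sum_coord_bound (M :=
  C * (expR (1 / 4 * (d%:R * Kb ^+ 2)) * gauss (1 / 8) v)) _ _) _.
  move=> i; rewrite pair_addZ scaler0 addr0.
  apply: le_trans (DH_bound _ _ Ox) _; rewrite ler_wpM2l//.
  apply: le_trans (gauss_shift _ _) _; rewrite ler_wpM2r ?gauss_ge0// ler_expR.
  rewrite ler_pM2l ?divr_gt0//; apply: le_trans (dotv_le_norm _) _.
  rewrite ler_wpM2l// lerXn2r ?nnegrE// !normrZ mulrA -normrM.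
  have st : 0 <= s * t <= 1.
    by case/andP: s0 => s0 s1; rewrite mulr_ge0//= mulr_ile1.
  case/andP: st => st0 st1.
  rewrite ger0_norm// -[leRHS]mul1r ler_pM//; exact: bK.
rewrite ler_wpM2l//; last by rewrite normrZ ger0_norm// ler_wpM2l// bK.
by rewrite !mulr_ge0 ?expR_ge0 ?gauss_ge0.
Qed.

(** For each [x] the map is a translation in [v], so a measurable [b] already gives a measure
    preserving shear. Positions do not move, so the restriction of [H] to the domain has dominated
    quotients without any cutoff. *)
Lemma velocity_flow :
  let L z := \sum_(i < d) b z.1 0 i * DH (inr i) z in
  lam2.-integrable setT (EFin \o (L \_ A)) /\ (\int[lam2]_z ((L \_ A) z)%:E = 0)%E.
Proof.
move=> L.
pose tau n (z : V * V) := (z.1, z.2 + n.+1%:R^-1 *: b z.1).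
have mtau n : measurable_fun setT (tau n).
  apply/measurable_fun_pair; first exact: measurable_fst.
  apply: measurable_addrV; first exact: measurable_snd.
  by apply: measurable_scaler_rV => //; exact: measurableT_comp mb measurable_fst.
have mp n : measure_preserving lam2 (tau n).
  apply: (@mp_shear_r _ _ _ _ R (lebesgue_rV d) (lebesgue_rV d)
    (fun x (v : V) => v + n.+1%:R^-1 *: b x)) => [|x].
    exact: mtau.
  exact: mp_translate_rV.
(* The Lipschitz constant of [H_lipschitz_r], its time step cancelled by the factor [n.+1], times
   the constant of [gauss_Omega]. *)
pose K := d%:R * (C * expR (1 / 4 * (d%:R * Kb ^+ 2))) * Kb * expR (1 / 16 * B).
have K0 : 0 <= K by rewrite !mulr_ge0 ?expR_ge0.
have a0 : (0 : R) < 1 / 32 by rewrite divr_gt0.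
apply: (integral_flow_derivative mp integrable_H (@integrable_gauss_prod R d d _ _ a0 K0)).
- move=> n [x v] /=; have [Ox|Ox] := pselect (Omega x); last first.
    by rewrite !restrict_phaseN// subrr mulr0 normr0 gauss_prod_ge0.
  rewrite /tau/= !restrict_phaseT// normrM ger0_norm//.
  have n01 : 0 <= (n.+1%:R^-1 : R) <= 1 by rewrite invr_ge0 ler0n/= invf_le1// ler1n.
  rewrite -ler_pdivlMl//; apply: le_trans (H_lipschitz_r _ Ox n01) _.
  rewrite mulrCA ler_wpM2l// /K.
  have := @gauss_Omega x v 0; rewrite scale0r addr0 => /(_ Ox); rewrite lexx ler01.
  move=> /(_ isT) gO; rewrite -[leRHS]mulrA.
  apply: le_trans (ler_wpM2l _ gO); last by rewrite !mulr_ge0 ?expR_ge0.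
  by rewrite le_eqVlt; apply/orP; left; apply/eqP; ring.
- move=> [x v]; have [Ox|Ox] := pselect (Omega x); last first.
    rewrite restrict_phaseN//; apply: cvg_near_cst; apply: nearW => n.
    by rewrite /tau !restrict_phaseN// subrr mulr0.
  rewrite !restrict_phaseT//.
  have Axv : A (x, v) by [].
  apply: seq_deriv_near (is_derive_cvg_seq (H_derive_r (b x) Axv)).
  by apply: nearW => n; rewrite pair_addZ scaler0 addr0 /tau/= !restrict_phaseT.
Qed.

End velocity_flow.

(** * The transport term *)

Section transport_flow.
Variables (rho : V -> R) (drho : V -> V -> R) (K : R).
Hypotheses (K_ge0 : 0 <= K) (rho_ge0 : forall x, 0 <= rho x).
Hypothesis rho_lt1 : forall x, rho x < 1 <-> Omega x.
Hypothesis rho_lip : forall x y, `|rho y - rho x| <= K * `|y - x|.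
Hypothesis rho_deriv : forall x v,
  t^-1 * (rho (x + t *: v) - rho x) @[t --> (0 : R)^'+] --> drho x v.

(** Truncation keeps the values in [[0, 1]], where powers are Lipschitz, and makes the cutoff vanish
    outside [Omega]. *)
Let trho x : R := Num.min (rho x) 1.

Lemma trho_itv x : 0 <= trho x <= 1.
Proof. by rewrite le_min rho_ge0 ler01/= ge_min lexx orbT. Qed.

Lemma trho_lip x y : `|trho x - trho y| <= K * `|x - y|.
Proof.
apply: le_trans (rho_lip _ _); rewrite /trho /Num.min.
by case: ltP => h1; case: ltP => h2; rewrite ler_norml; apply/andP; split;
  have := ler_norm (rho x - rho y); have := lerNnormlW (lexx `|rho x - rho y|); lra.
Qed.

(* Because of the square, the difference quotients of the cutoff along the
   transport also converge, to 0, from points of the boundary. *)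
Definition cutoff k x : R := (1 - trho x ^+ k) ^+ 2.

Lemma onem_trhoX_itv k x : 0 <= 1 - trho x ^+ k <= 1.
Proof.
have /andP[t0 t1] := trho_itv x.
by rewrite subr_ge0 exprn_ile1//= gerBl exprn_ge0.
Qed.

Lemma cutoff_itv k x : 0 <= cutoff k x <= 1.
Proof.
have /andP[t0 t1] := onem_trhoX_itv k x.
by rewrite /cutoff exprn_ge0//= exprn_ile1.
Qed.

Lemma onem_trhoX_lip k x y :
  `|(1 - trho x ^+ k) - (1 - trho y ^+ k)| <= k%:R * (K * `|x - y|).
Proof.
have -> : (1 - trho x ^+ k) - (1 - trho y ^+ k) = trho y ^+ k - trho x ^+ k.
  by ring.
rewrite distrC.
apply: le_trans (ler_dist_X _ (trho_itv _) (trho_itv _)) _.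
by rewrite ler_wpM2l// trho_lip.
Qed.

Lemma cutoff_lip k x y : `|cutoff k x - cutoff k y| <= 2 * (k%:R * (K * `|x - y|)).
Proof.
apply: le_trans (ler_dist_X _ (onem_trhoX_itv _ _) (onem_trhoX_itv _ _)) _.
by rewrite ler_wpM2l// onem_trhoX_lip.
Qed.

Lemma trho_out x : ~ Omega x -> trho x = 1.
Proof.
by move=> Ox; apply/min_idPr; rewrite leNgt; apply/negP => /rho_lt1.
Qed.

Lemma trho_in x : Omega x -> trho x = rho x.
Proof. by move=> /rho_lt1 h; apply/min_idPl/ltW. Qed.

Lemma cutoff_out k x : ~ Omega x -> cutoff k x = 0.
Proof. by move=> Ox; rewrite /cutoff trho_out// expr1n subrr expr0n. Qed.

Lemma continuous_trho : continuous trho.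
Proof.
move=> x; suff : forall e : R, 0 < e -> \forall y \near x, `|trho x - trho y| < e.
  by move=> H'; apply: (@cvgrPdist_lt R R V (nbhs x) _ trho (trho x)).2.
move=> e e0; have K1 : 0 < K + 1 by rewrite ltr_wpDl.
have c0 : 0 < e / (K + 1) by rewrite divr_gt0.
apply: filterS (nbhsx_ballx x _ c0) => y; rewrite -ball_normE/=.
rewrite ltr_pdivlMr// mulrC; apply: le_lt_trans.
by apply: le_trans (trho_lip _ _) _; rewrite ler_wpM2r// lerDl.
Qed.

Lemma measurable_cutoff k : measurable_fun setT (fun z : V * V => cutoff k z.1).
Proof.
have mt : measurable_fun setT (fun z : V * V => trho z.1).
  apply: continuous_measurable_prod; first exact: openT.
  move=> z _; apply: (@continuous_comp _ _ _ fst trho); first exact: cvg_fst.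
  exact: continuous_trho.
by apply: measurable_funX; apply: measurable_funB => //; exact: measurable_funX.
Qed.

Let F k (z : V * V) : R := cutoff k z.1 * (H \_ A) z.

Lemma measurable_F k : measurable_fun setT (F k).
Proof. by apply: measurable_funM; [exact: measurable_cutoff|exact: measurable_H]. Qed.

Lemma F_bound k x v : `|F k (x, v)| <= `|(H \_ A) (x, v)|.
Proof.
have /andP[c0 c1] := cutoff_itv k x.
by rewrite /F/= normrM ger0_norm// ler_piMl.
Qed.

Lemma integrable_F k : lam2.-integrable setT (EFin \o F k).
Proof.
apply: le_integrable integrable_H => //; first by apply/measurable_EFinP; exact: measurable_F.
by move=> [x v] _; rewrite /= lee_fin; exact: F_bound.
Qed.

Lemma H_bound_in x v : Omega x -> `|H (x, v)| <= C * gauss (1 / 4) v.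
Proof. by move=> Ox; apply: H_bound; exact: subset_closure. Qed.

(** If both points lie in [Omega], the increments of the cutoff and of [H] are estimated separately.
    If one lies outside, the cutoff vanishes there, so its increment alone accounts for the
    difference and [H] is evaluated only at the point inside. *)
Lemma F_lipschitz k x y v : `|F k (x, v) - F k (y, v)| <=
  (2 * (k%:R * K) + d%:R) * (C * gauss (1 / 4) v) * `|x - y|.
Proof.
set g := C * gauss _ v.
have g0 : 0 <= g by rewrite mulr_ge0// gauss_ge0.
have L1 u : Omega u -> `|cutoff k x - cutoff k y| * `|H (u, v)| <=
    2 * (k%:R * K) * g * `|x - y|.
  move=> Ou; have -> : 2 * (k%:R * K) * g * `|x - y| = 2 * (k%:R * (K * `|x - y|)) * g.
    by ring.
  by apply: ler_pM => //; [exact: cutoff_lip|exact: H_bound_in].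
have L2 : 0 <= d%:R * g * `|x - y| by rewrite mulr_ge0// mulr_ge0.
have L3 : 0 <= 2 * (k%:R * K) * g * `|x - y|.
  by rewrite mulr_ge0// mulr_ge0// mulr_ge0// mulr_ge0.
rewrite (_ : (_ + _) * g * _ = 2 * (k%:R * K) * g * `|x - y| +
  d%:R * g * `|x - y|); last by ring.
rewrite /F/=; have [Ox|Ox] := pselect (Omega x); last first.
  rewrite cutoff_out// mul0r sub0r normrN.
  have [Oy|Oy] := pselect (Omega y); last first.
    by rewrite cutoff_out// mul0r normr0 addr_ge0.
  rewrite restrict_phaseT// normrM; apply: ler_wpDr => //.
  by have := L1 _ Oy; rewrite (cutoff_out _ Ox) sub0r normrN.
have [Oy|Oy] := pselect (Omega y); last first.
  rewrite (cutoff_out _ Oy) mul0r subr0 restrict_phaseT// normrM.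
  apply: ler_wpDr => //; have := L1 _ Ox.
  by rewrite (cutoff_out _ Oy) subr0.
rewrite !restrict_phaseT//.
have -> : cutoff k x * H (x, v) - cutoff k y * H (y, v) =
    (cutoff k x - cutoff k y) * H (x, v) + cutoff k y * (H (x, v) - H (y, v)).
  by ring.
apply: le_trans (ler_normD _ _) _.
apply: lerD; first by rewrite normrM; exact: L1.
have /andP[c0 c1] := cutoff_itv k y.
rewrite normrM (ger0_norm c0) -[leRHS]mul1r; apply: ler_pM => //.
exact: H_lipschitz_l.
Qed.

Let X (z : V * V) : R := \sum_(i < d) z.2 0 i * DH (inl i) z.

Let dcutoff k x v : R := - (2 * (1 - rho x ^+ k) * (k%:R * rho x ^+ k.-1 * drho x v)).

(** The derivative of [F k] along [(v, 0)]. Its first term tends to the transport term as [k] grows;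
    the second is the flux through the cutoff layer. *)
Let G k : V * V -> R := (fun z => cutoff k z.1 * X z + dcutoff k z.1 z.2 * H z) \_ A.

Lemma rho_seq_deriv x v :
  seq_deriv (fun n => rho (x + n.+1%:R^-1 *: v)) (rho x) (drho x v).
Proof.
have rl := (cvg_at_rightP (fun t => t^-1 * (rho (x + t *: v) - rho x)) 0
  (drho x v)).1 (@rho_deriv x v) (fun n => n.+1%:R^-1).
rewrite /seq_deriv; under eq_fun do rewrite -[X in X * _]invrK.
by apply: rl; split=> [n|]; [rewrite invr_gt0|exact: cvg_harmonic].
Qed.

Lemma cutoff_seq_deriv k x v : Omega x ->
  seq_deriv (fun n => cutoff k (x + n.+1%:R^-1 *: v)) (cutoff k x) (dcutoff k x v).
Proof.
move=> Ox; have rd := @rho_seq_deriv x v.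
(* Eventually the moved point lies in [Omega], where the truncation is inactive. *)
have Od : \forall n \near \oo, rho (x + n.+1%:R^-1 *: v) < 1.
  by apply: (cvgr_lt (rho x)); [exact: seq_deriv_cvg rd|exact/rho_lt1].
apply: (@seq_deriv_near _ (fun n => (1 - rho (x + n.+1%:R^-1 *: v) ^+ k) ^+ 2)).
  by near=> n; rewrite /cutoff trho_in//; apply/rho_lt1; near: n.
have := seq_derivX (k := 2) (seq_derivB (seq_deriv_cst 1) (seq_derivX (k := k) rd)).
by rewrite /= expr1 sub0r mulrN /cutoff trho_in.
Unshelve. all: end_near. Qed.

Lemma transport_flow k :
  lam2.-integrable setT (EFin \o G k) /\ (\int[lam2]_z (G k z)%:E = 0)%E.
Proof.
pose tau n (z : V * V) := (z.1 + n.+1%:R^-1 *: z.2, z.2).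
have mtau n : measurable_fun setT (tau n).
  apply/measurable_fun_pair; last exact: measurable_snd.
  apply: measurable_addrV; first exact: measurable_fst.
  by apply: measurable_scaler_rV => //; exact: measurable_snd.
have mp n : measure_preserving lam2 (tau n).
  apply: (@mp_shear_l _ _ _ _ R (lebesgue_rV d) (lebesgue_rV d)
    (fun v (x : V) => x + n.+1%:R^-1 *: v)) => [|v].
    exact: mtau.
  exact: mp_translate_rV.
(* The constant of [F_lipschitz]. The displacement contributes a factor [|v|], whose absorption
   gives the 8 in [K']. *)
pose M := (2 * (k%:R * K) + d%:R) * C.
have M0 : 0 <= M by rewrite mulr_ge0// addr_ge0// !mulr_ge0.
pose K' := M * 8 * expR (1 / 16 * B).
have K'0 : 0 <= K' by rewrite mulr_ge0 ?expR_ge0// mulr_ge0.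
have a0 : (0 : R) < 1 / 32 by rewrite divr_gt0.
apply: (integral_flow_derivative mp (integrable_F k)
  (@integrable_gauss_prod R d d _ _ a0 K'0)).
- move=> n [x v] /=.
  have n0 : 0 <= (n.+1%:R^-1 : R) by rewrite invr_ge0.
  have n01 : 0 <= (n.+1%:R^-1 : R) <= 1 by rewrite n0/= invf_le1// ler1n.
  (* A nonzero increment means that the starting point or the moved point lies in [Omega]; either
     case yields decay in [x]. *)
  suff gO : F k (tau n (x, v)) - F k (x, v) != 0 ->
      gauss (1 / 8) v <= expR (1 / 16 * B) * (gauss (1 / 32) x * gauss (1 / 32) v).
    have [->|/gO{}gO] := eqVneq (F k (tau n (x, v)) - F k (x, v)) 0.
      by rewrite mulr0 normr0 gauss_prod_ge0.
    rewrite normrM ger0_norm// /tau/=.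
    apply: le_trans (ler_wpM2l _ (F_lipschitz _ _ _ _)) _ => //.
    rewrite addrAC subrr add0r normrZ ger0_norm//.
    have -> : n.+1%:R * ((2 * (k%:R * K) + d%:R) * (C * gauss (1 / 4) v) *
        (n.+1%:R^-1 * `|v|)) =
        M * (`|v| * gauss (1 / 4) v).
      have N0 : (n.+1%:R : R) != 0 by rewrite pnatr_eq0.
      by rewrite /M; move: (n.+1%:R : R) N0 => N N0; field.
    rewrite /K' -2![leRHS]mulrA ler_wpM2l//.
    apply: le_trans (ler_wpM2r (gauss_ge0 _ _) (ler_norm_enorm v)) _.
    by apply: le_trans (enorm_gauss v) _; rewrite ler_wpM2l.
  move=> FF; have [Ox|Ox] := pselect (Omega x).
    by apply: (@gauss_Omega _ _ 0); rewrite ?scale0r ?addr0 ?lexx ?ler01.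
  apply: (@gauss_Omega _ _ n.+1%:R^-1) => //.
  apply: contrapT => Ot; move: FF.
  by rewrite /F/= !cutoff_out// !mul0r subrr eqxx.
- move=> [x v]; have [Ox|Ox] := pselect (Omega x).
    have Axv : A (x, v) by [].
    rewrite /G restrict_phaseT//= addrC.
    rewrite {2}/F/= restrict_phaseT//.
    apply: (@seq_deriv_near _ (fun n => cutoff k (x + n.+1%:R^-1 *: v) *
        H ((x, v) + n.+1%:R^-1 *: (v, 0)))).
      have Od : \forall n \near \oo, rho (x + n.+1%:R^-1 *: v) < 1.
        by apply: (cvgr_lt (rho x)); [exact: seq_deriv_cvg (@rho_seq_deriv x v)|exact/rho_lt1].
      near=> n; rewrite pair_addZ scaler0 addr0 /F/= restrict_phaseT//.
      by apply/rho_lt1; near: n.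
    apply: seq_derivM; first exact: cutoff_seq_deriv.
    exact: (is_derive_cvg_seq (H_derive_l v Axv)).
  rewrite /G restrict_phaseN//; apply: norm_cvg0.
  have -> : F k (x, v) = 0 by rewrite /F/= cutoff_out// mul0r.
  (* Starting outside [Omega], the base of the square is at most a multiple of the time step, so the
     quotient is at most [c] times the time step. *)
  pose c := (k%:R * (K * `|v|)) ^+ 2 * (C * gauss (1 / 4) v).
  apply: (@squeeze_cvgr _ _ _ _ (fun=> 0) (fun n => n.+1%:R^-1 * c)).
  + near=> n; rewrite normr_ge0/= subr0 normrM ger0_norm//.
    have [Ot|Ot] := pselect (Omega (x + n.+1%:R^-1 *: v)); last first.
      rewrite /F/= cutoff_out// mul0r normr0 mulr0.
      by rewrite mulr_ge0 ?invr_ge0// mulr_ge0 ?exprn_ge0 ?mulr_ge0// ?gauss_ge0.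
    rewrite /F/= restrict_phaseT// normrM.
    have := onem_trhoX_lip k (x + n.+1%:R^-1 *: v) x.
    rewrite (trho_out Ox) expr1n subrr subr0 addrAC subrr add0r normrZ ger0_norm ?invr_ge0//.
    move=> Hc; have Hc2 : `|cutoff k (x + n.+1%:R^-1 *: v)| <=
        n.+1%:R^-1 ^+ 2 * (k%:R * (K * `|v|)) ^+ 2.
      rewrite /cutoff normrX -exprMn lerXn2r ?nnegrE ?mulr_ge0 ?invr_ge0//.
      by move: Hc; rewrite (mulrCA K) (mulrCA k%:R).
    apply: le_trans (ler_wpM2l _ (ler_pM _ _ Hc2 (H_bound_in _ Ot))) _ => //.
    rewrite le_eqVlt; apply/orP; left; apply/eqP; rewrite /c.
    have N0 : (n.+1%:R : R) != 0 by rewrite pnatr_eq0.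
    by move: (n.+1%:R : R) N0 => N N0; field.
  + exact: cvg_cst.
  + rewrite -[X in _ --> X](mul0r c); apply: cvgMl; exact: cvg_harmonic.
Unshelve. all: end_near. Qed.

Lemma drho_bound x v : `|drho x v| <= K * `|v|.
Proof.
have h : `|n.+1%:R * (rho (x + n.+1%:R^-1 *: v) - rho x)| @[n --> \oo] --> `|drho x v|.
  by apply: cvg_norm; exact: rho_seq_deriv.
apply: (cvgr_to_le h).
apply: nearW => n; rewrite normrM ger0_norm// -ler_pdivlMl//.
apply: le_trans (rho_lip _ _) _; rewrite addrAC subrr add0r normrZ ger0_norm ?invr_ge0//.
by rewrite mulrCA.
Qed.

(** [drho] is only known as a limit of difference quotients, which are measurable since [rho] is
    continuous. *)
Lemma measurable_drho x : measurable_fun setT (drho x).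
Proof.
have mr : measurable_fun setT rho.
  apply: (continuous_measurable_rV openT) => y _.
  suff : forall e : R, 0 < e -> \forall z \near y, `|rho y - rho z| < e.
    by move=> H'; apply: (@cvgrPdist_lt R R V (nbhs y) _ rho (rho y)).2.
  move=> e e0; have K1 : 0 < K + 1 by rewrite ltr_wpDl.
  have c0 : 0 < e / (K + 1) by rewrite divr_gt0.
  apply: filterS (nbhsx_ballx y _ c0) => z; rewrite -ball_normE/=.
  rewrite ltr_pdivlMr// mulrC; apply: le_lt_trans.
  by apply: le_trans (rho_lip _ _) _; rewrite ler_wpM2r// lerDl.
pose h (n : nat) (v : V) : R := n.+1%:R * (rho (x + n.+1%:R^-1 *: v) - rho x).
apply: (measurable_fun_cvg (h := h)) => //.
  move=> n; apply: measurable_funM => //; apply: measurable_funB => //.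
  apply: (measurableT_comp mr); apply: measurable_addrV => //.
  exact: measurable_scaler_rV.
by move=> v _; exact: (@rho_seq_deriv x v).
Qed.

Lemma measurable_H_slice y : closure Omega y -> measurable_fun setT (fun v => H (y, v)).
Proof.
move=> cy; apply: (continuous_measurable_rV openT) => v _.
have cA : closure A (y, v) by exact: closure_phase_domain.
have /subspace_continuousP /(_ _ cA) cH := H_continuous.
move=> W /cH [[W1 W2] /= [W1y W2v] W12].
apply: filterS W2v => w W2w; apply: (W12 (y, w)).
  by split=> //; exact: nbhs_singleton.
exact: closure_phase_domain.
Qed.

Lemma X_restrictE : X \_ A = fun z => \sum_(i < d) z.2 0 i * (DH (inl i) \_ A) z.
Proof.
apply/funext => -[x v]; have [Ox|Ox] := pselect (Omega x).
  by rewrite restrict_phaseT//; apply: eq_bigr => i _; rewrite restrict_phaseT.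
by rewrite restrict_phaseN// big1// => i _; rewrite restrict_phaseN// mulr0.
Qed.

Lemma measurable_X : measurable_fun setT (X \_ A).
Proof.
rewrite X_restrictE; apply: measurable_sum => i; apply: measurable_funM.
  by apply: measurable_coord; exact: measurable_snd.
by apply: measurable_phase => z; exact: DH_continuous.
Qed.

Let KX := d%:R * C * 8 * expR (1 / 16 * B).

Lemma KX_ge0 : 0 <= KX.
Proof. by rewrite mulr_ge0 ?expR_ge0// mulr_ge0// mulr_ge0. Qed.

Lemma X_bound z : `|(X \_ A) z| <= KX * (gauss (1 / 32) z.1 * gauss (1 / 32) z.2).
Proof.
case: z => x v; have [Ox|Ox] := pselect (Omega x); last first.
  by rewrite restrict_phaseN// normr0 gauss_prod_ge0// KX_ge0.
rewrite restrict_phaseT//.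
apply: le_trans (sum_coord_bound (M := C * gauss (1 / 4) v) _ _) _.
  by move=> i; exact: DH_bound.
have dC0 : 0 <= d%:R * C by rewrite mulr_ge0.
have -> : d%:R * (C * gauss (1 / 4) v) * `|v| = d%:R * C * (`|v| * gauss (1 / 4) v) by ring.
rewrite /KX -2![leRHS]mulrA ler_wpM2l//.
apply: le_trans (ler_wpM2r (gauss_ge0 _ _) (ler_norm_enorm v)) _.
apply: le_trans (enorm_gauss v) _; rewrite ler_wpM2l//.
by apply: (@gauss_Omega _ _ 0); rewrite ?scale0r ?addr0 ?lexx ?ler01.
Qed.

Lemma integrable_X : lam2.-integrable setT (EFin \o (X \_ A)).
Proof. exact: integrable_gauss_bound measurable_X KX_ge0 X_bound. Qed.

(** The form in which the specular condition enters: near [x] there is a point [y] where the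
    velocity flux through the level sets of [rho] cancels. The case [rho x = 0] is the center of the
    gauge, which has no radial projection. *)
Hypothesis flux0 : forall x, Omega x -> rho x = 0 \/
  exists y, [/\ closure Omega y, `|y - x| <= K * (1 - rho x) &
    (\int[lebesgue_rV d]_v (drho x v * H (y, v))%:E = 0)%E].

Let cutoff_flux k : V * V -> R := (fun z => dcutoff k z.1 z.2 * H z) \_ A.

Lemma cutoff_fluxE k z : cutoff_flux k z = G k z - cutoff k z.1 * (X \_ A) z.
Proof.
case: z => x v; rewrite /cutoff_flux /G; have [Ox|Ox] := pselect (Omega x).
  by rewrite !restrict_phaseT//=; ring.
by rewrite !restrict_phaseN// mulr0 subr0.
Qed.

Lemma integrable_cutoff_X k :
  lam2.-integrable setT (fun z => (cutoff k z.1 * (X \_ A) z)%:E).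
Proof.
apply: le_integrable integrable_X => //.
  apply/measurable_EFinP; apply: measurable_funM; first exact: measurable_cutoff.
  exact: measurable_X.
move=> z _; rewrite /= lee_fin normrM.
have /andP[c0 c1] := cutoff_itv k z.1.
by rewrite ger0_norm// ler_piMl.
Qed.

Lemma integrable_cutoff_flux k : lam2.-integrable setT (EFin \o cutoff_flux k).
Proof.
have [iG _] := transport_flow k.
have -> : EFin \o cutoff_flux k = (fun z => ((EFin \o G k) z - (cutoff k z.1 * (X \_ A) z)%:E)%E).
  by apply/funext => z; rewrite /= cutoff_fluxE.
by apply: integrableB => //; exact: integrable_cutoff_X.
Qed.

Lemma integral_cutoff_flux k : (\int[lam2]_z (cutoff_flux k z)%:E =
  - \int[lam2]_z (cutoff k z.1 * (X \_ A) z)%:E)%E.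
Proof.
have [iG G0] := transport_flow k.
under eq_integral do rewrite cutoff_fluxE EFinB.
by rewrite integralB// ?G0 ?sub0e//; exact: integrable_cutoff_X.
Qed.

Lemma norm_gauss_integrable (M : R) (f : V -> R) : measurable_fun setT f ->
  (forall v, `|f v| <= M * (`|v| * gauss (1 / 4) v)) ->
  (lebesgue_rV d).-integrable setT (EFin \o f).
Proof.
move=> mf fM; have a0 : (0 : R) < 1 / 8 by rewrite divr_gt0.
have i8 := integrableZl measurableT (`|M| * 8) (integrable_gauss d a0).
apply: le_integrable i8 => //; first exact/measurable_EFinP.
move=> v _; rewrite /= lee_fin; apply: le_trans (fM v) _.
rewrite [leRHS]ger0_norm ?mulr_ge0 ?gauss_ge0// -[leRHS]mulrA.
apply: (@le_trans _ _ (`|M| * (`|v| * gauss (1 / 4) v))).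
  by rewrite ler_wpM2r ?ler_norm// mulr_ge0// gauss_ge0.
rewrite ler_wpM2l//.
apply: le_trans (ler_wpM2r (gauss_ge0 _ _) (ler_norm_enorm v)) _.
exact: enorm_gauss.
Qed.

Lemma flux_bound k x : Omega x ->
  (`|\int[lebesgue_rV d]_v (cutoff_flux k.+2 (x, v))%:E| <=
   (2 * (k.+2%:R * rho x ^+ k.+1) * (1 - rho x) * (K * d%:R * C * K) * 8)%:E *
     \int[lebesgue_rV d]_v (gauss (1 / 8) v)%:E)%E.
Proof.
move=> Ox.
have rx1 : rho x <= 1 by exact/ltW/rho_lt1.
have onem0 : 0 <= 1 - rho x by rewrite subr_ge0.
have rX : 0 <= 1 - rho x ^+ k.+2 <= 1.
  by rewrite subr_ge0 exprn_ile1//= gerBl exprn_ge0.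
pose ck := - (2 * (1 - rho x ^+ k.+2) * (k.+2%:R * rho x ^+ k.+1)).
have ckE v : dcutoff k.+2 x v = ck * drho x v by rewrite /dcutoff /ck/=; ring.
have ck_le : `|ck| <= 2 * (k.+2%:R * rho x ^+ k.+1).
  rewrite normrN normrM [X in X * _]ger0_norm; last by rewrite mulr_ge0//; case/andP: rX.
  rewrite [X in _ * X]ger0_norm ?mulr_ge0 ?exprn_ge0// ler_wpM2r ?mulr_ge0 ?exprn_ge0//.
  by rewrite ler_piMr//; case/andP: rX.
have RHS0 : (0 <= (2 * (k.+2%:R * rho x ^+ k.+1) * (1 - rho x) * (K * d%:R * C * K) * 8)%:E *
     \int[lebesgue_rV d]_v (gauss (1 / 8) v)%:E)%E.
  apply: mule_ge0; last by apply: integral_ge0 => v _; rewrite lee_fin gauss_ge0.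
  rewrite lee_fin mulr_ge0// mulr_ge0 ?mulr_ge0 ?exprn_ge0//.
have [rx0|[y [cy yx yint]]] := flux0 Ox.
  (* At the center the slope of the cutoff vanishes because the exponent [k.+2] leaves a positive
     power of [rho x]. *)
  rewrite integral0_eq ?abse0// => v _; rewrite /cutoff_flux restrict_phaseT//= ckE.
  by rewrite /ck rx0 [0 ^+ k.+1]expr0n !(mulr0, mul0r) oppr0 !mul0r.
(* One factor [K] bounds [drho], the other, with [1 - rho x], the distance from [x] to [y];
   [d%:R * C] comes from the Lipschitz estimate of [H], and 8 from absorbing [|v|]. *)
pose cst1 := 2 * (k.+2%:R * rho x ^+ k.+1) * (1 - rho x) * (K * d%:R * C * K) * 8.
have cst1_ge0 : 0 <= cst1.
  rewrite /cst1 mulr_ge0// mulr_ge0 ?mulr_ge0 ?exprn_ge0//.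
have md := measurable_drho x.
have mHx : measurable_fun setT (fun v => H (x, v)).
  by apply: measurable_H_slice; exact: subset_closure.
have mHy := measurable_H_slice cy.
pose g v := ck * (drho x v * (H (x, v) - H (y, v))).
have mg : measurable_fun setT g.
  apply: measurable_funM => //; apply: measurable_funM => //.
  exact: measurable_funB.
have g_le v : `|g v| <= cst1 * gauss (1 / 8) v.
  have L := H_lipschitz_boundary v Ox cy.
  have xy : `|x - y| <= K * (1 - rho x) by rewrite distrC.
  have dg0 : 0 <= d%:R * (C * gauss (1 / 4) v) by rewrite !mulr_ge0// gauss_ge0.
  have L2 := le_trans L (ler_wpM2l dg0 xy).
  rewrite /g normrM normrM.
  apply: le_trans (ler_pM _ _ ck_le (ler_pM _ _ (drho_bound x v) L2)) _ => //.
  have -> : 2 * (k.+2%:R * rho x ^+ k.+1) *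
     (K * `|v| * (d%:R * (C * gauss (1 / 4) v) * (K * (1 - rho x)))) =
     2 * (k.+2%:R * rho x ^+ k.+1) * (1 - rho x) * (K * d%:R * C * K) *
       (`|v| * gauss (1 / 4) v) by ring.
  rewrite /cst1 -[leRHS]mulrA ler_wpM2l//.
    by rewrite mulr_ge0// mulr_ge0 ?mulr_ge0 ?exprn_ge0//.
  apply: le_trans (ler_wpM2r (gauss_ge0 _ _) (ler_norm_enorm v)) _.
  exact: enorm_gauss.
have a0 : (0 : R) < 1 / 8 by rewrite divr_gt0.
have ig : (lebesgue_rV d).-integrable setT (EFin \o g).
  apply: le_integrable (integrableZl measurableT cst1 (integrable_gauss d a0)) => //.
    exact/measurable_EFinP.
  move=> v _; rewrite /= lee_fin [leRHS]ger0_norm ?g_le//.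
  by rewrite mulr_ge0// gauss_ge0.
have iy : (lebesgue_rV d).-integrable setT (fun v => (drho x v * H (y, v))%:E).
  apply: (@norm_gauss_integrable (K * C) (fun v => drho x v * H (y, v))).
    exact: measurable_funM.
  move=> v; rewrite normrM.
  have -> : K * C * (`|v| * gauss (1 / 4) v) = K * `|v| * (C * gauss (1 / 4) v) by ring.
  by apply: ler_pM => //; [exact: drho_bound|exact: H_bound].
have -> : (\int[lebesgue_rV d]_v (cutoff_flux k.+2 (x, v))%:E = \int[lebesgue_rV d]_v (g v)%:E)%E.
  transitivity (\int[lebesgue_rV d]_v ((g v)%:E + ck%:E * (drho x v * H (y, v))%:E))%E.
    apply: eq_integral => v _; rewrite -EFinM -EFinD; congr EFin.
    by rewrite /cutoff_flux restrict_phaseT//= ckE /g; ring.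
  rewrite integralD//; last exact: integrableZl.
  by rewrite integralZl// yint mule0 adde0.
apply: le_trans (le_abse_integral _ _ _) _ => //; first exact/measurable_EFinP.
rewrite -ge0_integralZl//; first last.
- by move=> v _; rewrite lee_fin gauss_ge0.
- exact/measurable_EFinP/measurable_gauss.
apply: ge0_le_integral => //.
- by apply/measurable_EFinP; apply: measurableT_comp.
- by apply/measurable_EFinP; apply: measurable_funM => //; exact: measurable_gauss.
- by move=> v _; rewrite -EFinM lee_fin; exact: g_le.
Qed.

Lemma cutoff_cvg x : Omega x -> cutoff k.+2 x @[k --> \oo] --> (1 : R).
Proof.
move=> Ox; rewrite /cutoff trho_in//.
have rX : rho x ^+ k.+2 @[k --> \oo] --> (0 : R).
  have : rho x ^+ k @[k --> \oo] --> (0 : R).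
    by apply: cvg_expr; rewrite ger0_norm//; exact/rho_lt1.
  by move=> /(cvg_comp (addn 2) _ (cvg_addnl 2)).
have h : 1 - rho x ^+ k.+2 @[k --> \oo] --> (1 : R).
  by rewrite -[X in _ --> X]subr0; apply: cvgB => //; exact: cvg_cst.
by rewrite -[X in _ --> X]mulr1; under eq_fun do rewrite expr2; exact: cvgM.
Qed.

Lemma cvg_integral_cutoff_X :
  (\int[lam2]_z (cutoff k.+2 z.1 * (X \_ A) z)%:E @[k --> \oo] -->
   \int[lam2]_z ((X \_ A) z)%:E)%E.
Proof.
have [|||||_ _ h] := @dominated_convergence _ _ _ lam2 setT measurableT
  (fun k z => (cutoff k.+2 z.1 * (X \_ A) z)%:E) (EFin \o (X \_ A))
  (fun z => `|(X \_ A) z|%:E).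
- move=> k; exact: measurable_int (integrable_cutoff_X k.+2).
- exact: measurable_int integrable_X.
- apply: aeW => -[x v] _; apply: cvg_EFin; first exact: nearW.
  have [Ox|Ox] := pselect (Omega x); last first.
    by rewrite /= !restrict_phaseN//; under eq_fun do rewrite mulr0; exact: cvg_cst.
  rewrite /= -[X in _ --> X]mul1r; apply: cvgMl; exact: cutoff_cvg.
- exact: integrable_abse integrable_X.
- apply: aeW => z k _; rewrite /= lee_fin normrM.
  have /andP[c0 c1] := cutoff_itv k.+2 z.1.
  by rewrite ger0_norm// ler_piMl.
- exact: h.
Qed.

Lemma cvg_integral_flux :
  (\int[lebesgue_rV d]_x \int[lebesgue_rV d]_v (cutoff_flux k.+2 (x, v))%:E
    @[k --> \oo] --> 0)%E.
Proof.
have a80 : (0 : R) < 1 / 8 by rewrite divr_gt0.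
have a0 : (0 : R) < 1 / 32 by rewrite divr_gt0.
have [c c0 cE] := @integral_gauss R d _ a80.
pose K' := K * d%:R * C * K.
have K'0 : 0 <= K' by rewrite !mulr_ge0.
pose J k x := (\int[lebesgue_rV d]_v (cutoff_flux k.+2 (x, v))%:E)%E.
have J_out k x : ~ Omega x -> J k x = 0%E.
  by move=> Ox; apply: integral0_eq => v _; rewrite /cutoff_flux restrict_phaseN.
have J_in k x : Omega x ->
    (`|J k x| <= (2 * (k.+2%:R * rho x ^+ k.+1) * (1 - rho x) * K' * 8 * c)%:E)%E.
  by move=> Ox; apply: le_trans (flux_bound k Ox) _; rewrite cE -EFinM.
(* On [Omega] the product [expR (1 / 32 * B) * gauss (1 / 32) x] is at least 1, so it replaces the
   indicator of [Omega] as an integrable majorant. *)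
pose D (x : V) := (2 * K' * 8 * c * expR (1 / 32 * B)) * gauss (1 / 32) x.
have D0 : 0 <= 2 * K' * 8 * c by rewrite !mulr_ge0// ltW.
have iD : (lebesgue_rV d).-integrable setT (EFin \o D).
  exact: integrableZl (integrable_gauss d a0).
have JD k x : (`|J k x| <= (D x)%:E)%E.
  have [Ox|Ox] := pselect (Omega x); last first.
    by rewrite J_out// abse0 lee_fin mulr_ge0 ?gauss_ge0// mulr_ge0 ?expR_ge0.
  apply: le_trans (J_in k x Ox) _; rewrite lee_fin /D.
  have r1 : k.+2%:R * rho x ^+ k.+1 * (1 - rho x) <= 1.
    by apply: ler_kX_onem; rewrite rho_ge0 ltW//; exact/rho_lt1.
  have -> : 2 * (k.+2%:R * rho x ^+ k.+1) * (1 - rho x) * K' * 8 * c =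
      2 * K' * 8 * c * (k.+2%:R * rho x ^+ k.+1 * (1 - rho x)) by ring.
  rewrite -[leRHS]mulrA ler_wpM2l//; apply: le_trans r1 _.
  rewrite /gauss -expRD -[leLHS]expR0 ler_expR.
  by have := Omega_B Ox; lra.
have J0 x : (J k x @[k --> \oo] --> 0)%E.
  have [Ox|Ox] := pselect (Omega x); last first.
    by under eq_fun do rewrite J_out//; exact: cvg_cst.
  have u0 : (2 * (k.+2%:R * rho x ^+ k.+1) * (1 - rho x) * K' * 8 * c
      @[k --> \oo] --> (0 : R)).
    have -> : (fun k => 2 * (k.+2%:R * rho x ^+ k.+1) * (1 - rho x) * K' * 8 * c) =
        (fun k => (2 * (1 - rho x) * K' * 8 * c) * (k.+2%:R * rho x ^+ k.+1)).
      by apply/funext => k; ring.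
    rewrite -[X in _ --> X](mulr0 (2 * (1 - rho x) * K' * 8 * c)); apply: cvgMr.
    have rx : 0 <= rho x < 1 by rewrite rho_ge0; exact/rho_lt1.
    by have := cvg_kX rx; rewrite -(cvg_shiftS (fun k => k.+1%:R * rho x ^+ k)).
  apply/cvg_abse0P.
  have up : ((2 * (k.+2%:R * rho x ^+ k.+1) * (1 - rho x) * K' * 8 * c)%:E
      @[k --> \oo] --> 0)%E by apply: cvg_EFin => //; exact: nearW.
  apply: (squeeze_cvge _ (cvg_cst 0%E) up).
  by apply: nearW => k; rewrite abse_ge0/= J_in.
have mJ k : measurable_fun setT (J k).
  exact: (measurable_fubini_F (integrable_cutoff_flux k.+2)).
have [|||||_ _ h] := @dominated_convergence _ _ _ (lebesgue_rV d) setT measurableT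
  J (cst 0%E) (EFin \o D).
- exact: mJ.
- exact: measurable_cst.
- by apply: aeW => x _; exact: J0.
- exact: iD.
- by apply: aeW => x k _; exact: JD.
- by move: h; rewrite integral_cst// mul0e.
Qed.

Lemma transport_integral :
  lam2.-integrable setT (EFin \o (X \_ A)) /\ (\int[lam2]_z ((X \_ A) z)%:E = 0)%E.
Proof.
split; first exact: integrable_X.
apply: cvg_unique cvg_integral_cutoff_X _ => //.
have -> : (fun k => (\int[lam2]_z (cutoff k.+2 z.1 * (X \_ A) z)%:E)%E) =
    (fun k => (- \int[lebesgue_rV d]_x \int[lebesgue_rV d]_v (cutoff_flux k.+2 (x, v))%:E)%E).
  apply/funext => k.
  by rewrite [in RHS](integral12_prod_meas1 (integrable_cutoff_flux k.+2)) integral_cutoff_flux oppeK.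
by have := cvgeN cvg_integral_flux; rewrite oppe0; exact.
Qed.

End transport_flow.

End phase_function.

(** * Specular reflection *)

Section specular_flux.
Context {R : realType} {d : nat}.
Local Notation V := 'rV[R]_d.

Lemma dotv_le_sup (u v : V) : `|dotv u v| <= d%:R * `|u| * `|v|.
Proof.
by rewrite dotvC; apply: (@sum_coord_bound R d v (fun i => u 0 i)) => i; exact: ler_coord_norm.
Qed.

Section reflection.
Variables (n : V) (n1 : dotv n n = 1).
Let T (v : V) : V := v - (2 * dotv v n) *: n.

Lemma dotv_reflect_normal v : dotv n (T v) = - dotv n v.
Proof. by rewrite /T dotvDr dotvNr dotvZr n1 (dotvC v n); ring. Qed.

Lemma dotv_reflect v : dotv (T v) (T v) = dotv v v.
Proof.
rewrite /T !(dotvDl, dotvDr, dotvNl, dotvNr, dotvZl, dotvZr) n1 (dotvC n v).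
by ring.
Qed.

Lemma mp_reflect : measure_preserving (lebesgue_rV d) T.
Proof.
apply: mp_isometry => [|x y|x|x]; last exact: dotv_reflect.
- apply: measurable_addrV => //; apply: measurable_oppr_rV.
  apply: measurable_scaler_rV => //; apply: measurable_funM => //.
  exact: measurable_dotv.
- by rewrite /T dotvDl; apply/rowP => i; rewrite !mxE; ring.
- rewrite {1}/T (dotvC (T x)) dotv_reflect_normal /T (dotvC n).
  by apply/rowP => i; rewrite !mxE; ring.
Qed.

Lemma flux_zero (h : V -> R) (C a : R) : measurable_fun setT h -> 0 <= C ->
  (forall v, `|h v| <= C * gauss (1 / 4) v) -> (forall v, h v = h (T v)) ->
  (\int[lebesgue_rV d]_v (a * dotv n v * h v)%:E = 0)%E.
Proof.
move=> mh C0 hC hT; pose F v := a * dotv n v * h v.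
have mF : measurable_fun setT F.
  by apply: measurable_funM => //; apply: measurable_funM => //; exact: measurable_dotv.
have iF : (lebesgue_rV d).-integrable setT (EFin \o F).
  apply: (@norm_gauss_integrable _ _ (`|a| * (d%:R * `|n|) * C)) => // v.
  have -> : `|a| * (d%:R * `|n|) * C * (`|v| * gauss (1 / 4) v) =
    (`|a| * (d%:R * `|n| * `|v|)) * (C * gauss (1 / 4) v) by ring.
  rewrite /F !normrM ler_pM// ?mulr_ge0// ler_wpM2l//.
  exact: dotv_le_sup.
have := integral_mp mp_reflect iF.
have -> : (\int[lebesgue_rV d]_v (EFin \o F) (T v) = - \int[lebesgue_rV d]_v (F v)%:E)%E.
  rewrite -[RHS]mulN1e -EFinN -(integralZl measurableT iF).
  apply: eq_integral => v _.
  by rewrite /= -EFinM /F dotv_reflect_normal -hT; congr EFin; ring.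
have := integrable_fin_num measurableT iF.
rewrite /comp; case: (integral _ _ _) => [r| |]//= _ [] h0.
by congr EFin; lra.
Qed.

End reflection.

Lemma bounded_dotv (Omega : set V) : bounded_set Omega ->
  exists2 B, 0 <= B & forall x, Omega x -> dotv x x <= B.
Proof.
move=> [M [_ bM]]; exists (d%:R * (`|M| + 1) ^+ 2).
  by rewrite mulr_ge0// exprn_ge0// addr_ge0.
move=> x Ox; apply: le_trans (dotv_le_norm _) _.
rewrite ler_wpM2l// lerXn2r ?nnegrE ?addr_ge0//.
by apply: (bM _ _ x Ox); rewrite (le_lt_trans (ler_norm M))// ltrDl.
Qed.

(** The hypothesis [flux0] holds with [y] the radial projection: there [drho x] is a multiple of the
    normal functional, which reflection makes odd. *)
Lemma specular_transport (Omega : set V) (C : R) (H : V * V -> R)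
    (DH : 'I_d + 'I_d -> V * V -> R) :
  Omega !=set0 -> open Omega -> bounded_set Omega ->
  convex_set (Omega : set (convex_lmodType V)) -> C21_boundary Omega ->
  {within closure (phase_domain Omega), continuous H} ->
  (forall a z, phase_domain Omega z -> is_derive z (phase_basis a) H (DH a z)) ->
  (forall a z, phase_domain Omega z -> {for z, continuous (DH a)}) ->
  0 <= C ->
  (forall x v, closure Omega x -> `|H (x, v)| <= C * gauss (1 / 4) v) ->
  (forall a x v, Omega x -> `|DH a (x, v)| <= C * gauss (1 / 4) v) ->
  (forall x v, boundary Omega x -> H (x, v) = H (x, reflect_velocity Omega x v)) ->
  let X (z : V * V) := \sum_(i < d) z.2 0 i * DH (inl i) z in
  (lebesgue_rV d \x lebesgue_rV d)%E.-integrable setT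
    (EFin \o (X \_ (phase_domain Omega))) /\
  (\int[lebesgue_rV d \x lebesgue_rV d]_z ((X \_ (phase_domain Omega)) z)%:E = 0)%E.
Proof.
move=> O0 oO bO cO O21 cH dH cDH C0 HC DHC Hspec X.
have [B B0 OB] := bounded_dotv bO.
have [rho [drho [proj [K [K0 rho0 rho1 rhoK [rhod rhoproj]]]]]] :=
  boundary_gauge O0 oO bO cO O21.
apply: (transport_integral oO OB _ cH dH cDH C0 HC DHC (ltW K0) rho0 rho1 rhoK rhod).
  by move=> x y a; exact: convex_set_conv.
move=> x Ox; have [?|[bp pK [a da]]] := rhoproj x Ox; [by left|right].
have cp : closure Omega (proj x) by case: bp.
have [n1 _ _] := outward_normal_spec O21 bp.
exists (proj x); split=> //.
under eq_integral do rewrite da.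
apply: (flux_zero n1 a (measurable_H_slice cH cp) C0) => v; first exact: HC.
by rewrite {1}Hspec.
Qed.

End specular_flux.

(** * The Gibbs measure and the Liouville operator *)

Section C1_phase.
Context {R : realType} {d : nat}.
Local Notation V := 'rV[R]_d.
Variable Omega : set V.
Hypotheses (Omega_open : open Omega).
Let A : set (V * V) := phase_domain Omega.
Implicit Types (f g : V * V -> R) (Df Dg : 'I_d + 'I_d -> V * V -> R) (S : set V).

(** Natural exponents make the class stable under sums and products by adding exponents; [S]
    separates bounds on the closure from bounds in the interior. *)
Definition growth S f := exists C m, 0 <= C /\
  forall x v, S x -> `|f (x, v)| <= C * (1 + enorm v) ^+ m.

Lemma growth_sub S S' f : S `<=` S' -> growth S' f -> growth S f.
Proof. by move=> SS [C [m [C0 fC]]]; exists C, m; split=> // x v /SS; exact: fC. Qed.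

Lemma ler_onem_enorm (v : V) : 1 <= 1 + enorm v.
Proof. by rewrite lerDl enorm_ge0. Qed.

Lemma growthD S f g : growth S f -> growth S g -> growth S (fun z => f z + g z).
Proof.
move=> [C [m [C0 fC]]] [C' [m' [C'0 gC]]]; exists (C + C'), (m + m')%N.
split=> [|x v Sx]; first exact: addr_ge0.
apply: le_trans (ler_normD _ _) _; rewrite mulrDl; apply: lerD.
  apply: le_trans (fC _ _ Sx) _; rewrite ler_wpM2l// ler_weXn2l ?ler_onem_enorm//.
  exact: leq_addr.
apply: le_trans (gC _ _ Sx) _; rewrite ler_wpM2l// ler_weXn2l ?ler_onem_enorm//.
exact: leq_addl.
Qed.

Lemma growthM S f g : growth S f -> growth S g -> growth S (fun z => f z * g z).
Proof.
move=> [C [m [C0 fC]]] [C' [m' [C'0 gC]]]; exists (C * C'), (m + m')%N.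
split=> [|x v Sx]; first exact: mulr_ge0.
by rewrite exprD mulrACA normrM ler_pM// ?fC ?gC.
Qed.

Lemma growth_le S f (C : R) m : (forall x v, S x -> `|f (x, v)| <= C * (1 + enorm v) ^+ m) ->
  growth S f.
Proof.
move=> fC; exists `|C|, m; split=> // x v Sx; apply: le_trans (fC _ _ Sx) _.
rewrite ler_wpM2r ?ler_norm// exprn_ge0// addr_ge0 ?enorm_ge0//.
Qed.

Lemma growth_cst S (a : R) : growth S (fun=> a).
Proof. by apply: (@growth_le _ _ `|a| 0) => x v _; rewrite mulr1. Qed.

Lemma growthN S f : growth S f -> growth S (fun z => - f z).
Proof.
move=> gf; rewrite (_ : (fun _ => _) = (fun z => -1 * f z)).
  by apply: growthM gf; exact: growth_cst.
by apply/funext => z; rewrite mulN1r.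
Qed.

Lemma growth_sum S (I : Type) (r : seq I) (F : I -> V * V -> R) :
  (forall i, growth S (F i)) -> growth S (fun z => \sum_(i <- r) F i z).
Proof.
move=> gF; elim: r => [|i r IH].
  by under eq_fun do rewrite big_nil; exact: growth_cst.
by under eq_fun do rewrite big_cons; exact: growthD.
Qed.

Lemma growth_coord S (i : 'I_d) : growth S (fun z => z.2 0 i).
Proof.
apply: (@growth_le _ _ 1 1) => x v _; rewrite mul1r expr1.
apply: le_trans (ler_coord_enorm _ _) _.
by rewrite lerDr.
Qed.

(** The first-order part of a jet, with [f] continuous up to the boundary and its derivatives
    continuous inside. Unlike a jet, it passes directly to products and exponentials. *)
Definition C1_phase f Df := [/\ {within closure A, continuous f},
  forall a z, A z -> is_derive z (phase_basis a) f (Df a z) &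
  forall a z, A z -> {for z, continuous (Df a)}].

Lemma C1_phase_continuous f Df z : C1_phase f Df -> A z -> {for z, continuous f}.
Proof. by move=> [cf _ _]; exact: H_continuous_in. Qed.

Lemma C1_phaseM f g Df Dg : C1_phase f Df -> C1_phase g Dg ->
  C1_phase (fun z => f z * g z) (fun a z => Df a z * g z + f z * Dg a z).
Proof.
move=> hf hg; have [cf df cdf] := hf; have [cg dg cdg] := hg; split.
- by move=> z; apply: cvgM; [exact: cf|exact: cg].
- move=> a z Az; have := is_deriveM (df a z Az) (dg a z Az).
  by rewrite addrC [_ *: Df a z]mulrC.
- move=> a z Az; apply: cvgD; apply: cvgM; [exact: cdf| | |exact: cdg].
    exact: C1_phase_continuous hg Az.
  exact: C1_phase_continuous hf Az.
Qed.

(** Restriction to the line through [z] along [u] reduces this to the chain rule in one variable. *)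
Lemma is_derive_comp_expR f z u (l : R) : is_derive z u f l ->
  is_derive z u (fun z => expR (f z)) (expR (f z) * l).
Proof.
move=> df.
have d0 : is_derive (0 : R) 1 (fun t : R => f (z + t *: u)) l.
  by apply: is_derive_line; rewrite scale0r addr0.
have := @is_derive1_comp _ expR (fun t : R => f (z + t *: u)) 0 _ l (is_derive_expR _) d0.
move=> /is_deriveP; rewrite /comp scale0r addr0.
under eq_fun do rewrite add0r [_ *: 1]mulr1.
by move=> h; apply/is_deriveP.
Qed.

Lemma C1_phase_expR f Df : C1_phase f Df ->
  C1_phase (fun z => expR (f z)) (fun a z => expR (f z) * Df a z).
Proof.
move=> hf; have [cf df cdf] := hf; split.
- move=> z; apply: (continuous_comp (cf z)); exact: continuous_expR.
- by move=> a z Az; apply: is_derive_comp_expR; exact: df.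
- move=> a z Az; apply: cvgM; last exact: cdf.
  apply: continuous_comp; last exact: continuous_expR.
  exact: C1_phase_continuous hf Az.
Qed.

End C1_phase.

(** * The Gibbs weight and its derivatives *)

Section gibbs_weight.
Context {R : realType} {d : nat}.
Local Notation V := 'rV[R]_d.
Variables (Omega : set V) (U : V -> R) (UU : seq 'I_d -> V -> R).
Hypotheses (Omega_open : open Omega) (Omega_bounded : bounded_set Omega).
Hypothesis jU : is_jet basis_rV 2 Omega U UU.
Let A : set (V * V) := phase_domain Omega.

Lemma closure_phase_fst (z : V * V) : closure A z -> closure Omega z.1.
Proof.
move=> cz W Wz; have [y [[Oy _] Wy]] := cz (fst @^-1` W) (cvg_fst Wz).
by exists y.1.
Qed.

Lemma within_comp_fst (k : V -> R) : {within closure Omega, continuous k} ->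
  {within closure A, continuous (fun z => k z.1)}.
Proof.
move=> /subspace_continuousP ck; apply/subspace_continuousP => z /closure_phase_fst cz.
move=> W Wz; have := ck _ cz _ Wz.
rewrite /nbhs/= /within/= => kW.
apply: (@filterS _ (nbhs z) _ (fst @^-1` [set x | closure Omega x -> W (k x)])).
  by move=> y yW cy; apply: yW; exact: closure_phase_fst.
exact: (cvg_fst kW).
Qed.

Lemma closure_bounded (k : V -> R) : {within closure Omega, continuous k} ->
  exists2 M, 0 <= M & forall x, closure Omega x -> `|k x| <= M.
Proof.
move=> ck; have cO : compact (closure Omega).
  apply: bounded_closed_compact; last exact: closed_closure.
  have [M [Mr bM]] := Omega_bounded; exists M; split=> // x Mx.
  have clx : closed [set y : V | `|y| <= x].
    apply: (@closed_comp V R (fun y => `|y|) [set r | r <= x]); last exact: closed_le.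
    by move=> y _; exact: norm_continuous.
  have : closure Omega `<=` [set y | `|y| <= x].
    rewrite closureE; apply: smallest_sub; last by move=> y Oy; exact: bM.
    exact: clx.
  by move=> h y /h.
have [M [_ bM]] := compact_bounded (continuous_compact ck cO).
exists (`|M| + 1); first by rewrite addr_ge0.
move=> x cx; apply: (bM (`|M| + 1)); last by exists x.
by rewrite (le_lt_trans (ler_norm M))// ltrDl.
Qed.

Definition log_weight (z : V * V) : R := - (dotv z.2 z.2 / 2) - U z.1.

Definition dlog_weight (a : 'I_d + 'I_d) (z : V * V) : R :=
  if a is inl i then - UU [:: i] z.1 else if a is inr i then - z.2 0 i else 0.

Lemma cvg_coord2 (z : V * V) i : {for z, continuous (fun y : V * V => y.2 0 i)}.
Proof.
apply: (@continuous_comp _ _ _ snd (fun v : V => v 0 i)); first exact: cvg_snd.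
exact: coord_continuous.
Qed.

Lemma is_derive_kinetic (z : V * V) a : is_derive z (phase_basis a)
  (fun z => - (dotv z.2 z.2 / 2)) (if a is inr i then - z.2 0 i else 0).
Proof.
case: a => i; apply/is_deriveP.
  by under eq_fun do rewrite /= scaler0 addr0 subrr mulr0; exact: cvg_cst.
have e2 : dotv (basis_rV i : V) (basis_rV i) = 1.
  rewrite /dotv (bigD1 i)//= big1 => [|j ji]; rewrite /basis_rV !mxE ?eqxx ?mulr1 ?addr0//.
  by rewrite (negPf ji) andbF mulr0.
have ve : dotv z.2 (basis_rV i) = z.2 0 i.
  rewrite /dotv (bigD1 i)//= big1 => [|j ji]; rewrite /basis_rV !mxE ?eqxx ?mulr1 ?addr0//.
  by rewrite (negPf ji) andbF mulr0.
(* The difference quotient of the quadratic function along a basis vector, computed exactly. *)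
have : - z.2 0 i - h / 2 @[h --> (0 : R)^'] --> - z.2 0 i.
  rewrite -[X in _ --> X]subr0 -[X in _ --> _ - X](mul0r (2^-1)).
  apply: cvgB; first exact: cvg_cst.
  by apply: cvgMl; exact: cvg_within.
apply: cvg_trans; apply: near_eq_cvg; near=> h.
have h0 : h != 0 by near: h; exact: nbhs_dnbhs_neq.
rewrite /= dotvDl !dotvDr !(dotvZl, dotvZr) e2 (dotvC _ z.2) ve.
by field.
Unshelve. all: end_near. Qed.

Lemma C1_phase_log_weight : C1_phase Omega log_weight dlog_weight.
Proof.
split.
- move=> z; apply: (@cvgB _ _ _ _ _ (fun z : V * V => - (dotv z.2 z.2 / 2))); last first.
    exact: (within_comp_fst (jet_continuous0 jU)).
  apply: (@continuous_subspaceT _ _ (closure A) (fun z : V * V => - (dotv z.2 z.2 / 2))) => y.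
  apply: cvgN; apply: cvgMl; rewrite /dotv; apply: cvg_big => [|i _].
    exact: add_continuous.
  by apply: cvgM; exact: cvg_coord2.
- move=> a z [Oz _].
  have dU : is_derive z (phase_basis a) (fun z => U z.1)
      (if a is inl i then UU [:: i] z.1 else 0).
    case: a => i; apply/is_deriveP.
      by have /is_deriveP := jet_is_derive Omega_open jU i (isT : (0 < 2)%N) Oz.
    by under eq_fun do rewrite /= scaler0 addr0 subrr mulr0; exact: cvg_cst.
  have := is_deriveB (is_derive_kinetic z a) dU.
  by case: a {dU} => i; rewrite /dlog_weight ?sub0r ?subr0.
- move=> [i|i] z [Oz _].
    apply: cvgN; apply: (@continuous_comp _ _ _ fst (UU [:: i])); first exact: cvg_fst.
    by apply: (jet_continuous Omega_open jU).
  by apply: cvgN; exact: cvg_coord2.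
Qed.

Lemma growth_dlog_weight a : growth Omega (dlog_weight a).
Proof.
case: a => i; apply: growthN; last exact: growth_coord.
have [_ _ /(_ [:: i] isT) cU] := jU.
have [M _ UM] := closure_bounded cU.
apply: (@growth_le _ _ _ _ M 0) => x v Ox; rewrite mulr1; apply: UM.
exact: subset_closure.
Qed.

Lemma ler_expR_log_weight : exists2 E, 0 <= E & forall x v, closure Omega x ->
  expR (log_weight (x, v)) <= E * gauss (1 / 2) v.
Proof.
have [M M0 UM] := closure_bounded (jet_continuous0 jU).
exists (expR M); first exact: expR_ge0.
move=> x v cx; rewrite /gauss -expRD ler_expR /log_weight/=.
by have := UM x cx; rewrite ler_norml => /andP[h _]; lra.
Qed.

Lemma growth_gauss S f : S `<=` closure Omega -> growth S f -> exists2 C, 0 <= C &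
  forall x v, S x ->
  `|f (x, v) * expR (log_weight (x, v))| <= C * gauss (1 / 4) v.
Proof.
move=> SO [C [m [C0 fC]]]; have [E E0 wE] := ler_expR_log_weight.
have [C' C'0 gC] := @exprn_gauss R d m.
exists (C * E * C') => [|x v Sx]; first by rewrite !mulr_ge0.
rewrite normrM (ger0_norm (expR_ge0 _)).
apply: (@le_trans _ _ (C * (1 + enorm v) ^+ m * (E * gauss (1 / 2) v))).
  by rewrite ler_pM// ?expR_ge0 ?fC ?wE//; exact: SO.
rewrite mulrACA -!(mulrA (C * E)) ler_wpM2l// ?mulr_ge0//; exact: gC.
Qed.

End gibbs_weight.

Section signed_density.
Context d (T : measurableType d) (R : realType).
Variables (mu nu : {measure set T -> \bar R}) (D : set T) (w : T -> R).
Hypotheses (mD : measurable D) (mw : measurable_fun D w).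
Hypothesis w0 : forall x, D x -> 0 <= w x.
Hypothesis nuE : forall A, measurable A ->
  (nu A = \int[mu]_(x in A `&` D) (w x)%:E)%E.
Variables (f : T -> R) (mf : measurable_fun D f).

Lemma integral_density :
  (\int[nu]_(x in D) (f x)%:E = \int[mu]_(x in D) (f x * w x)%:E)%E.
Proof.
have mfE : measurable_fun D (EFin \o f) by exact/measurable_EFinP.
rewrite [LHS]integralE [RHS]integralE; congr (_ - _)%E.
  rewrite (ge0_integral_density mD mw w0 nuE (measurable_funepos mfE))//.
  apply: eq_integral => x; rewrite inE => Dx.
  by rewrite !funeposE -!EFin_max -EFinM maxr_pMl ?w0// mul0r.
rewrite (ge0_integral_density mD mw w0 nuE (measurable_funeneg mfE))//.
apply: eq_integral => x; rewrite inE => Dx.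
by rewrite !funenegE -!EFinN -!EFin_max -EFinM maxr_pMl ?w0// mul0r mulNr.
Qed.

Lemma integrable_density : mu.-integrable D (fun x => (f x * w x)%:E) ->
  nu.-integrable D (EFin \o f).
Proof.
move=> /integrableP[_ fin]; apply/integrableP; split; first exact/measurable_EFinP.
rewrite (ge0_integral_density mD mw w0 nuE)//.
  apply: le_lt_trans fin; rewrite le_eqVlt; apply/orP; left; apply/eqP.
  apply: eq_integral => x; rewrite inE => Dx.
  by rewrite /= -EFinM normrM (ger0_norm (w0 Dx)).
by apply: measurableT_comp => //; exact/measurable_EFinP.
Qed.

End signed_density.

(** * Integrals against the Gibbs measure *)

Section gibbs_integral.
Context {R : realType} {d : nat}.
Local Notation V := 'rV[R]_d.
Variables (Omega : set V) (U : V -> R) (UU : seq 'I_d -> V -> R).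
Hypotheses (Omega_open : open Omega) (Omega_bounded : bounded_set Omega).
Hypothesis jU : is_jet basis_rV 2 Omega U UU.
Variables (mu : probability (V * V)%type R) (c : R).
Let A : set (V * V) := phase_domain Omega.
Let lam2 := (@lebesgue_rV R d \x @lebesgue_rV R d)%E.
Let w z := expR (log_weight U z).
Hypothesis muE : forall E, measurable E ->
  (mu E = \int[lam2]_(z in E `&` A) (c * w z)%:E)%E.

Let mA : measurable A.
Proof. exact: phase_domain_measurable. Qed.

Lemma measurable_phase_in (k : V * V -> R) : (forall z, A z -> {for z, continuous k}) ->
  measurable_fun A k.
Proof. by move=> ck; apply/(measurable_restrictT _ mA); exact: measurable_phase. Qed.

Lemma continuous_gibbs_weight z : A z -> {for z, continuous w}.
Proof.
exact: C1_phase_continuous (C1_phase_expR Omega_open (C1_phase_log_weight Omega_open jU)).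
Qed.

(** A negative constant would give total mass at most 0, whereas [mu] is a probability. *)
Lemma gibbs_constant_ge0 : 0 <= c.
Proof.
rewrite leNgt; apply/negP => c0.
have : (mu setT <= 0)%E.
  rewrite muE// integralE integral0_eq; last first.
    move=> z _; rewrite funeposE; apply/max_idPr.
    by rewrite lee_fin mulr_le0_ge0 ?expR_ge0 ?ltW.
  by rewrite sub0e oppe_le0 integral_ge0.
by rewrite probability_setT lee_fin ler10.
Qed.

Section observable.
Variable k : V * V -> R.
Hypotheses (ck : forall z, A z -> {for z, continuous k}) (gk : growth Omega k).

Lemma integrable_growth : lam2.-integrable A (fun z => (k z * w z)%:E).
Proof.
have [B B0 OB] := bounded_dotv Omega_bounded.
have [C C0 kC] := growth_gauss Omega_bounded jU (@subset_closure _ Omega) gk.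
have : lam2.-integrable setT (EFin \o ((fun z => k z * w z) \_ A)).
  apply: (@integrable_gauss_bound _ _ _ (C * expR (1 / 16 * B))).
  - apply: measurable_phase => // z Az.
    by apply: cvgM; [exact: ck|exact: continuous_gibbs_weight].
  - by rewrite mulr_ge0// expR_ge0.
  move=> [x v]/=; have [Ox|Ox] := pselect (Omega x); last first.
    rewrite restrict_phaseN// normr0 gauss_prod_ge0//.
    by rewrite mulr_ge0// expR_ge0.
  rewrite restrict_phaseT//; apply: le_trans (kC _ v Ox) _.
  rewrite -[leRHS]mulrA ler_wpM2l//; apply: (@le_trans _ _ (gauss (1 / 8) v)).
    by apply: ler_gauss; lra.
  by apply: (@gauss_Omega _ _ _ _ OB _ _ 0); rewrite ?scale0r ?addr0 ?lexx ?ler01.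
by rewrite -restrict_EFin -integrable_mkcond.
Qed.

Let mw : measurable_fun A (fun z => c * w z).
Proof.
by apply: measurable_funM => //; apply: measurable_phase_in; exact: continuous_gibbs_weight.
Qed.

Let cw0 z : A z -> 0 <= c * w z.
Proof. by rewrite mulr_ge0 ?gibbs_constant_ge0 ?expR_ge0. Qed.

Lemma gibbs_integral :
  (\int[mu]_(z in A) (k z)%:E = c%:E * \int[lam2]_(z in A) (k z * w z)%:E)%E.
Proof.
rewrite (integral_density mA mw cw0 muE (measurable_phase_in ck)).
rewrite -(integralZl mA integrable_growth).
by apply: eq_integral => z _; rewrite -EFinM mulrCA.
Qed.

Lemma gibbs_integrable : mu.-integrable A (EFin \o k).
Proof.
apply: (integrable_density mA mw cw0 muE (measurable_phase_in ck)).
have := integrableZl mA c integrable_growth.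
by apply: eq_integrable => // z _; rewrite -EFinM mulrCA.
Qed.

End observable.

(** The square of [k] again has polynomial growth, hence is integrable. *)
Lemma growth_in_L2 (k : V * V -> R) : (forall z, A z -> {for z, continuous k}) ->
  growth Omega k -> in_L2 Omega mu k.
Proof.
move=> ck gk; rewrite /in_L2; apply/andP; rewrite !inE/=; split.
  exact: measurable_phase.
have ck2 z : A z -> {for z, continuous (fun z => k z * k z)}.
  by move=> Az; apply: cvgM; exact: ck.
have /integrableP[_ fin] := gibbs_integrable ck2 (growthM gk gk).
rewrite /finite_norm unlock /Lnorm; apply: poweR_lty.
apply: le_lt_trans fin; rewrite le_eqVlt; apply/orP; left; apply/eqP.
rewrite [RHS]integral_mkcond; apply: eq_integral => z _; rewrite /= /patch; case: ifPn => _.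
  by rewrite powR_mulrn// normrM expr2.
(* Outside the domain the restriction takes the default value [point], which is 0. *)
by rewrite -[point]/(0 : R) normr0 powR_mulrn// expr0n.
Qed.

End gibbs_integral.

(** * The Liouville operator *)

Section liouville.
Context {R : realType} {d : nat}.
Local Notation V := 'rV[R]_d.
Variables (Omega : set V) (U : V -> R) (UU : seq 'I_d -> V -> R).
Hypotheses (Omega_open : open Omega) (Omega_bounded : bounded_set Omega).
Hypothesis jU : is_jet basis_rV 2 Omega U UU.
Let A : set (V * V) := phase_domain Omega.
Let lam2 := (@lebesgue_rV R d \x @lebesgue_rV R d)%E.
Let w z := expR (log_weight U z).

Definition specular_C1 (f : V * V -> R) (Df : 'I_d + 'I_d -> V * V -> R) :=
  [/\ C1_phase Omega f Df, growth (closure Omega) f, forall a, growth Omega (Df a) &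
    forall x v, boundary Omega x -> f (x, v) = f (x, reflect_velocity Omega x v)].

Lemma specular_class_C1 f : specular_class Omega f -> exists Df, specular_C1 f Df.
Proof.
move=> [[F [N [jF N0 FN]]] fspec]; exists (fun a => F [:: a]).
have oA : open (phase_domain Omega) by exact: phase_domain_open.
have gF s : (size s <= 2)%N -> growth (closure Omega) (F s).
  move=> s2; have [C FC] := FN s s2.
  (* [Num.bound N] is a natural number above the real exponent, and the base [1 + enorm v] is at
     least 1. *)
  apply: (@growth_le _ _ _ _ `|C| (Num.bound N)) => x v cx.
  apply: le_trans (FC x v cx) _.
  apply: le_trans (ler_wpM2r (powR_ge0 _ _) (ler_norm C)) _; rewrite ler_wpM2l//.
  rewrite -powR_mulrn ?addr_ge0 ?enorm_ge0//.
  by rewrite ler_powR ?ler_onem_enorm// ltW// archi_boundP// ltW.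
split=> //.
- split; first exact: jet_continuous0 jF.
  + by move=> a z Az; exact: (jet_is_derive oA jF).
  + by move=> a z Az; exact: (jet_continuous oA jF).
- have [F0 _ _] := jF; have [C [m [C0 FC]]] := gF [::] isT.
  exists C, m; split=> // x v cx; rewrite -F0; first exact: FC.
  exact: closure_phase_domain.
- by move=> a; apply: growth_sub (gF [:: a] isT); exact: subset_closure.
Qed.

(** The operator expressed through the jets, whose continuity and growth are known, instead of
    through the derivation operator; both agree on the phase domain. *)
Definition liouville_of Df (z : V * V) : R :=
  \sum_(i < d) z.2 0 i * Df (inl i) z - \sum_(i < d) UU [:: i] z.1 * Df (inr i) z.

Lemma liouvilleE f Df z : C1_phase Omega f Df -> A z -> liouville U f z = liouville_of Df z.
Proof.
move=> [_ df _] Az; have [Oz _] := Az; rewrite /liouville /liouville_of.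
congr (_ - _); apply: eq_bigr => i _.
  by have [_ ->] := df (inl i) z Az.
have [_ ->] := df (inr i) z Az.
by have [_ ->] := jet_is_derive Omega_open jU i isT Oz.
Qed.

Lemma continuous_potential_deriv i z : A z ->
  {for z, continuous (fun z : V * V => UU [:: i] z.1)}.
Proof.
move=> [Oz _]; apply: (@continuous_comp _ _ _ fst (UU [:: i])); first exact: cvg_fst.
exact: (jet_continuous Omega_open jU).
Qed.

Lemma continuous_liouville_of Df z : (forall a z, A z -> {for z, continuous (Df a)}) ->
  A z -> {for z, continuous (liouville_of Df)}.
Proof.
move=> cD Az; apply: cvgB; (apply: cvg_big => [|i _]; first exact: add_continuous).
  by apply: cvgM; [exact: cvg_coord2|exact: cD].
by apply: cvgM; [exact: continuous_potential_deriv|exact: cD].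
Qed.

Lemma growth_liouville_of Df : (forall a, growth Omega (Df a)) ->
  growth Omega (liouville_of Df).
Proof.
move=> gD; apply: growthD; last apply: growthN; apply: growth_sum => i.
  by apply: growthM; [exact: growth_coord|exact: gD].
apply: growthM; last exact: gD.
have := growthN (growth_dlog_weight Omega_bounded jU (inl i)).
by congr growth; apply/funext => z; rewrite opprK.
Qed.

Lemma liouville_in_L2 (mu : probability (V * V)%type R) c f Df :
  (forall E, measurable E ->
    mu E = \int[lam2]_(z in E `&` A) (c * w z)%:E)%E ->
  C1_phase Omega f Df -> (forall a, growth Omega (Df a)) ->
  in_L2 Omega mu (liouville U f).
Proof.
move=> muE C1f gD; have [_ _ cD] := C1f.
have := growth_in_L2 Omega_open Omega_bounded jU muE
  (fun z => continuous_liouville_of (z := z) cD) (growth_liouville_of gD).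
rewrite /in_L2 (_ : liouville_of Df \_ _ = liouville U f \_ (phase_domain Omega))//.
apply/funext => z; rewrite /patch; case: ifPn => //.
by rewrite inE => Az; rewrite (liouvilleE C1f Az).
Qed.

Lemma growth_gauss_family (I : finType) S (F : I -> V * V -> R) :
  S `<=` closure Omega -> (forall i, growth S (F i)) -> exists2 C, 0 <= C &
  forall i x v, S x -> `|F i (x, v) * w (x, v)| <= C * gauss (1 / 4) v.
Proof.
move=> SO gF.
have /choice[C CP] i : exists C, 0 <= C /\ forall x v, S x ->
    `|F i (x, v) * w (x, v)| <= C * gauss (1 / 4) v.
  by have [C C0 FC] := growth_gauss Omega_bounded jU SO (gF i); exists C.
exists (\sum_i C i); first by apply: sumr_ge0 => i _; have [] := CP i.
move=> i x v Sx; have [_ FC] := CP i; apply: le_trans (FC x v Sx) _.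
rewrite ler_wpM2r ?gauss_ge0// (bigD1 i)//= lerDl.
by apply: sumr_ge0 => j _; have [] := CP j.
Qed.

(** Extended by 0 outside [Omega], so that it is measurable on the whole space and defines a shear
    there. *)
Definition potential_gradient (x : V) : V := \row_i ((UU [:: i] \_ Omega) x).

Lemma measurable_potential_gradient : measurable_fun setT potential_gradient.
Proof.
apply/measurable_fun_coord_rVP => i.
rewrite (_ : _ \o _ = UU [:: i] \_ Omega); last first.
  by apply/funext => x; rewrite /coord_rV/= mxE.
apply/(measurable_restrictT _ (open_measurable_rV Omega_open)).
apply: continuous_measurable_rV => // x; rewrite inE => Ox.
exact: (jet_continuous Omega_open jU).
Qed.

Lemma potential_gradient_bound : exists2 K, 0 <= K &
  forall x, Omega x -> `|potential_gradient x| <= K.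
Proof.
have /choice[M MP] i : exists M, forall x, Omega x -> `|UU [:: i] x| <= M.
  have [_ _ /(_ [:: i] isT) cU] := jU.
  have [M _ UM] := closure_bounded Omega_bounded cU.
  by exists M => x Ox; apply: UM; exact: subset_closure.
exists (Num.sqrt (\sum_(i < d) M i ^+ 2)); first exact: sqrtr_ge0.
move=> x Ox; apply: le_trans (ler_norm_enorm _) _.
rewrite /enorm ler_wsqrtr// ler_sum// => i _.
rewrite mxE patchT ?inE// -expr2 -[leLHS]real_normK ?num_real//.
by rewrite lerXn2r ?nnegrE// ?MP// (le_trans _ (MP i x Ox)).
Qed.

Section balance.
Hypotheses (Omega_nonempty : Omega !=set0) (Omega_C21 : C21_boundary Omega).
Hypothesis Omega_convex : convex_set (Omega : set (convex_lmodType V)).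
Variables (f g : V * V -> R) (Df Dg : 'I_d + 'I_d -> V * V -> R).
Hypotheses (f_C1 : specular_C1 f Df) (g_C1 : specular_C1 g Dg).

Let H z := f z * g z * w z.
(** The derivative of [H] divided by the weight. It has polynomial growth, so multiplying by [w]
    yields the Gaussian bound on [DH]. *)
Let D a z := Df a z * g z + f z * Dg a z + f z * g z * dlog_weight UU a z.
Let DH a z := D a z * w z.

Let C1H : C1_phase Omega H DH.
Proof.
have [C1f _ _ _] := f_C1; have [C1g _ _ _] := g_C1.
have := C1_phaseM Omega_open (C1_phaseM Omega_open C1f C1g)
  (C1_phase_expR Omega_open (C1_phase_log_weight Omega_open jU)).
congr C1_phase; apply/funext => a; apply/funext => z.
by rewrite /DH /D /w; ring.
Qed.

(** The weight depends on [v] only through its length, which reflection preserves. *)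
Let H_specular x v : boundary Omega x -> H (x, v) = H (x, reflect_velocity Omega x v).
Proof.
move=> bx; have [_ _ _ fs] := f_C1; have [_ _ _ gs] := g_C1.
have [n1 _ _] := outward_normal_spec Omega_C21 bx.
by rewrite /H -fs// -gs// /w /log_weight/= dotv_reflect.
Qed.

Lemma liouville_balance :
  (\int[lam2]_(z in A) ((liouville_of Df z * g z + f z * liouville_of Dg z) * w z)%:E = 0)%E.
Proof.
have [_ gf gDf _] := f_C1; have [_ gg gDg _] := g_C1.
have OcO : Omega `<=` closure Omega by exact: subset_closure.
have gD a : growth Omega (D a).
  have gf' := growth_sub OcO gf; have gg' := growth_sub OcO gg.
  exact: (growthD (growthD (growthM (gDf a) gg') (growthM gf' (gDg a)))
    (growthM (growthM gf' gg') (growth_dlog_weight Omega_bounded jU a))).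
have [C1 C10 HC] := growth_gauss Omega_bounded jU (@subset_refl _ _) (growthM gf gg).
have [C2 C20 DHC] := growth_gauss_family OcO gD.
have [B B0 OB] := bounded_dotv Omega_bounded.
have [K K0 bK] := potential_gradient_bound.
have C0 : 0 <= C1 + C2 by exact: addr_ge0.
have HC' x v : closure Omega x -> `|H (x, v)| <= (C1 + C2) * gauss (1 / 4) v.
  move=> cx; apply: le_trans (HC x v cx) _.
  by rewrite ler_wpM2r ?gauss_ge0// lerDl.
have DHC' a x v : Omega x -> `|DH a (x, v)| <= (C1 + C2) * gauss (1 / 4) v.
  move=> Ox; apply: le_trans (DHC a x v Ox) _.
  by rewrite ler_wpM2r ?gauss_ge0// lerDr.
have [cH dH cDH] := C1H.
have [iX X0] := specular_transport Omega_nonempty Omega_open Omega_bounded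
  Omega_convex Omega_C21 cH dH cDH C0 HC' DHC' H_specular.
have [iL L0] := velocity_flow Omega_open OB cH dH cDH C0 HC' DHC'
  measurable_potential_gradient bK K0.
(* Writing 0 as the difference of the two vanishing integrals leaves a pointwise identity of
   integrands. *)
rewrite integral_mkcond -[RHS]sube0 -[X in (X - _)%E]X0 -[X in (_ - X)%E]L0.
rewrite -(integralB measurableT iX iL); apply: eq_integral => -[x v] _.
have [Ox|Ox] := pselect (Omega x); last first.
  rewrite [in RHS]/= !restrict_phaseN// subee// /patch ifF//.
  by apply/negP; rewrite inE => -[].
rewrite [in RHS]/= !restrict_phaseT// /patch ifT ?inE//.
rewrite -EFinB; congr EFin.
pose S1 := \sum_(i < d) v 0 i * Df (inl i) (x, v).
pose S2 := \sum_(i < d) UU [:: i] x * Df (inr i) (x, v).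
pose S3 := \sum_(i < d) v 0 i * Dg (inl i) (x, v).
pose S4 := \sum_(i < d) UU [:: i] x * Dg (inr i) (x, v).
(* The contribution of the weight: it enters both derivatives of [H] with the same sign, since
   $v\cdot\nabla_x(-U) = \nabla U\cdot\nabla_v(-|v|^2/2)$, and cancels in their difference. *)
pose P := \sum_(i < d) v 0 i * UU [:: i] x.
have -> : \sum_(i < d) v 0 i * DH (inl i) (x, v) =
    (S1 * g (x, v) + f (x, v) * S3 - f (x, v) * g (x, v) * P) * w (x, v).
  rewrite /S1 /S3 /P !mulr_sumr mulr_suml -big_split -sumrB mulr_suml.
  by apply: eq_bigr => i _; rewrite /DH /D /=; ring.
have -> : \sum_(i < d) potential_gradient x 0 i * DH (inr i) (x, v) =
    (S2 * g (x, v) + f (x, v) * S4 - f (x, v) * g (x, v) * P) * w (x, v).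
  rewrite /S2 /S4 /P !mulr_sumr mulr_suml -big_split -sumrB mulr_suml.
  apply: eq_bigr => i _; rewrite /DH /D /= mxE patchT ?inE//.
  by ring.
by rewrite /liouville_of /= -/S1 -/S2 -/S3 -/S4; ring.
Qed.

End balance.

End liouville.

Theorem lemma4 (R : realType) (d : nat) (Omega : set 'rV[R]_d)
    (U : 'rV[R]_d -> R) (mu : probability ('rV[R]_d * 'rV[R]_d)%type R)
    (f g : 'rV[R]_d * 'rV[R]_d -> R)
    (Omega_nonempty : Omega !=set0)
    (Omega_open : open Omega)
    (Omega_bounded : bounded_set Omega)
    (Omega_convex : convex_set (Omega : set (convex_lmodType 'rV[R]_d)))
    (Omega_C21 : C21_boundary Omega)
    (U_C2 : C2_closure Omega U)
    (mu_gibbs : gibbs_measure Omega U mu)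
    (f_spec : specular_class Omega f)
    (g_spec : specular_class Omega g) :
  [/\ in_L2 Omega mu f, in_L2 Omega mu g,
      in_L2 Omega mu (liouville U f), in_L2 Omega mu (liouville U g) &
      L2_inner Omega mu (liouville U f) g =
        - L2_inner Omega mu f (liouville U g)].
Proof.
have [UU jU] := U_C2; have [c muE] := mu_gibbs.
have [Df Cf] := specular_class_C1 Omega_open f_spec.
have [Dg Cg] := specular_class_C1 Omega_open g_spec.
have [C1f gf gDf _] := Cf; have [C1g gg gDg _] := Cg.
have gf' := growth_sub (@subset_closure _ Omega) gf.
have gg' := growth_sub (@subset_closure _ Omega) gg.
have cf z := C1_phase_continuous (z := z) Omega_open C1f.
have cg z := C1_phase_continuous (z := z) Omega_open C1g.
have mA := phase_domain_measurable Omega_open.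
split.
- exact: (growth_in_L2 Omega_open Omega_bounded jU muE).
- exact: (growth_in_L2 Omega_open Omega_bounded jU muE).
- exact: (liouville_in_L2 Omega_open Omega_bounded jU muE C1f).
- exact: (liouville_in_L2 Omega_open Omega_bounded jU muE C1g).
have gLf := growth_liouville_of Omega_bounded jU gDf.
have gLg := growth_liouville_of Omega_bounded jU gDg.
have cLf z : phase_domain Omega z -> {for z, continuous (liouville_of UU Df)}.
  by have [_ _ cD] := C1f; exact: (continuous_liouville_of Omega_open jU).
have cLg z : phase_domain Omega z -> {for z, continuous (liouville_of UU Dg)}.
  by have [_ _ cD] := C1g; exact: (continuous_liouville_of Omega_open jU).
pose k1 z := liouville_of UU Df z * g z; pose k2 z := f z * liouville_of UU Dg z.
have ck1 z : phase_domain Omega z -> {for z, continuous k1}.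
  by move=> Az; apply: cvgM; [exact: cLf|exact: cg].
have ck2 z : phase_domain Omega z -> {for z, continuous k2}.
  by move=> Az; apply: cvgM; [exact: cf|exact: cLg].
have ck z : phase_domain Omega z -> {for z, continuous (fun z => k1 z + k2 z)}.
  by move=> Az; apply: cvgD; [exact: ck1|exact: ck2].
have gk1 : growth Omega k1 := growthM gLf gg'.
have gk2 : growth Omega k2 := growthM gf' gLg.
have i1 := gibbs_integrable Omega_open Omega_bounded jU muE ck1 gk1.
have i2 := gibbs_integrable Omega_open Omega_bounded jU muE ck2 gk2.
have E1 : L2_inner Omega mu (liouville U f) g = \int[mu]_(z in phase_domain Omega) k1 z.
  apply: eq_Rintegral => z; rewrite inE => Az.
  by rewrite (liouvilleE Omega_open jU C1f).
have E2 : L2_inner Omega mu f (liouville U g) = \int[mu]_(z in phase_domain Omega) k2 z.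
  apply: eq_Rintegral => z; rewrite inE => Az.
  by rewrite (liouvilleE Omega_open jU C1g).
(* Antisymmetry amounts to the vanishing of the sum; as both products are integrable, it is a single
   integral, to which [liouville_balance] applies. *)
rewrite E1 E2; apply/eqP; rewrite -addr_eq0 -RintegralD//; apply/eqP.
rewrite /Rintegral (gibbs_integral Omega_open Omega_bounded jU muE ck (growthD gk1 gk2)).
rewrite (liouville_balance Omega_open Omega_bounded jU Omega_nonempty Omega_C21
  Omega_convex Cf Cg).
by rewrite mule0.
Qed.
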